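(* Let $E,F$ be locally convex spaces, assume $F$ to be complete and let $U$ be an open subset of $E$. Then $\mathcal{C}^\infty(U,F)$ is complete with respect to the topology $\tau^\infty$ of uniform $F$-convergence of all differentials on subsets of the form $K\times B$ where $K$ is a compact subset of $U$ and $B$ is bounded in the appropriate product $E^n=E\times\dots\times E$. Moreover, for each $p\in\mathbb{N}$, the operator $\mathrm{d}^p:\mathcal{C}^\infty(U,F)\to\mathcal{C}^\infty(U,L^p(E^p,F))$ is continuous if both the domain and the range space carry the respective topology $\tau^\infty$.
   Context: Calculus is that of convenient vector spaces (Kriegl–Michor): a map $f:U\to F$ is smooth if it maps smooth curves in $U$ to smooth curves in $F$; $\mathcal{C}^\infty(U,F)$ is the space of all smooth maps. $L^n(E^n,F)$ denotes the space of $n$-linear bounded maps $E\times\dots\times E$ ($n$ factors) $\to F$, with the topology of uniform convergence on bounded sets; $L^0(E^0,F):=F$. For smooth $f:U\to F$ the $n$-th differential $\mathrm{d}^nf$ belongs to $\mathcal{C}^\infty(U,L^n(E^n,F))$. On $\mathcal{C}^\infty(U,L^n(E^n,F))$ let $\tau^n_{cb}$ be the topology of uniform $F$-convergence (of maps $(x,v_1,\dots,v_n)\mapsto g(x)(v_1,\dots,v_n)$) on subsets of the form $K\times B$ where $K$ is a compact subset of $U$ and $B$ is bounded in $E^n$. The topology $\tau^\infty$ on $\mathcal{C}^\infty(U,F)$ is the initial (locally convex) topology induced by the family of maps $\mathrm{d}^n:\mathcal{C}^\infty(U,F)\to(\mathcal{C}^\infty(U,L^n(E^n,F)),\tau^n_{cb})$,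 $n\ge0$. *)

(* Defs.v *)
From HB Require Import structures.
From mathcomp Require Import all_boot all_order all_algebra finmap.
From mathcomp Require Import all_classical all_reals all_analysis.

Set Implicit Arguments.
Unset Strict Implicit.
Unset Printing Implicit Defensive.

Import Order.TTheory GRing.Theory Num.Theory.
Import numFieldNormedType.Exports.

Local Open Scope classical_set_scope.
Local Open Scope ring_scope.

(* A [tvsType] carries a uniform structure that is only required to induce its
   topology. Uniform continuity of the addition forces it to be the translation
   invariant one, so that [cauchy] has its usual meaning in a topological vector
   space. Locally convex spaces are Hausdorff by convention. *)
HB.mixin Record Tvs_isLcs (R : numFieldType) E & Tvs R E := {
  lcs_add_unif_continuous : unif_continuous (fun xy : E * E => xy.1 + xy.2) ;
  lcs_hausdorff : hausdorff_space E
}.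

#[short(type="lcsType")]
HB.structure Definition Lcs (R : numFieldType) :=
  {E of Tvs R E & Tvs_isLcs R E}.

Definition uniform_complete (T : uniformType) : Prop :=
  forall Phi : set_system T, ProperFilter Phi -> cauchy Phi ->
    exists x : T, Phi --> x.

(* Von Neumann boundedness: every neighborhood of 0 absorbs [B]. *)
Definition tvs_bounded (R : numFieldType) (V : NbhsLmodule.type R)
    (B : set V) : Prop :=
  forall W : set V, nbhs 0 W ->
    exists2 r : R, 0 < r & forall s : R, r < `|s| -> B `<=` *:%R s @` W.

(* The n-fold product E x ... x E, with the product topology. *)
Definition epow (E : Type) (n : nat) : Type := prod_topology (fun _ : 'I_n => E).

HB.instance Definition _ (E : uniformType) (n : nat) :=
  Uniform.copy (epow E n) (prod_topology (fun _ : 'I_n => E)).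
HB.instance Definition _ (R : numFieldType) (E : lmodType R) (n : nat) :=
  GRing.Lmodule.copy (epow E n) ('I_n -> E).
HB.instance Definition _ (R : numFieldType) (E : lcsType R) (n : nat) :=
  Uniform.on (epow E n).


Section tvs_bounded_theory.
Context {R : numFieldType} {V : NbhsLmodule.type R}.
Implicit Types A B : set V.

Lemma tvs_boundedS A B : A `<=` B -> tvs_bounded B -> tvs_bounded A.
Proof.
by move=> AB bB W /bB[r r0 h]; exists r => // s /h /(subset_trans AB).
Qed.

Lemma tvs_boundedU A B : tvs_bounded A -> tvs_bounded B ->
  tvs_bounded (A `|` B).
Proof.
move=> bA bB W W0; have [r r0 rA] := bA W W0; have [s s0 sB] := bB W W0.
exists (r + s); first exact: addr_gt0.
move=> t rst x [Ax|Bx].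
- by apply: rA Ax; apply: lt_trans rst; rewrite ltrDl.
- by apply: sB Bx; apply: lt_trans rst; rewrite ltrDr.
Qed.

End tvs_bounded_theory.

Section lcs_theory.
Context {R : numFieldType} {V : lcsType R}.
Implicit Types (A B : set V) (W : set V).

Lemma nbhs0_entourage (P : set (V * V)) : entourage P ->
  exists2 W : set V, nbhs 0 W & forall x y, W (y - x) -> P (x, y).
Proof.
move=> eP; have [[A B]/= [eA eB] AB] := @lcs_add_unif_continuous R V P eP.
exists (xsection A 0); first exact: nbhs_entourage.
move=> x y /xsectionP Ayx.
have /AB : (A `*` B) ((0, y - x), (x, x)) by split=> //=; exact: entourage_refl.
by case=> -[[a b] [c d]]/= + [] ? ? ? ?; subst; rewrite add0r subrK.
Qed.

Lemma entourage_nbhs0 W : nbhs 0 W ->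
  entourage [set xy : V * V | W (xy.2 - xy.1)].
Proof.
rewrite -nbhs_entourageE => -[P eP PW].
have [[A B]/= [eA eB] AB] := @lcs_add_unif_continuous R V P eP.
apply: filterS eA => -[x y] Axy /=; apply/PW/xsectionP.
have /AB : (A `*` B) ((x, y), (- x, - x)).
  by split=> //=; exact: entourage_refl.
by case=> -[[a b] [c d]]/= + [] ? ? ? ?; subst; rewrite subrr.
Qed.

Lemma nbhs0_split W : nbhs 0 W -> exists2 W', nbhs 0 W' &
  forall x y, W' x -> W' y -> W (x + y).
Proof.
move=> W0; have /= := @add_continuous V (0, 0) W; rewrite addr0 => /(_ W0).
case=> -[A B]/= [A0 B0] AB; exists (A `&` B); first exact: filterI.
by move=> x y [Ax _] [_ By]; exact: (AB (x, y)).
Qed.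

Lemma tvs_bounded0 : tvs_bounded [set (0 : V)].
Proof.
move=> W W0; exists 1 => // s _ _ ->; exists 0; last by rewrite scaler0.
exact: nbhs_singleton W0.
Qed.

Lemma tvs_boundedD A B : tvs_bounded A -> tvs_bounded B ->
  tvs_bounded [set x + y | x in A & y in B].
Proof.
move=> bA bB W /nbhs0_split[W' W'0 W'W].
have [r r0 rA] := bA W' W'0; have [s s0 sB] := bB W' W'0.
exists (r + s); first exact: addr_gt0.
move=> t rst _ [x Ax [y By] <-].
have [|u Wu <-] := rA t _ x Ax; first by apply: lt_trans rst; rewrite ltrDl.
have [|v Wv <-] := sB t _ y By; first by apply: lt_trans rst; rewrite ltrDr.
by exists (u + v); [exact: W'W|rewrite scalerDr].
Qed.

Lemma tvs_boundedZ a A : tvs_bounded A -> tvs_bounded [set a *: x | x in A].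
Proof.
have [->|a0] := eqVneq a 0.
  move=> _; apply: tvs_boundedS tvs_bounded0 => _ [x _ <-] /=.
  by rewrite scale0r.
move=> bA W W0; have [|r r0 rA] := bA ( *:%R a^-1 @` W).
  by apply: nbhs0Z => //; rewrite invr_eq0.
exists r => // s /rA {}rA _ [x /rA[_ [w Ww <-] <-] <-].
by exists w => //; rewrite !scalerA mulrAC divff// mul1r.
Qed.

End lcs_theory.

Lemma tvs_bounded1_epow {R : numFieldType} {E : lcsType R} n (v : epow E n) :
  tvs_bounded [set v].
Proof.
move=> W W0.
have cv : (t *: v @[t --> (0 : R^o)]) --> (0 : epow E n).
  apply/cvg_sup; first exact/fmap_filter/(nbhs_filter (0 : R^o)).
  move=> i; pose f (t : R^o) : initial_topology (@proj _ (fun _ : 'I_n => E) i) := t *: v.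
  have /(_ 0) : continuous f.
    apply: continuous_comp_initial => t.
    apply: (@continuous_comp R^o (R^o * E)%type E (fun t => (t, v i))
      (fun z => z.1 *: z.2)); last exact: scale_continuous.
    apply: (@cvg_pair _ _ _ _ (nbhs (t : R^o))).
    - exact: (nbhs_filter (t : R^o)).
    - exact: cvg_id.
    - have := @cvg_cst E (v i) R^o (nbhs (t : R^o)) _.
      by apply; exact: (nbhs_filter (t : R^o)).
  by rewrite /continuous_at /f scale0r.
have := cv W W0; rewrite /= -nbhs_ballE => -[e /= e0 eW].
exists e^-1; first by rewrite invr_gt0.
move=> s es _ ->; have s0 : s != 0.
  by rewrite -normr_gt0; apply: lt_trans es; rewrite invr_gt0.
exists (s^-1 *: v); last by rewrite scalerA divff// scale1r.
apply: (eW s^-1); rewrite -ball_normE/= sub0r normrN normfV.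
by rewrite -[ltRHS]invrK ltf_pV2 ?posrE ?invr_gt0// normr_gt0.
Qed.

Section bounded_multilinear_map.
Context {R : numFieldType}.
Implicit Types E F : lcsType R.

Definition multilinear_map {E F} (n : nat) (f : epow E n -> F) : Prop :=
  forall (i : 'I_n) (v : epow E n),
    linear (fun x : E => f (@dfwith _ (fun _ => E) v i x)).

Definition bounded_map {E F} (n : nat) (f : epow E n -> F) : Prop :=
  forall B : set (epow E n), tvs_bounded B -> tvs_bounded (f @` B).

Definition bmlin_pred E F (n : nat) : pred (epow E n -> F) :=
  fun f => `[< multilinear_map f /\ bounded_map f >].

(* L^n(E^n, F) *)
Record bmlin E F (n : nat) := Bmlin {
  bmlin_fun :> epow E n -> F ;
  _ : bmlin_fun \in @bmlin_pred E F n }.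

HB.instance Definition _ E F n := [isSub for @bmlin_fun E F n].
HB.instance Definition _ E F n := [Choice of bmlin E F n by <:].

Lemma bmlin_pred_submod E F n : submod_closed (@bmlin_pred E F n).
Proof.
split.
  apply/asboolP; split=> [i v a x y|B _].
    by rewrite /= scaler0 addr0.
  by apply: tvs_boundedS tvs_bounded0 => _ [x _ <-].
move=> a f g /asboolP[lf bf] /asboolP[lg bg]; apply/asboolP; split.
  move=> i v b x y; rewrite /= !fctE lf lg !scalerDr !scalerA mulrC.
  by rewrite addrACA.
move=> B bB; apply: tvs_boundedS (tvs_boundedD (tvs_boundedZ a (bf _ bB)) (bg _ bB)).
move=> _ [x Bx <-]; exists (a *: f x); first by exists (f x) => //; exists x.
by exists (g x) => //; exists x.
Qed.

HB.instance Definition _ E F n :=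
  GRing.isSubmodClosed.Build R (epow E n -> F) (@bmlin_pred E F n)
    (@bmlin_pred_submod E F n).
HB.instance Definition _ E F n := [SubChoice_isSubLmodule of bmlin E F n by <:].

(* Uniform convergence on the bounded subsets of E^n. *)
HB.instance Definition _ E F n := Uniform.copy (bmlin E F n)
  (initial_topology (@bmlin_fun E F n :
     _ -> {family (@tvs_bounded R (epow E n)), epow E n -> F})).

Lemma bmlin_entourageP E F n (A : set (bmlin E F n * bmlin E F n)) :
  entourage A <-> exists (B : set (epow E n)) (W : set F), [/\ tvs_bounded B, nbhs 0 W &
    forall f g : bmlin E F n, (forall v, B v -> W (g v - f v)) -> A (f, g)].
Proof.
split=> [[V [_ [S _ <-] SV] VA]|[B [W [bB W0 BWA]]]].
  suff [B [W [bB W0 BW]]] : exists (B : set (epow E n)) (W : set F), [/\ tvs_bounded B, nbhs 0 W &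
      forall f g : bmlin E F n, (forall v, B v -> W (g v - f v)) ->
      forall p, p \in enum_fset S -> (projT1 p).2 (bmlin_fun f, bmlin_fun g)].
    exists B, W; split=> // f g /BW BWfg; apply: VA; apply: SV => p pS.
    exact: BWfg.
  elim: (enum_fset S) => [|p s [B [W [bB W0 BW]]]].
    exists set0, setT; split=> //; last exact: filterT.
    by move=> ? ?; exists 1 => // ? _ ? [].

  have := projT2 p => /asboolP; rewrite uniform_entourage => -[P eP Pp].
  have [W1 W10 W1P] := nbhs0_entourage eP.
  exists (projT1 (projT1 p).1 `|` B), (W1 `&` W); split.
  - by apply: tvs_boundedU => //; exact: (projT2 (projT1 p).1).
  - exact: filterI.
  - move=> f g BWfg q; rewrite in_cons => /orP[/eqP ->|].
      by apply: Pp => v Bv; apply: W1P; apply: (BWfg v _).1; left.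
    by apply: BW => v Bv; apply: (BWfg v _).2; right.
exists [set fg : (epow E n -> F) * (epow E n -> F) |
    forall v, B v -> W (fg.2 v - fg.1 v)]; last by case=> f g; exact: BWA.
set P := (X in entourage X).
have eP : @entourage {uniform` B -> F} P.
  rewrite uniform_entourage.
  by exists [set xy | W (xy.2 - xy.1)]; first exact: entourage_nbhs0.
pose k := existT (@tvs_bounded R (epow E n)) B bB.
rewrite /entourage/=.
exists P => //.
have kP : `[< @entourage {uniform` projT1 (k, P).1 -> F} (k, P).2 >].
  exact/asboolP.
pose p : {p : {classic {x : set (epow E n) & tvs_bounded x}} *
              set ((epow E n -> F) * (epow E n -> F)) |
    `[< @entourage {uniform` projT1 p.1 -> F} p.2 >]} := exist _ (k, P) kP.
refine (@finI_from1 _ _ _ _ p I).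
Qed.

Lemma bmlin_nbhsP E F n (f : bmlin E F n) (A : set (bmlin E F n)) :
  nbhs f A <-> exists (B : set (epow E n)) (W : set F), [/\ tvs_bounded B, nbhs 0 W &
    forall g : bmlin E F n, (forall v, B v -> W (g v - f v)) -> A g].
Proof.
rewrite -nbhs_entourageE; split.
  move=> [P eP PA]; have [B [W [bB W0 BWP]]] := (bmlin_entourageP P).1 eP.
  by exists B, W; split=> // g /BWP Pfg; apply/PA/xsectionP.
move=> [B [W [bB W0 BWA]]].
exists [set fg : bmlin E F n * bmlin E F n |
  forall v, B v -> W (fg.2 v - fg.1 v)].
  by apply/bmlin_entourageP; exists B, W.
by move=> g /xsectionP; exact: BWA.
Qed.

Lemma bmlin_bounded E F n (f : bmlin E F n) : bounded_map f.
Proof. by case: f => f fP; have /asboolP[] := fP. Qed.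

Lemma bmlin_add_unif_continuous E F n :
  unif_continuous (fun fg : bmlin E F n * bmlin E F n => fg.1 + fg.2).
Proof.
move=> A eA; have [B [W [bB W0 BWA]]] := (bmlin_entourageP A).1 eA.
have [W' W'0 W'W] := nbhs0_split W0.
pose P := [set fg : bmlin E F n * bmlin E F n |
  forall v, B v -> W' (fg.2 v - fg.1 v)].
have eP : entourage P by apply/bmlin_entourageP; exists B, W'.
exists (P, P) => //= -[[f1 f2] [g1 g2]]/= [Pf Pg].
exists ((f1, g1), (f2, g2)) => //=; apply: BWA => v Bv.
rewrite [X in W X](_ : _ = (f2 v - f1 v) + (g2 v - g1 v)).
  by apply: W'W; [exact: Pf|exact: Pg].
by rewrite /= opprD addrACA.
Qed.

Lemma bmlin_add_continuous E F n :
  continuous (fun fg : bmlin E F n * bmlin E F n => fg.1 + fg.2).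
Proof.
move=> [f g] A /bmlin_nbhsP[B [W [bB /nbhs0_split[W' W'0 W'W] BWA]]].
exists ([set h : bmlin E F n | forall v, B v -> W' (h v - f v)],
        [set h : bmlin E F n | forall v, B v -> W' (h v - g v)]).
  by split; apply/bmlin_nbhsP; exists B, W'.
move=> [h k]/= [Bh Bk]; apply: BWA => v Bv.
rewrite [X in W X](_ : _ = (h v - f v) + (k v - g v)).
  by apply: W'W; [exact: Bh|exact: Bk].
by rewrite /= opprD addrACA.
Qed.

Lemma bmlin_scale_continuous E F n :
  continuous (fun z : R^o * bmlin E F n => z.1 *: z.2).
Proof.
move=> [r f] A /bmlin_nbhsP[B [W [bB /nbhs0_split[W' W'0 W'W] BWA]]].
have := @scale_continuous R F (r, 0) W'; rewrite /= scaler0 => /(_ W'0).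
move=> [[S T]/= [Sr T0] ST].
have [rho rho0 fBW'] := bmlin_bounded f bB W'0.
exists (S `&` [set s : R^o | `|s - r| < rho^-1],
        [set g : bmlin E F n | forall v, B v -> T (g v - f v)]).
  split; last by apply/bmlin_nbhsP; exists B, T.
  apply: filterI => //.
  rewrite -nbhs_ballE; exists rho^-1; first by rewrite /= invr_gt0.
  by move=> s /=; rewrite -ball_normE/= distrC.
move=> [s g]/= [[Ss sr] BT]; apply: BWA => v Bv.
rewrite [X in W X](_ : _ = s *: (g v - f v) + (s - r) *: f v); last first.
  by rewrite /= scalerBr scalerBl addrA subrK.
apply: W'W; first by apply: (ST (s, g v - f v)); split=> //; exact: BT.
have [->|sr0] := eqVneq s r.
  by rewrite subrr scale0r; exact: nbhs_singleton W'0.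
have sr1 : s - r != 0 by rewrite subr_eq0.
have [||w Ww <-] := fBW' (s - r)^-1 _ (f v).
- rewrite normfV -[ltLHS]invrK ltf_pV2 ?posrE ?invr_gt0//.
  by rewrite normr_gt0.
- by exists v.
- by rewrite scalerA divff// scale1r.
Qed.

Lemma bmlin_locally_convex E F n : exists2 S : set_system (bmlin E F n),
  (forall b, b \in S -> convex_set b) & basis S.
Proof.
have [S Sc [So Sb]] := @locally_convex R F.
have S0 (W : set F) : nbhs 0 W -> exists2 C, C `<=` W & nbhs 0 C /\ S C.
  move=> /Sb[C [SC C0] CW]; exists C => //; split=> //.
  by apply: open_nbhs_nbhs; split=> //; exact: So.
pose base (f : bmlin E F n) B C := [set g : bmlin E F n |
  forall v, B v -> C (g v - f v)].
exists [set A | exists f B C, [/\ tvs_bounded B, nbhs 0 C, S C &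
    A = interior (base f B C)]].
  move=> A; rewrite inE => -[f [B [C [bB C0 SC ->]]]].
  have conv (g h : bmlin E F n) (l : {i01 R}) : base f B C g -> base f B C h ->
      base f B C (l%:num *: g + (1 - l%:num) *: h).
    move=> Bg Bh v Bv.
    have := Sc C (mem_set SC) (g v - f v) (h v - f v) l
      (mem_set (Bg v Bv)) (mem_set (Bh v Bv)).
    rewrite inE; congr (C _); rewrite /conv/= !scalerBr addrACA -opprD.
    by rewrite -scalerDl (addrC l%:num) subrK scale1r.
  apply/convex_setW => g h /[!inE] gA hA l l0 l1.
  have l0' : l%:num != 0 by rewrite gt_eqF.
  have [B' [W [bB' W0 gW]]] := (bmlin_nbhsP _ _).1 gA.
  suff : nbhs (l%:num *: g + (1 - l%:num) *: h : bmlin E F n) (base f B C).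
    by move=> H; apply/mem_set; exact: H.
  apply/bmlin_nbhsP; exists B', ( *:%R l%:num @` W); split=> //.
    exact: nbhs0Z.
  move=> k kW; pose k' := l%:num^-1 *: (k - (1 - l%:num) *: h).
  have -> : k = l%:num *: k' + (1 - l%:num) *: h.
    by rewrite scalerA divff// scale1r subrK.
  apply: conv (interior_subset hA); apply: gW => v /kW[w Ww].
  rewrite [X in _ = X -> _](_ : _ = l%:num *: (k' v - g v)); last first.
    rewrite scalerBr /= scalerA divff// scale1r opprD addrA.
    by rewrite addrAC.
  by move=> /(scalerI l0') <-.
split; first by move=> A [f [B [C [_ _ _ ->]]]]; exact: open_interior.
move=> f A /bmlin_nbhsP[B [W [bB /S0[C CW [C0 SC]] BWA]]].
exists (interior (base f B C)).
  split; first by exists f, B, C.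
  by apply/bmlin_nbhsP; exists B, C.
by move=> g /interior_subset fg; apply: BWA => v /fg; exact: CW.
Qed.

Lemma bmlin_hausdorff E F n : hausdorff_space (bmlin E F n).
Proof.
move=> f g fg; apply/val_inj/funext => v /=; apply: (@lcs_hausdorff R F).
move=> A B; rewrite -!nbhs_entourageE => -[P eP PA] [Q eQ QB].
have [W W0 WP] := nbhs0_entourage eP; have [Z Z0 ZQ] := nbhs0_entourage eQ.
have bv : tvs_bounded [set v].
  exact: tvs_bounded1_epow.
have [||h [hA hB]] := fg [set h : bmlin E F n | A (h v)] [set h | B (h v)].
- by apply/bmlin_nbhsP; exists [set v], W; split=> // h /(_ v erefl) /WP/xsectionP/PA.
- by apply/bmlin_nbhsP; exists [set v], Z; split=> // h /(_ v erefl) /ZQ/xsectionP/QB.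
- by exists (h v).
Qed.

HB.instance Definition _ E F n :=
  PreTopologicalNmodule_isTopologicalNmodule.Build (bmlin E F n)
    (@bmlin_add_continuous E F n).
HB.instance Definition _ E F n :=
  TopologicalNmodule_isTopologicalLmodule.Build R (bmlin E F n)
    (@bmlin_scale_continuous E F n).
HB.instance Definition _ E F n :=
  Uniform_isTvs.Build R (bmlin E F n) (@bmlin_locally_convex E F n).
HB.instance Definition _ E F n :=
  Tvs_isLcs.Build R (bmlin E F n)
    (@bmlin_add_unif_continuous E F n) (@bmlin_hausdorff E F n).

End bounded_multilinear_map.

Section differential.
Context {R : realType}.
Implicit Types E F V : lcsType R.

(* The limit of [Phi], or 0 if there is none ([lim] needs a pointed type). *)
Definition flim V (Phi : set_system V) : V := xget 0 [set l : V | Phi --> l].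

Definition curve_quotient V (c : R -> V) (t h : R) : V :=
  h^-1 *: (c (t + h) - c t).

Definition curve_derive V (c : R -> V) (t : R) : V :=
  flim (curve_quotient c t h @[h --> 0^']).

Definition smooth_curve V (c : R -> V) : Prop :=
  forall (n : nat) (t : R), exists l : V,
    curve_quotient (iter n (@curve_derive V) c) t h @[h --> 0^'] --> l.

Definition smooth E (U : set E) F (f : U -> F) : Prop :=
  forall c : R -> U, smooth_curve (fun t => \val (c t)) ->
    smooth_curve (fun t => f (c t)).

(* ['valL_0 f] extends [f] by 0 outside [U]; when [U] is open, the extension
   does not affect the limit. *)
Definition dir_derive E (U : set E) F (f : U -> F) (x : U) (v : E) : F :=
  flim (h^-1 *: ('valL_0 f (\val x + h *: v) - f x) @[h --> (0 : R)^']).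

(* [differential f x v] is d^n f(x)(v_0, ..., v_(n-1)); the recursion reads
   d^(m+1) f(x)(v_0, ..., v_m) = d(d^m f)(x)(v_0)(v_1, ..., v_m). *)
Fixpoint differential E (U : set E) F (n : nat) (f : U -> F) :
    U -> epow E n -> F :=
  match n with
  | 0 => fun x _ => f x
  | m.+1 => fun x v =>
      dir_derive (fun y => differential f y (fun i : 'I_m => v (lift ord0 i)))
        x (v ord0)
  end.

Definition Cinfty E (U : set E) F : Type :=
  set_type [set f : U -> F | smooth f].

Definition compact_bounded E (U : set E) (n : nat) : set (set (U * epow E n)) :=
  [set S | exists (K : set E) (B : set (epow E n)),
    [/\ compact K, K `<=` U, tvs_bounded B & S = (\val @^-1` K) `*` B]].

HB.instance Definition _ E (U : set E) F := Choice.on (Cinfty U F).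

Definition uncurried_differential E (U : set E) F (n : nat) (f : Cinfty U F) :
    {family @compact_bounded E U n, (U * epow E n)%type -> F} :=
  fun xv => differential (\val f) xv.1 xv.2.

(* tau^oo, with its uniform structure: the initial one for the maps
   f |-> ((x, v) |-> d^n f(x)(v)), n >= 0, where the target carries the
   structure of uniform convergence on the sets K x B. This uniform structure is
   translation invariant, but [Cinfty U F] is not made a [tvsType]: if the
   topology of E is not bornological, d^n f may be unbounded on K x B, and then
   the scalar multiplication is not continuous. *)
HB.instance Definition _ E (U : set E) F := Uniform.copy (Cinfty U F)
  (sup_topology (fun n : nat =>
     Uniform.class (initial_topology (@uncurried_differential E U F n)))).

End differential.

(* Main.v *)
From HB Require Import structures.
Require Import Defs.
From mathcomp Require Import all_boot all_order all_algebra.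
From mathcomp Require Import all_classical all_reals all_analysis.
From mathcomp Require Import ring lra zify.

Set Implicit Arguments.
Unset Strict Implicit.
Unset Printing Implicit Defensive.

Import Order.TTheory GRing.Theory Num.Theory.
Import numFieldNormedType.Exports.

Local Open Scope classical_set_scope.
Local Open Scope ring_scope.

(** Everything is reduced to the behaviour of smooth maps along curves.

    Smoothness of [f : U -> F] is tested on smooth curves only, so the first
    task is to show that the directional derivative [df(x)(v)] depends smoothly
    on [(x, v)], is linear in [v] and obeys the chain rule. The heart of the
    matter is a function [k(s, t)] of two real variables that is smooth along
    smooth curves: its partial derivative [dleft k] at [s = 0] is smooth in [t]
    ([smooth_dleft]). Pure partial derivatives of all orders of [k] are locally
    bounded ([locally_bounded2]), because a smooth curve can be led through any
    rapidly converging sequence of points ([plateau_curve], [traverse]), and a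
    blow-up of the derivatives along the sequence would show in the derivatives
    of the composite. The difference quotients of [k] at [s = 2 ^- n] then
    converge at a geometric rate, while their derivatives in [t] grow at most
    geometrically; the interpolation inequality [landau] turns this into
    geometric convergence of all derivatives in [t], and completeness of [F]
    provides the limits. The derivative of [k(t, t)] ([der_diag]) follows. It
    gives additivity of [df(x)] and, since a smooth curve has the form
    [c(t + h) = c(t) + h q(h)] with [q] smooth ([hadamard]), the chain rule.

    By induction [d^n f(x)(v_1, ..., v_n)] is smooth along curves in all its
    variables ([csmooth_dext]), multilinear, and satisfies the Leibniz rule
    ([der_dcurve]): its derivative along curves is a sum of values of
    [d^(n+1) f] and [d^n f] along curves.

    Completeness: along a Cauchy filter all the differentials converge,
    uniformly on the sets [K x B]. By the Leibniz rule, derivatives of the curves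
    [d^n f(c)(w)] are controlled by such sets, so that the limits [g_n] satisfy
    the same rule ([der_limit_curve]). Hence [g_0] is smooth, and its
    differentials are the [g_n].

    The differential as a map: leading a curve through rapidly shrinking
    multiples of vectors of a bounded set [B] shows that the derivatives of
    [d^p f(c(t))(v)] are locally bounded in [t] uniformly in [v] in [B]
    ([locally_bounded_on]). So [d^p f(x)] is bounded, and the derivatives along
    curves exist uniformly on [B], that is, in the space of bounded multilinear
    maps. Therefore [d^p f] is smooth, [d^m (d^p f)(x)(w)(v) = d^(m+p) f(x)(w, v)]
    ([differential_Df]), and continuity of [d^p] is immediate, as the product of
    a bounded set of [E^m] and one of [E^p] is bounded in [E^(m+p)]. *)

(** * Linear identities in modules *)

Section linear_expressions.
Variables (R : comNzRingType) (V : lmodType R).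

Inductive lexp :=
  LVar of nat | LZero | LAdd of lexp & lexp | LOpp of lexp | LScale of R & lexp.

Fixpoint leval (env : seq V) e : V := match e with
  | LVar i => nth 0 env i
  | LZero => 0
  | LAdd a b => leval env a + leval env b
  | LOpp a => - leval env a
  | LScale k a => k *: leval env a
  end.

Fixpoint lcoef e (i : nat) : R := match e with
  | LVar j => if eqn i j then 1 else 0
  | LZero => 0
  | LAdd a b => lcoef a i + lcoef b i
  | LOpp a => - lcoef a i
  | LScale k a => k * lcoef a i
  end.

Lemma lcoefE env e :
  leval env e = \sum_(0 <= i < size env) lcoef e i *: nth 0 env i.
Proof.
elim: e => [j||a IHa b IHb|a IHa|k a IHa] /=.
- have [js|js] := ltnP j (size env).
    rewrite big_mkord (bigD1 (Ordinal js)) //= -[eqn j j]/(j == j) eqxx scale1r.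
    rewrite big1 ?addr0// => i; rewrite -val_eqE /= -[eqn i j]/(val i == j).
    by move=> /negbTE ->; rewrite scale0r.
  rewrite nth_default// big_nat big1// => i /andP[_ ij].
  rewrite -[eqn i j]/(i == j) ltn_eqF ?scale0r//; exact: leq_trans js.
- by rewrite big1// => i _; rewrite scale0r.
- by rewrite IHa IHb -big_split; apply: eq_bigr => i _; rewrite scalerDl.
- by rewrite IHa -sumrN; apply: eq_bigr => i _; rewrite scaleNr.
- by rewrite IHa scaler_sumr; apply: eq_bigr => i _; rewrite scalerA.
Qed.

(** Recursion on the number of vectors, so that on a concrete list it reduces to
    a conjunction of scalar equations. *)
Fixpoint same_coef e1 e2 (n : nat) : Prop :=
  match n with 0 => True | m.+1 => lcoef e1 m = lcoef e2 m /\ same_coef e1 e2 m end.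

Lemma leval_eq env e1 e2 : same_coef e1 e2 (size env) ->
  leval env e1 = leval env e2.
Proof.
rewrite !lcoefE; elim: (size env) => [|n IH] /= h; first by rewrite !big_geq.
by rewrite !big_nat_recr//= h.1 IH//; case: h.
Qed.

End linear_expressions.

Ltac lm_mem x l :=
  match l with
  | nil => constr:(false)
  | x :: _ => constr:(true)
  | _ :: ?l' => lm_mem x l'
  end.
Ltac lm_insert x l :=
  match lm_mem x l with
  | true => l
  | false => constr:(x :: l)
  end.
Ltac lm_index x l :=
  match l with
  | x :: _ => constr:(0%N)
  | _ :: ?l' => let i := lm_index x l' in constr:(S i)
  end.
Ltac lm_atoms t l :=
  lazymatch t with
  | (?a + ?b)%R => let l1 := lm_atoms b l in lm_atoms a l1
  | (- ?a)%R => lm_atoms a l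
  | (_ *: ?a)%R => lm_atoms a l
  | 0%R => l
  | _ => lm_insert t l
  end.
Ltac lm_reify R t l :=
  lazymatch t with
  | (?a + ?b)%R => let x := lm_reify R a l in let y := lm_reify R b l in
      constr:(@LAdd R x y)
  | (- ?a)%R => let x := lm_reify R a l in constr:(@LOpp R x)
  | (?k *: ?a)%R => let x := lm_reify R a l in constr:(@LScale R k x)
  | 0%R => constr:(@LZero R)
  | _ => let i := lm_index t l in constr:(@LVar R i)
  end.
(** Proves an equality between linear combinations by comparing coefficients,
    leaving one scalar equation for each vector. *)
Ltac lm_coefs R V :=
  match goal with
  | |- ?a = ?b =>
    let l0 := lm_atoms a (@nil V) in
    let l := lm_atoms b l0 in
    let x := lm_reify R a l in
    let y := lm_reify R b l in
    refine (@leval_eq R V l x y _); cbn [lcoef same_coef size eqn]; repeat split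
  end.
Ltac lmod R V := lm_coefs R V; try ring.

(** * Continuous seminorms *)

Section seminorms.
Context {R : realType} {V : lcsType R}.
Implicit Types (p : V -> R) (x y : V) (W : set V).

Definition csemi p :=
  [/\ forall x y, p (x + y) <= p x + p y,
      forall a x, p (a *: x) = `|a| * p x &
      nbhs 0 [set x | p x < 1]].

Section csemi_theory.
Variable p : V -> R.
Hypothesis cp : csemi p.

Lemma csemiD x y : p (x + y) <= p x + p y. Proof. by case: cp. Qed.

Lemma csemiZ a x : p (a *: x) = `|a| * p x. Proof. by case: cp. Qed.

Lemma csemi0 : p 0 = 0.
Proof. by rewrite -(scale0r 0) csemiZ normr0 mul0r. Qed.

Lemma csemiN x : p (- x) = p x.
Proof. by rewrite -scaleN1r csemiZ normrN normr1 mul1r. Qed.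

Lemma csemi_ge0 x : 0 <= p x.
Proof.
have := csemiD x (- x); rewrite subrr csemi0 csemiN -mulr2n.
by rewrite pmulrn_lge0.
Qed.

Lemma csemiB x y : p (x - y) <= p x + p y.
Proof. by rewrite -(csemiN y) csemiD. Qed.

Lemma csemi_distC x y : p (x - y) = p (y - x).
Proof. by rewrite -opprB csemiN. Qed.

Lemma csemi_triangle y x z : p (x - z) <= p (x - y) + p (y - z).
Proof. by rewrite -[x - z](subrKA y) csemiD. Qed.

Lemma csemi_le_add x y : p x <= p y + p (x - y).
Proof. by have := csemiD y (x - y); rewrite addrC subrK. Qed.

Lemma csemi_sum (I : Type) (r : seq I) (P : pred I) (f : I -> V) :
  p (\sum_(i <- r | P i) f i) <= \sum_(i <- r | P i) p (f i).
Proof.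
elim/big_rec2 : _ => [|i a b _ ba]; first by rewrite csemi0.
by rewrite (le_trans (csemiD _ _))// lerD2l.
Qed.

Lemma csemi_nbhs0 e : 0 < e -> nbhs 0 [set x | p x < e].
Proof.
move=> e0; have [_ _ p1] := cp.
have := nbhs0Z (lt0r_neq0 e0) p1.
apply: filterS => _ [x /= px <-].
by rewrite csemiZ gtr0_norm// -[ltRHS]mulr1 ltr_pM2l.
Qed.

End csemi_theory.

(** The topology of a locally convex space is given by its continuous
    seminorms: the Minkowski functional of a symmetric convex neighbourhood
    [C] of 0 has its open unit ball inside [C]. *)
Lemma exists_csemi W : nbhs 0 W ->
  exists2 p, csemi p & forall x, p x < 1 -> W x.
Proof.
have [S Sc [So Sb]] := @locally_convex R V.
move=> /Sb[C0 [SC0 C00] C0W].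
have nC0 : nbhs 0 C0 by apply: open_nbhs_nbhs; split=> //; exact: So.
have cvx0 x y l : C0 x -> C0 y -> 0 <= l <= 1 -> C0 (l *: x + (1 - l) *: y).
  move=> Cx Cy /andP[l0 l1].
  have := Sc C0 (mem_set SC0) x y (Itv01 l0 l1) (mem_set Cx) (mem_set Cy).
  by rewrite inE.
(* symmetry makes the gauge homogeneous for negative scalars *)
pose C := C0 `&` [set x | C0 (- x)].
have nC : nbhs 0 C.
  apply: filterI => //; have := nbhs0N nC0.
  by apply: filterS => _ [y Cy <-] /=; rewrite opprK.
have C0_ : C 0 by exact: nbhs_singleton nC.
have cvx x y l : C x -> C y -> 0 <= l <= 1 -> C (l *: x + (1 - l) *: y).
  move=> [Cx Cx'] [Cy Cy'] l01; split; first exact: cvx0.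
  by rewrite /= opprD -!scalerN; exact: cvx0.
have CN x : C x -> C (- x) by move=> [? ?]; split=> //=; rewrite opprK.
have frac01 (r s : R) : 0 < r -> r <= s -> 0 <= r / s <= 1.
  move=> r0 rs; have s0 := lt_le_trans r0 rs.
  by apply/andP; split; [apply: divr_ge0; exact: ltW|rewrite ler_pdivrMr// mul1r].
pose A x := [set r : R | 0 < r /\ C (r^-1 *: x)].
have Alb x : has_lbound (A x) by exists 0 => r [/ltW].
have A0 x : A x !=set0.
  have : (t *: x @[t --> (0 : R^o)]) --> (0 : V).
    have := @scale_continuous R V (0, x); rewrite /continuous_at/= scale0r.
    move=> h U U0; have [[P Q]/= [P0 Q0] PQ] := h U U0.
    by apply: filterS P0 => t Pt; apply: (PQ (t, x)); split=> //; exact: nbhs_singleton.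
  move=> /(_ _ nC); rewrite /= -nbhs_ballE => -[e /= e0 eC].
  exists (e / 2)^-1; split; first by rewrite invr_gt0 divr_gt0.
  rewrite invrK; apply: eC; rewrite -ball_normE/= sub0r normrN gtr0_norm ?divr_gt0//.
  by rewrite ltr_pdivrMr// mulr_natr mulr2n ltrDr.
have Ainf x : has_inf (A x) by [].
have Aup x r s : A x r -> r <= s -> A x s.
  move=> [r0 Cr] rs; have s0 := lt_le_trans r0 rs; split=> //.
  have -> : s^-1 *: x = (r / s) *: (r^-1 *: x) + (1 - r / s) *: 0.
    by rewrite scaler0 addr0 scalerA mulrAC divff ?mul1r// gt_eqF.
  by apply: cvx => //; exact: frac01.
pose p x := inf (A x).
have pA x r : p x < r -> A x r.
  move=> pr; have r0 : 0 < r - p x by rewrite subr_gt0.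
  have [s As sr] := inf_adherent r0 (Ainf x).
  by apply: Aup As _; move: sr; rewrite addrC subrK => /ltW.
have Ap x r : A x r -> p x <= r by move=> Ar; apply: ge_inf.
have p_ge0 x : 0 <= p x by apply: lb_le_inf => // r [/ltW].
have pD x y : p (x + y) <= p x + p y.
  apply/ler_addgt0Pr => e e0.
  have [r0 Cr] : A x (p x + e / 2) by apply: pA; rewrite ltrDl divr_gt0.
  have [s0 Cs] : A y (p y + e / 2) by apply: pA; rewrite ltrDl divr_gt0.
  set r := p x + e / 2 in r0 Cr; set s := p y + e / 2 in s0 Cs.
  have -> : p x + p y + e = r + s by rewrite /r /s; field.
  have rs0 : 0 < r + s by exact: addr_gt0.
  apply: Ap; split=> //.
  have -> : (r + s)^-1 *: (x + y) =
    (r / (r + s)) *: (r^-1 *: x) + (1 - r / (r + s)) *: (s^-1 *: y).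
    rewrite !scalerA scalerDr; congr (_ *: _ + _ *: _).
      by field; rewrite !gt_eqF.
    by field; rewrite !gt_eqF.
  by apply: cvx => //; apply: frac01 => //; rewrite lerDl ltW.
have pZ_le a x : a != 0 -> p (a *: x) <= `|a| * p x.
  move=> a0; have a0' : 0 < `|a| by rewrite normr_gt0.
  apply/ler_addgt0Pr => e e0.
  have [r0 Cr] : A x (p x + e / `|a|) by apply: pA; rewrite ltrDl divr_gt0.
  set r := p x + _ in r0 Cr.
  have -> : `|a| * p x + e = `|a| * r by rewrite /r; field; rewrite gt_eqF.
  apply: Ap; split; first exact: mulr_gt0.
  have : `|a| = a \/ `|a| = - a by case: (ger0P a); [left|right].
  case=> ->; rewrite scalerA.
    by rewrite invfM mulrAC mulVf// mul1r.
  have -> : (- a * r)^-1 * a = - r^-1 by field; rewrite a0 gt_eqF.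
  by rewrite scaleNr; exact: CN.
exists p; last first.
  by move=> x /pA[_]; rewrite invr1 scale1r => -[/C0W].
split=> // [a x|].
  have [->|a0] := eqVneq a 0.
    rewrite scale0r normr0 mul0r; apply/eqP; rewrite eq_le p_ge0 andbT.
    apply/ler_addgt0Pr => e e0; rewrite add0r; apply: Ap; split=> //.
    by rewrite scaler0.
  apply/eqP; rewrite eq_le pZ_le//=.
  have := @pZ_le a^-1 (a *: x); rewrite invr_eq0 => /(_ a0).
  rewrite scalerA mulVf// scale1r normfV => h.
  by rewrite mulrC -ler_pdivlMr ?normr_gt0// mulrC.
have h0 : (2^-1 : R) != 0 by rewrite invr_eq0.
have := nbhs0Z h0 nC; apply: filterS => _ [c Cc <-] /=.
apply: le_lt_trans (_ : 2^-1 < 1); last by rewrite invf_lt1// ltr1n.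
apply: Ap; split; first by rewrite invr_gt0.
by rewrite invrK scalerA divff// scale1r.
Qed.

Lemma csemi_eq0 x : (forall p, csemi p -> p x = 0) -> x = 0.
Proof.
move=> px; apply: (@lcs_hausdorff R V) => A B; rewrite -!nbhs_entourageE.
move=> [P eP PA] [Q eQ QB].
have [W W0 WP] := nbhs0_entourage eP.
exists 0; split; last by apply: QB; apply/xsectionP; exact: entourage_refl.
apply/PA/xsectionP/WP; rewrite sub0r.
have [p cp pW] := exists_csemi W0; apply: pW.
by rewrite csemiN// px.
Qed.

Lemma nbhs_csemi x (A : set V) : nbhs x A <->
  exists p, csemi p /\ exists2 e, 0 < e & forall y, p (y - x) < e -> A y.
Proof.
split.
  rewrite -nbhs_entourageE => -[P eP PA].
  have [W /exists_csemi[p cp pW] WP] := nbhs0_entourage eP.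
  exists p; split=> //; exists 1 => // y /pW /WP Pxy.
  exact/PA/xsectionP.
move=> [p [cp [e e0 pA]]]; rewrite -nbhs_entourageE.
exists [set xy | p (xy.2 - xy.1) < e].
  exact: (entourage_nbhs0 (csemi_nbhs0 cp e0)).
by move=> y /xsectionP /= /pA.
Qed.

Lemma cvg_csemi (I : Type) (Phi : set_system I) {FPhi : Filter Phi} (f : I -> V) l :
  f i @[i --> Phi] --> l <->
  forall p, csemi p -> forall e, 0 < e -> \forall i \near Phi, p (f i - l) < e.
Proof.
split=> [fl p cp e e0|h A /nbhs_csemi[p [cp [e e0 pA]]]].
  by apply: (fl [set y | p (y - l) < e]); apply/nbhs_csemi; exists p; split=> //; exists e.
by apply: filterS (h p cp e e0) => i /pA.
Qed.

Lemma tvs_bounded_csemi (B : set V) : tvs_bounded B <->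
  forall p, csemi p -> exists M, forall x, B x -> p x <= M.
Proof.
split=> [bB p cp|h W /exists_csemi[p cp pW]].
  have [r r0 /(_ (r + 1))] := bB _ (csemi_nbhs0 cp ltr01).
  rewrite gtr0_norm ?addr_gt0// ltrDl => /(_ ltr01) h.
  exists (r + 1) => x /h[y /= py <-].
  rewrite csemiZ// gtr0_norm ?addr_gt0// -[leRHS]mulr1 ler_pM2l ?addr_gt0//.
  exact: ltW.
have [M hM] := h p cp; exists (`|M| + 1); first by rewrite ltr_wpDl.
move=> s Ms x Bx; have s0 : 0 < `|s| by apply: lt_trans Ms; rewrite ltr_wpDl.
exists (s^-1 *: x); last by rewrite scalerA divff -?normr_gt0// scale1r.
apply: pW; rewrite csemiZ// normfV mulrC ltr_pdivrMr// mul1r.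
apply: le_lt_trans (hM x Bx) _; apply: le_lt_trans (ler_norm M) _.
by apply: lt_trans Ms; rewrite ltrDl.
Qed.

Lemma csemi_complete (cV : uniform_complete V) (I : Type) (Phi : set_system I)
    {FPhi : ProperFilter Phi} (f : I -> V) :
  (forall p, csemi p -> forall e, 0 < e ->
    exists2 A, Phi A & forall i j, A i -> A j -> p (f i - f j) < e) ->
  exists l, forall p, csemi p -> forall e, 0 < e ->
    \forall i \near Phi, p (f i - l) < e.
Proof.
move=> h; have [l hl] : exists l : V, f @ Phi --> l.
  have @PF : ProperFilter (f @ Phi) := fmap_proper_filter f FPhi; apply: (cV _ PF).
  move=> P eP.
  have [W /exists_csemi[p cp pW] WP] := nbhs0_entourage eP.
  have [A PA hA] := h p cp 1 ltr01.
  exists ([set f i | i in A], [set f i | i in A]).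
    split; rewrite /= nbhs_filterE; apply: (@filterS _ Phi _ A) => // i Ai.
      by exists i.
    by exists i.
  by move=> [_ _]/= [[i Ai <-] [j Aj <-]]; apply/WP/pW/hA.
by exists l; apply/cvg_csemi.
Qed.

End seminorms.

(** * Differential calculus of curves *)

Section real_line.
Variable R : realType.

Let real_add_unif_continuous :
  unif_continuous (fun xy : R^o * R^o => xy.1 + xy.2).
Proof.
move=> A; rewrite /= -entourage_ballE => -[e /= e0 eA].
pose B := [set xy : R^o * R^o | ball xy.1 (e / 2) xy.2].
have eB : entourage B.
  by rewrite -entourage_ballE; exists (e / 2) => //=; rewrite divr_gt0.
exists (B, B) => //= -[[a b] [c d]]/= [ab cd].
exists ((a, c), (b, d)) => //=; apply: eA => /=.
move: ab cd; rewrite /B -!ball_normE /= => ab cd.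
rewrite opprD addrACA (le_lt_trans (ler_normD _ _))//.
by rewrite [ltRHS]splitr ltrD.
Qed.

HB.instance Definition _ := Tvs_isLcs.Build R R^o
  real_add_unif_continuous (@norm_hausdorff R R^o).

Lemma csemi_norm : csemi (fun x : R^o => `|x|).
Proof.
split; [exact: ler_normD|by move=> a x; rewrite -normrM|].
rewrite -nbhs_ballE; exists 1 => //= x.
by rewrite -ball_normE /= sub0r normrN.
Qed.

Lemma csemi_realE (p : R^o -> R) x : csemi p -> p x = `|x| * p 1.
Proof. by move=> cp; rewrite -{1}[x]mulr1 (csemiZ cp x). Qed.

End real_line.

Section curves.
Context {R : realType}.
Implicit Types (V : lcsType R) (t h : R).

(** Multiplied out, so that [h = 0] needs no exception; see [derP] for the
    difference quotient. *)
Definition der V (c : R -> V) t (l : V) := forall p, csemi p ->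
  forall e, 0 < e -> exists2 d, 0 < d &
  forall h, `|h| < d -> p (c (t + h) - c t - h *: l) <= e * `|h|.

Lemma derP V (c : R -> V) t l :
  (curve_quotient c t h @[h --> 0^'] --> l) <-> der c t l.
Proof.
have FF : Filter (0 : R)^' by exact: dnbhs_filter.
split=> [/cvg_csemi cl p cp e e0|cl].
  have [d /= d0 hd] := cl p cp e e0.
  exists d => // h hd'; have [->|h0] := eqVneq h 0.
    by rewrite addr0 subrr scale0r subr0 csemi0// normr0 mulr0.
  have := hd h; rewrite /= sub0r normrN => /(_ hd' h0) /ltW.
  rewrite /curve_quotient => he.
  have -> : c (t + h) - c t - h *: l = h *: (h^-1 *: (c (t + h) - c t) - l).
    by lm_coefs R V; field.
  by rewrite csemiZ// mulrC ler_pM2r// normr_gt0.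
apply/cvg_csemi => p cp e e0.
have e20 : 0 < e / 2 by rewrite divr_gt0.
have [d d0 hd] := cl p cp _ e20.
exists d => //= h /=; rewrite sub0r normrN => hd' h0.
have -> : curve_quotient c t h - l = h^-1 *: (c (t + h) - c t - h *: l).
  by rewrite /curve_quotient; lm_coefs R V; field.
rewrite csemiZ// normfV mulrC ltr_pdivrMr ?normr_gt0//.
apply: le_lt_trans (hd _ hd') _; rewrite ltr_pM2r ?normr_gt0//.
by rewrite ltr_pdivrMr// mulr_natr mulr2n ltrDl.
Qed.

(** Absorbs constant factors of the error. *)
Lemma derI V (c : R -> V) t l :
  (forall p, csemi p -> exists K, forall e, 0 < e -> exists2 d, 0 < d &
    forall h, `|h| < d -> p (c (t + h) - c t - h *: l) <= K * e * `|h|) ->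
  der c t l.
Proof.
move=> H p cp e e0; have [K hK] := H p cp.
have K0 : 0 < `|K| + 1 by rewrite ltr_wpDl.
have e'0 : 0 < e / (`|K| + 1) by rewrite divr_gt0.
have [d d0 hd] := hK _ e'0; exists d => // h /hd /le_trans; apply.
rewrite ler_wpM2r// mulrCA ger_pMr// ler_pdivrMr// mul1r.
by rewrite (le_trans (ler_norm K))// lerDl.
Qed.

Lemma der_unique V (c : R -> V) t l l' : der c t l -> der c t l' -> l = l'.
Proof.
move=> cl cl'; apply/eqP; rewrite -subr_eq0; apply/eqP/csemi_eq0 => p cp.
apply/eqP; rewrite eq_le csemi_ge0// andbT; apply/ler_addgt0Pr => e e0.
rewrite add0r; have e20 : 0 < e / 2 by rewrite divr_gt0.
have [d d0 hd] := cl p cp _ e20; have [d' d'0 hd'] := cl' p cp _ e20.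
pose h := Num.min d d' / 2.
have m0 : 0 < Num.min d d' by rewrite lt_min d0 d'0.
have h0 : 0 < h by rewrite divr_gt0.
have hm : h < Num.min d d' by rewrite ltr_pdivrMr// mulr_natr mulr2n ltrDl.
have hh : `|h| = h by rewrite gtr0_norm.
have {hd} := hd h; rewrite hh (lt_le_trans hm) ?ge_min ?lexx// => /(_ isT) H1.
have {hd'} := hd' h; rewrite hh (lt_le_trans hm) ?ge_min ?lexx ?orbT// => /(_ isT) H2.
rewrite -(ler_pM2l h0) -{1}hh -csemiZ//.
have -> : h *: (l - l') = (c (t + h) - c t - h *: l') - (c (t + h) - c t - h *: l).
  by lmod R V.
rewrite (le_trans (csemiB cp _ _))// (le_trans (lerD H2 H1))//.
by rewrite mulrC -mulrDr -splitr.
Qed.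

Lemma curve_deriveE V (c : R -> V) t l : der c t l -> curve_derive c t = l.
Proof.
move=> cl; rewrite /curve_derive /flim; case: xgetP.
  by move=> l' _ /derP cl'; exact: der_unique cl' cl.
by move=> /(_ l) /=; move/derP: cl.
Qed.

Lemma der_near V (c c' : R -> V) t t' l d : 0 < d ->
  (forall h, `|h| < d -> c (t + h) = c' (t' + h)) -> der c t l -> der c' t' l.
Proof.
move=> d0 cc' cl p cp e e0; have [d' d'0 hd'] := cl p cp e e0.
exists (Num.min d d'); first by rewrite lt_min d0 d'0.
move=> h; rewrite lt_min => /andP[hd hd2].
have := cc' 0; rewrite normr0 !addr0 => /(_ d0) <-.
by rewrite -cc'//; exact: hd'.
Qed.

Lemma der_ext V (c c' : R -> V) t l : c =1 c' -> der c t l -> der c' t l.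
Proof. by move=> /funext ->. Qed.

Lemma der_shift V (c : R -> V) s t l :
  der c (s + t) l -> der (fun t => c (s + t)) t l.
Proof.
move=> cl; apply: der_near (ltr01) _ cl => h _ /=.
by rewrite addrA.
Qed.

Lemma der_cst V (a : V) t : der (fun=> a) t 0.
Proof.
move=> p cp e e0; exists 1 => // h _.
by rewrite subrr scaler0 subr0 csemi0// mulr_ge0// ltW.
Qed.

Lemma der_id t : der (fun t => t : R^o) t (1 : R^o).
Proof.
move=> p cp e e0; exists 1 => // h _.
rewrite [X in p X](_ : _ = 0) ?csemi0// ?mulr_ge0 ?(ltW e0)//.
rewrite [h *: _]mulr1; ring.
Qed.

Lemma derD V (c d : R -> V) t l m :
  der c t l -> der d t m -> der (fun t => c t + d t) t (l + m).
Proof.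
move=> cl dm; apply: derI => p cp; exists 2 => e e0.
have [r r0 hr] := cl p cp _ e0; have [s s0 hs] := dm p cp _ e0.
exists (Num.min r s); first by rewrite lt_min r0.
move=> h; rewrite lt_min => /andP[/hr Hr /hs Hs].
have -> : c (t + h) + d (t + h) - (c t + d t) - h *: (l + m) =
  (c (t + h) - c t - h *: l) + (d (t + h) - d t - h *: m).
  by lmod R V.
rewrite (le_trans (csemiD cp _ _))// (le_trans (lerD Hr Hs))//.
by rewrite -mulrDl mulr_natl mulr2n.
Qed.

End curves.

Section curves_calculus.
Context {R : realType}.
Implicit Types (V : lcsType R) (t h : R).

Lemma der_bound V (c : R -> V) t l p : der c t l -> csemi p ->
  exists2 d, 0 < d & forall h, `|h| < d -> p (c (t + h) - c t) <= (p l + 1) * `|h|.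
Proof.
move=> cl cp; have [d d0 hd] := cl p cp _ ltr01; exists d => // h /hd H.
have -> : c (t + h) - c t = (c (t + h) - c t - h *: l) + h *: l by lmod R V.
rewrite (le_trans (csemiD cp _ _))// mulrDl addrC lerD//.
by rewrite csemiZ// mulrC.
Qed.

Lemma der_continuous V (c : R -> V) t l p e : der c t l -> csemi p -> 0 < e ->
  exists2 d, 0 < d & forall h, `|h| < d -> p (c (t + h) - c t) < e.
Proof.
move=> cl cp e0; have [d d0 hd] := der_bound cl cp.
have K0 : 0 < p l + 1 by rewrite ltr_wpDl// csemi_ge0.
exists (Num.min d (e / (p l + 1))).
  by rewrite lt_min d0 divr_gt0.
move=> h; rewrite lt_min => /andP[/hd H he]; apply: le_lt_trans H _.
by rewrite mulrC -ltr_pdivlMr.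
Qed.

Lemma derM V (f : R -> R^o) (c : R -> V) t a l : der f t a -> der c t l ->
  der (fun t => f t *: c t) t (f t *: l + a *: c t).
Proof.
move=> fa cl; apply: derI => p cp.
exists (`|f t| + 1 + (`|a| + 1) * p l + p (c t)) => e e0.
have [r r0 hr] := fa _ (csemi_norm R) _ e0.
have [s s0 hs] := cl p cp _ e0.
have [u u0 hu] := der_bound fa (csemi_norm R).
have [v v0 hv] := der_continuous fa (csemi_norm R) ltr01.
exists (Num.min (Num.min r s) (Num.min (Num.min u v) e)).
  by rewrite !lt_min r0 s0 u0 v0.
move=> h; rewrite !lt_min => /andP[/andP[/hr Hr /hs Hs] /andP[/andP[/hu Hu /hv Hv] he]].
have -> : f (t + h) *: c (t + h) - f t *: c t - h *: (f t *: l + a *: c t) =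
  f (t + h) *: (c (t + h) - c t - h *: l) + (f (t + h) - f t) *: (h *: l)
    + (f (t + h) - f t - h * a) *: c t by lmod R V.
rewrite (le_trans (csemiD cp _ _))// !mulrDl lerD//; last first.
  by rewrite csemiZ// [leRHS](_ : _ = e * `|h| * p (c t)) ?ler_wpM2r ?csemi_ge0//; ring.
rewrite (le_trans (csemiD cp _ _))// lerD//.
  rewrite csemiZ// [leRHS](_ : _ = (`|f t| + 1) * (e * `|h|)); last by ring.
  apply: ler_pM => //; first exact: csemi_ge0.
  have -> : f (t + h) = f t + (f (t + h) - f t) by ring.
  by rewrite (le_trans (ler_normD _ _))// lerD2l ltW.
rewrite !csemiZ//.
have -> : (`|a| * p l * e * `|h| + 1 * p l * e * `|h|) =
  ((`|a| + 1) * `|h|) * (e * p l) by ring.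
apply: ler_pM => //; first by rewrite mulr_ge0// csemi_ge0.
by rewrite ler_wpM2r ?csemi_ge0// ltW.
Qed.

Lemma derZ V (k : R) (c : R -> V) t l : der c t l ->
  der (fun t => k *: c t) t (k *: l).
Proof.
by move=> cl; have := derM (@der_cst R R^o k t) cl; rewrite scale0r addr0.
Qed.

Lemma derN V (c : R -> V) t l : der c t l -> der (fun t => - c t) t (- l).
Proof.
move=> /(derZ (-1)); rewrite scaleN1r; apply: der_ext => s.
by rewrite scaleN1r.
Qed.

Lemma derB V (c d : R -> V) t l m : der c t l -> der d t m ->
  der (fun t => c t - d t) t (l - m).
Proof. by move=> cl /derN; exact: derD. Qed.

Lemma der_sum V (I : Type) (r : seq I) (c : I -> R -> V) t (l : I -> V) :
  (forall i, der (c i) t (l i)) ->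
  der (fun t => \sum_(i <- r) c i t) t (\sum_(i <- r) l i).
Proof.
move=> cl; elim: r => [|i r IH].
  rewrite big_nil; apply: der_ext (der_cst _ _) => s.
  by rewrite big_nil.
rewrite big_cons; apply: der_ext (derD (cl i) IH) => s.
by rewrite big_cons.
Qed.

Lemma der_comp V (s : R -> R^o) (c : R -> V) t a l :
  der s t a -> der c (s t) l -> der (fun t => c (s t)) t (a *: l).
Proof.
move=> sa cl; apply: derI => p cp; exists (`|a| + 1 + p l) => e e0.
have [r r0 hr] := cl p cp _ e0.
have [u u0 hu] := der_bound sa (csemi_norm R).
have [v v0 hv] := der_continuous sa (csemi_norm R) r0.
have [w w0 hw] := sa _ (csemi_norm R) _ e0.
exists (Num.min u (Num.min v w)); first by rewrite !lt_min u0 v0.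
move=> h; rewrite !lt_min => /andP[/hu Hu /andP[/hv /hr Hv /hw Hw]].
have st : s t + (s (t + h) - s t) = s (t + h) by ring.
have -> : c (s (t + h)) - c (s t) - h *: (a *: l) =
  (c (s t + (s (t + h) - s t)) - c (s t) - (s (t + h) - s t) *: l) +
  (s (t + h) - s t - h * a) *: l by rewrite st; lmod R V.
rewrite [leRHS](_ : _ = e * ((`|a| + 1) * `|h|) + e * `|h| * p l); last by ring.
rewrite (le_trans (csemiD cp _ _))// lerD//.
  by rewrite (le_trans Hv)// ler_wpM2l// ltW.
by rewrite csemiZ// ler_wpM2r// csemi_ge0.
Qed.

(** Mean value inequality. The set of [s] for which the increment over [[a, s]]
    is controlled by [(M + e) (s - a)] is closed, and the derivative at its
    supremum pushes it further. *)
Lemma mvt V (c c' : R -> V) p M a b : csemi p -> a <= b ->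
  (forall t, a <= t <= b -> der c t (c' t)) ->
  (forall t, a <= t <= b -> p (c' t) <= M) ->
  p (c b - c a) <= M * (b - a).
Proof.
move=> cp ab cc' cM; have [->|neab] := eqVneq a b.
  by rewrite !subrr csemi0// mulr0.
have ltab : a < b by rewrite lt_neqAle neab.
suff H : forall e, 0 < e -> p (c b - c a) <= (M + e) * (b - a).
  apply/ler_addgt0Pr => e e0; have ba0 : 0 < b - a by rewrite subr_gt0.
  have := H _ (divr_gt0 e0 ba0); rewrite mulrDl divfK// gt_eqF//.
move=> e e0; pose S := [set s | a <= s <= b /\
  forall t, a <= t <= s -> p (c t - c a) <= (M + e) * (t - a)].
have Sa : S a.
  split; first by rewrite lexx.
  move=> t /le_anti <-; by rewrite !subrr csemi0// mulr0.
have Sb : has_ubound S by exists b => s [/andP[]].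
have supS : has_sup S by split=> //; exists a.
pose s := sup S.
have as_ : a <= s by apply: ub_le_sup.
have sb : s <= b by apply: ge_sup; [exists a|move=> x [/andP[]]].
have ssb : a <= s <= b by rewrite as_ sb.
have [d d0 hd] := cc' s ssb p cp _ e0.
have {}hd h : `|h| < d -> p (c (s + h) - c s) <= (M + e) * `|h|.
  move=> /hd H; have -> : c (s + h) - c s = (c (s + h) - c s - h *: c' s) + h *: c' s.
    by lmod R V.
  rewrite (le_trans (csemiD cp _ _))// mulrDl addrC lerD//.
  by rewrite csemiZ// mulrC ler_wpM2r// cM// as_ sb.
have Ss : p (c s - c a) <= (M + e) * (s - a).
  have [t [/andP[at_ tb] St] ts] := sup_adherent d0 supS.
  rewrite -/s in ts.
  have ts' : t <= s by apply: ub_le_sup => //; split=> //; rewrite at_.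
  have := hd (t - s); rewrite ler0_norm ?subr_le0// opprB => H.
  rewrite (le_trans (csemi_triangle cp (c t) _ _))//.
  have -> : (M + e) * (s - a) = (M + e) * (s - t) + (M + e) * (t - a) by ring.
  apply: lerD; last by apply: St; rewrite at_ /=.
  rewrite csemi_distC//; have -> : c t = c (s + (t - s)) by congr c; ring.
  by apply: H; rewrite ltrBlDr -ltrBlDl.
have Ss' t : a <= t <= s -> p (c t - c a) <= (M + e) * (t - a).
  move=> /andP[at_]; rewrite le_eqVlt => /orP[/eqP -> //|ts].
  have st0 : 0 < s - t by rewrite subr_gt0.
  have [u [_ Su]] := sup_adherent st0 supS.
  rewrite -/s opprB addrC subrK => /ltW tu.
  by apply: Su; rewrite at_.
have [-> //|sb'] := eqVneq b s.
have {sb'}{}sb : s < b by rewrite lt_neqAle eq_sym sb'.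
pose h := Num.min (d / 2) (b - s).
have h0 : 0 < h by rewrite lt_min divr_gt0//= subr_gt0.
have hd2 : h < d.
  by rewrite /h gt_min ltr_pdivrMr// mulr_natr mulr2n ltrDl d0.
have hb : s + h <= b by rewrite -lerBrDl ge_min lexx orbT.
suff : S (s + h) by move=> /(ub_le_sup Sb); rewrite -/s gerDl leNgt h0.
split; first by rewrite hb andbT (le_trans as_)// lerDl ltW.
move=> t /andP[at_ tsh]; have [ts|st] := leP t s; first by apply: Ss'; rewrite at_.
rewrite (le_trans (csemi_triangle cp (c s) _ _))//.
have -> : (M + e) * (t - a) = (M + e) * (t - s) + (M + e) * (s - a) by ring.
apply: lerD => //; have := hd (t - s).
rewrite gtr0_norm ?subr_gt0//.
have -> : s + (t - s) = t by ring.
apply.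
by apply: le_lt_trans hd2; rewrite lerBlDl.
Qed.

Lemma mvt_norm V (c c' : R -> V) p M t h : csemi p ->
  (forall s, `|s| <= `|h| -> der c (t + s) (c' (t + s))) ->
  (forall s, `|s| <= `|h| -> p (c' (t + s)) <= M) ->
  p (c (t + h) - c t) <= M * `|h|.
Proof.
move=> cp dc cM; have [h0|h0] := leP 0 h.
  have -> : `|h| = t + h - t by rewrite ger0_norm//; ring.
  apply: (mvt (c' := c') cp); first by rewrite lerDl.
  - move=> u /andP[tu uh]; have -> : u = t + (u - t) by ring.
    apply: dc; rewrite ger0_norm ?subr_ge0// (ger0_norm h0); lra.
  - move=> u /andP[tu uh]; have -> : u = t + (u - t) by ring.
    apply: cM; rewrite ger0_norm ?subr_ge0// (ger0_norm h0); lra.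
rewrite csemi_distC//.
have -> : `|h| = t - (t + h) by rewrite ltr0_norm//; ring.
apply: (mvt (c' := c') cp); first by rewrite gerDl ltW.
- move=> u /andP[tu uh]; have -> : u = t + (u - t) by ring.
  apply: dc; rewrite (ltr0_norm h0) ler0_norm ?subr_le0//; lra.
- move=> u /andP[tu uh]; have -> : u = t + (u - t) by ring.
  apply: cM; rewrite (ltr0_norm h0) ler0_norm ?subr_le0//; lra.
Qed.

Lemma taylor2 V (c c' c'' : R -> V) p M t h : csemi p ->
  (forall s, der c s (c' s)) -> (forall s, der c' s (c'' s)) ->
  (forall s, `|s| <= `|h| -> p (c'' (t + s)) <= M) ->
  p (c (t + h) - c t - h *: c' t) <= M * `|h| ^+ 2.
Proof.
move=> cp dc dc' cM.
have M0 : 0 <= M.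
  by apply: le_trans (cM 0 _); [exact: csemi_ge0|rewrite normr0].
have := @mvt_norm V (fun s => c (t + s) - s *: c' t) (fun s => c' (t + s) - c' t)
  p (M * `|h|) 0 h cp.
rewrite !add0r scale0r subr0 addr0 expr2 mulrA.
have -> : c (t + h) - h *: c' t - c t = c (t + h) - c t - h *: c' t by lmod R V.
apply=> s sh; rewrite !add0r.
  apply: derB; first exact: der_shift.
  have := derM (der_id s) (der_cst (c' t) s).
  by rewrite scale1r scaler0 add0r.
apply: (@le_trans _ _ (M * `|s|)); last by rewrite ler_wpM2l.
apply: (mvt_norm cp (c' := c'')) => [u _|u us]; [exact: dc'|apply: cM; exact: le_trans us sh].
Qed.

(** By the mean value inequality the difference quotients of two of the curves
    are as close as their derivatives near [t0]; passing to the limit in one of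
    them compares the quotients of [u] with those of a single curve. *)
Lemma der_limit V (I : Type) (Phi : set_system I) {FPhi : ProperFilter Phi}
    (c c' : I -> R -> V) (u l : R -> V) t0 :
  (forall i t, der (c i) t (c' i t)) ->
  (forall t p, csemi p -> forall e, 0 < e ->
     \forall i \near Phi, p (c i t - u t) < e) ->
  (forall p, csemi p -> forall e, 0 < e -> exists2 d, 0 < d &
     \forall i \near Phi, forall h, `|h| < d ->
       p (c' i (t0 + h) - l (t0 + h)) <= e) ->
  der u t0 (l t0).
Proof.
move=> dc cu c'l; apply: derI => p cp; exists 4 => e e0.
have [d d0 Phid] := c'l p cp _ e0.
have [i iA] := @filter_ex _ _ _ _ Phid.
have [d2 d20 hd2] := dc i t0 p cp _ e0.
exists (Num.min d d2); first by rewrite lt_min d0.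
move=> h; rewrite lt_min => /andP[hd hd2'].
have H1 : p (c' i t0 - l t0) <= e.
  by have := iA 0; rewrite normr0 addr0; exact.
have H2 : p ((u (t0 + h) - c i (t0 + h)) - (u t0 - c i t0)) <= 2 * e * `|h|.
  apply/ler_addgt0Pr => eta eta0; have eta20 : 0 < eta / 2 by rewrite divr_gt0.
  have [j [[jA J1] J2]] := @filter_ex _ _ _ _ (filterI (filterI Phid
    (cu (t0 + h) p cp _ eta20)) (cu t0 p cp _ eta20)).
  have : p ((c j (t0 + h) - c i (t0 + h)) - (c j t0 - c i t0)) <= 2 * e * `|h|.
    apply: (@mvt_norm V (fun t => c j t - c i t) (fun t => c' j t - c' i t)) => //.
      by move=> s _; exact: derB.
    move=> s /le_lt_trans/(_ hd) sd.
    rewrite (le_trans (csemi_triangle cp (l (t0 + s)) _ _))// mulr_natl mulr2n.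
    by apply: lerD; [exact: jA|rewrite csemi_distC//; exact: iA].
  have -> : u (t0 + h) - c i (t0 + h) - (u t0 - c i t0) =
    (c j (t0 + h) - c i (t0 + h) - (c j t0 - c i t0))
      + ((c j t0 - u t0) - (c j (t0 + h) - u (t0 + h))) by lmod R V.
  move=> J3; rewrite (le_trans (csemiD cp _ _))// lerD//.
  rewrite (le_trans (csemiB cp _ _))// [leRHS]splitr lerD// ltW//.
have -> : u (t0 + h) - u t0 - h *: l t0 =
   ((u (t0 + h) - c i (t0 + h)) - (u t0 - c i t0))
    + ((c i (t0 + h) - c i t0 - h *: c' i t0) + h *: (c' i t0 - l t0)) by lmod R V.
have -> : 4 * e * `|h| = 2 * e * `|h| + (e * `|h| + `|h| * e) by ring.
rewrite (le_trans (csemiD cp _ _))// lerD//.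
rewrite (le_trans (csemiD cp _ _))// lerD//; first exact: hd2.
by rewrite csemiZ// ler_wpM2l.
Qed.

End curves_calculus.

(** * Smooth curves *)

Section smooth_curves.
Context {R : realType}.
Implicit Types (V : lcsType R) (t h : R) (n k : nat).

Definition cder V n (c : R -> V) : R -> V := iter n (@curve_derive R V) c.

(** Finite differentiability classes, so that the closure properties of smooth
    curves can be proved by induction on the order. *)
Fixpoint Ck V n (c : R -> V) : Prop :=
  if n is m.+1 then exists c', (forall t, der c t (c' t)) /\ Ck m c' else True.

Lemma Ck_pred V n (c : R -> V) : Ck n.+1 c -> Ck n c.
Proof.
elim: n c => // n IH c [c' [dc cc']]; exists c'; split=> //; exact: IH.
Qed.

Lemma curve_derive_fun V (c c' : R -> V) : (forall t, der c t (c' t)) ->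
  curve_derive c = c'.
Proof. by move=> dc; apply/funext => t; exact: curve_deriveE. Qed.

Lemma smooth_der V (c : R -> V) n t : smooth_curve c ->
  der (cder n c) t (cder n.+1 c t).
Proof.
move=> /(_ n t)[l /derP cl]; rewrite /cder iterS.
by rewrite (curve_deriveE cl).
Qed.

Lemma smooth_cder V (c : R -> V) n : smooth_curve c -> smooth_curve (cder n c).
Proof.
move=> sc k t; rewrite -iterD; exact: sc.
Qed.

Lemma smoothP V (c : R -> V) : smooth_curve c <-> forall n, Ck n c.
Proof.
split=> [sc n|cc].
  suff : forall k, Ck n (cder k c) by move=> /(_ 0).
  elim: n => // n IH k; exists (cder k.+1 c); split=> // t; exact: smooth_der.
suff H n k : Ck n.+1 (cder k c) -> forall t, der (cder (n + k) c) t (cder (n + k).+1 c t).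
  move=> n t; have := @H n 0 (cc n.+1) t; rewrite addn0 => /derP cl.
  by exists (cder n.+1 c t).
elim: n k => [|n IH] k [c' [dc Cc']] t.
  by rewrite add0n /cder iterS -/(cder k c) (curve_derive_fun dc).
rewrite addSnnS; apply: IH.
by rewrite /cder iterS -/(cder k c) (curve_derive_fun dc).
Qed.

Lemma smooth_Ck V (c : R -> V) n : smooth_curve c -> Ck n c.
Proof. by move/smoothP. Qed.

Lemma smooth_tower V (d : nat -> R -> V) :
  (forall n t, der (d n) t (d n.+1 t)) -> smooth_curve (d 0%N).
Proof.
move=> dd; apply/smoothP => n; move: 0%N; elim: n => // n IH k.
by exists (d k.+1).
Qed.

Lemma cder_tower V (d : nat -> R -> V) n :
  (forall n t, der (d n) t (d n.+1 t)) -> cder n (d 0%N) = d n.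
Proof.
by move=> dd; elim: n => // n IH; rewrite /cder iterS -/(cder n _) IH (curve_derive_fun (dd n)).
Qed.

Lemma smooth_ext V (c d : R -> V) : c =1 d -> smooth_curve c -> smooth_curve d.
Proof. by move=> /funext ->. Qed.

Lemma CkD V n (c d : R -> V) : Ck n c -> Ck n d -> Ck n (fun t => c t + d t).
Proof.
elim: n c d => // n IH c d [c' [dc Cc']] [d' [dd Cd']].
exists (fun t => c' t + d' t); split; first by move=> t; exact: derD.
exact: IH.
Qed.

Lemma Ck_cst V n (a : V) : Ck n (fun _ : R => a).
Proof. by elim: n a => // n IH a; exists (fun=> 0); split=> // t; exact: der_cst. Qed.

Lemma Ck_sum V (I : Type) (r : seq I) (c : I -> R -> V) n :
  (forall i, Ck n (c i)) -> Ck n (fun t => \sum_(i <- r) c i t).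
Proof.
move=> cc; elim: r => [|i r IH].
  by under eq_fun do rewrite big_nil; exact: Ck_cst.
by under eq_fun do rewrite big_cons; exact: CkD.
Qed.

Lemma CkM V n (f : R -> R^o) (c : R -> V) : Ck n f -> Ck n c ->
  Ck n (fun t => f t *: c t).
Proof.
elim: n f c => // n IH f c [f' [df Cf']] [c' [dc Cc']].
exists (fun t => f t *: c' t + f' t *: c t); split; first by move=> t; exact: derM.
apply: CkD; apply: IH => //; apply: Ck_pred; first by exists f'.
by exists c'.
Qed.

Lemma Ck_comp V n (s : R -> R^o) (c : R -> V) : Ck n s -> Ck n c ->
  Ck n (fun t => c (s t)).
Proof.
elim: n s c => // n IH s c [s' [ds Cs']] [c' [dc Cc']].
exists (fun t => s' t *: c' (s t)); split; first by move=> t; exact: der_comp.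
by apply: CkM => //; apply: IH => //; apply: Ck_pred; exists s'.
Qed.

Lemma smooth_cst V (a : V) : smooth_curve (fun _ : R => a).
Proof. by apply/smoothP => n; exact: Ck_cst. Qed.

Lemma smooth_id : smooth_curve (fun t : R => t : R^o).
Proof.
apply/smoothP => -[//|n]; exists (fun=> 1); split; first by move=> t; exact: der_id.
exact: Ck_cst.
Qed.

Lemma smoothD V (c d : R -> V) : smooth_curve c -> smooth_curve d ->
  smooth_curve (fun t => c t + d t).
Proof. by move=> /smoothP sc /smoothP sd; apply/smoothP => n; exact: CkD. Qed.

Lemma smoothM V (f : R -> R^o) (c : R -> V) : smooth_curve f ->
  smooth_curve c -> smooth_curve (fun t => f t *: c t).
Proof. by move=> /smoothP sf /smoothP sc; apply/smoothP => n; exact: CkM. Qed.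

Lemma smoothZ V (k : R) (c : R -> V) : smooth_curve c ->
  smooth_curve (fun t => k *: c t).
Proof. by apply: smoothM; exact: (@smooth_cst R^o). Qed.

Lemma smoothB V (c d : R -> V) : smooth_curve c -> smooth_curve d ->
  smooth_curve (fun t => c t - d t).
Proof.
move=> sc /(smoothZ (-1)) sd; apply: smooth_ext (smoothD sc sd) => t.
by rewrite scaleN1r.
Qed.

Lemma smooth_comp V (s : R -> R^o) (c : R -> V) : smooth_curve s ->
  smooth_curve c -> smooth_curve (fun t => c (s t)).
Proof. by move=> /smoothP ss /smoothP sc; apply/smoothP => n; exact: Ck_comp. Qed.

Lemma smooth_affine (a b : R) : smooth_curve (fun t : R => a + b * t : R^o).
Proof.
apply: (@smoothD R^o); first exact: (@smooth_cst R^o).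
exact: (@smoothZ R^o b _ smooth_id).
Qed.

Lemma smooth_continuous V (c : R -> V) t p e : smooth_curve c -> csemi p ->
  0 < e -> exists2 d, 0 < d & forall h, `|h| < d -> p (c (t + h) - c t) < e.
Proof. by move=> sc; apply: der_continuous (@smooth_der V c 0 t sc). Qed.

Lemma cder_near V (c d : R -> V) t t' e n : 0 < e ->
  (forall h, `|h| < e -> c (t + h) = d (t' + h)) -> smooth_curve c ->
  forall h, `|h| < e -> cder n c (t + h) = cder n d (t' + h).
Proof.
move=> e0 cd sc; elim: n => // n IH h he.
rewrite /cder !iterS -!/(cder n _).
have := @smooth_der V c n (t + h) sc; rewrite {2}/cder iterS -/(cder n _).
have he0 : 0 < e - `|h| by rewrite subr_gt0.
move=> /(der_near (c' := cder n d) (t' := t' + h) he0) H.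
apply/esym/curve_deriveE/H => k kh; rewrite -!addrA; apply: IH.
by apply: le_lt_trans (ler_normD _ _) _; rewrite addrC -ltrBrDr.
Qed.

(** The curves [g] may differ from point to point; this is what allows to
    modify a curve away from the point of interest so that it stays in [U]. *)
Lemma smooth_local V (c : R -> V) :
  (forall t, exists g : R -> V, smooth_curve g /\ exists2 e, 0 < e &
     forall h, `|h| < e -> c (t + h) = g h) ->
  smooth_curve c.
Proof.
move=> cg; apply/smoothP => n.
have {}cg t : exists g : R -> V, Ck n g /\ exists2 e, 0 < e &
     forall h, `|h| < e -> c (t + h) = g h.
  by have [g [/smoothP sg eg]] := cg t; exists g.
elim: n c cg => // n IH c cg.
have dc t : exists (g : R -> V) (e : R), [/\ Ck n g, 0 < e &
    forall h, `|h| < e -> der c (t + h) (g h)].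
  have [g [[g' [dg Cg']] [e e0 cge]]] := cg t; exists g', e; split=> // h he.
  have he0 : 0 < e - `|h| by rewrite subr_gt0.
  apply: der_near he0 _ (dg h) => k ke; rewrite -addrA cge//.
  by apply: le_lt_trans (ler_normD _ _) _; rewrite addrC -ltrBrDr.
exists (curve_derive c); split=> [t|].
  have [g [e [_ e0 /(_ 0)]]] := dc t; rewrite normr0 addr0 => /(_ e0) ct.
  by rewrite (curve_deriveE ct).
apply: IH => t; have [g [e [Cg e0 dge]]] := dc t.
by exists g; split=> //; exists e => // h /dge /curve_deriveE.
Qed.

Lemma cderD V (c d : R -> V) n : smooth_curve c -> smooth_curve d ->
  cder n (fun t => c t + d t) = (fun t => cder n c t + cder n d t).
Proof.
move=> sc sd; apply: (@cder_tower V (fun n t => cder n c t + cder n d t)).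
by move=> k t; apply: derD; exact: smooth_der.
Qed.

Lemma cderZ V (a : R) (c : R -> V) n : smooth_curve c ->
  cder n (fun t => a *: c t) = (fun t => a *: cder n c t).
Proof.
move=> sc; apply: (@cder_tower V (fun n t => a *: cder n c t)).
by move=> k t; apply: derZ; exact: smooth_der.
Qed.

Lemma cderB V (c d : R -> V) n : smooth_curve c -> smooth_curve d ->
  cder n (fun t => c t - d t) = (fun t => cder n c t - cder n d t).
Proof.
move=> sc sd; apply: (@cder_tower V (fun n t => cder n c t - cder n d t)).
by move=> k t; apply: derB; exact: smooth_der.
Qed.

Lemma cder_affine V (c : R -> V) (a b : R) n : smooth_curve c ->
  cder n (fun t => c (a + b * t)) = (fun t => b ^+ n *: cder n c (a + b * t)).
Proof.
move=> sc; have -> : (fun t => c (a + b * t)) = (fun t => b ^+ 0 *: cder 0 c (a + b * t)).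
  by apply/funext => t; rewrite expr0 scale1r.
apply: (@cder_tower V (fun n t => b ^+ n *: cder n c (a + b * t))) => k t.
rewrite exprSr -scalerA; apply: derZ.
apply: (@der_comp _ _ (fun t => a + b * t : R^o)); last exact: smooth_der.
have := derD (@der_cst R R^o a t) (derZ b (der_id t)).
by rewrite add0r [b *: 1]mulr1.
Qed.

End smooth_curves.

(** * Smooth functions with compact support *)

Section bump.
Variable R : realType.
Implicit Types (t h x : R).

Lemma der_expR x : der (expR : R -> R^o) x (expR x).
Proof.
apply/derP; have [/= ex dv] := is_derive_expR x.
have : h^-1 *: (expR (h *: 1 + x) - expR x) @[h --> 0^'] --> expR x.
  by rewrite -[in X in _ --> X]dv; exact: ex.
move=> H; have -> : curve_quotient (expR : R -> R^o) x =
  (fun h => h^-1 *: (expR (h *: 1 + x) - expR x)).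
  by apply/funext => h; rewrite /curve_quotient [h%:A]mulr1 (addrC h).
exact: H.
Qed.

Lemma der_inv x : x != 0 -> der (fun t => t^-1 : R^o) x (- x ^- 2).
Proof.
move=> x0; have ax : 0 < `|x| by rewrite normr_gt0.
apply: derI => p cp; exists (2 * `|x| ^- 3 * p 1) => e e0.
exists (Num.min e (`|x| / 2)); first by rewrite lt_min e0 divr_gt0.
move=> h; rewrite lt_min => /andP[/ltW he hx].
have hx2 : `|x| / 2 <= `|x + h|.
  have := ler_normD (x + h) (- h); rewrite addrK normrN; lra.
have xh0 : x + h != 0.
  by rewrite -normr_gt0; apply: lt_le_trans hx2; rewrite divr_gt0.
rewrite csemi_realE//.
have -> : (x + h)^-1 - x^-1 - h *: (- x ^- 2 : R^o) = h ^+ 2 * (x ^- 2 * (x + h)^-1).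
  by rewrite /GRing.scale /=; field; rewrite x0 xh0.
rewrite !normrM !normfV normrX.
have -> : 2 * `|x| ^- 3 * p 1 * e * `|h| = (e * `|h|) * (`|x| ^- 2 * (`|x| / 2)^-1) * p 1.
  by field; rewrite normr_eq0.
rewrite ler_wpM2r ?csemi_ge0//; apply: ler_pM.
- by rewrite mulr_ge0.
- by rewrite mulr_ge0// invr_ge0// ?exprn_ge0// mulr_ge0.
- by rewrite ler_wpM2r.
- apply: ler_wpM2l; first by rewrite invr_ge0 exprn_ge0.
  by rewrite lef_pV2// posrE ?divr_gt0// normr_gt0.
Qed.

Lemma der_invX k x : x != 0 ->
  der (fun t => t^-1 ^+ k : R^o) x (- (k%:R * x^-1 ^+ k.+1)).
Proof.
move=> xn0; elim: k => [|k IH].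
  by rewrite mul0r oppr0; exact: (@der_cst _ R^o).
have := derM (der_inv xn0) IH.
have -> : - (k.+1%:R * x^-1 ^+ k.+2) =
  x^-1 *: (- (k%:R * x^-1 ^+ k.+1) : R^o) + - x ^- 2 *: (x^-1 ^+ k : R^o).
  rewrite [_ *: _]mulrN [(- _) *: _]mulNr -natr1 -exprVn !exprS expr0.
  by rewrite /GRing.scale /=; ring.
by apply: der_ext => t; rewrite exprS.
Qed.

Lemma der_exp k x : der (fun t => t ^+ k.+1 : R^o) x (k.+1%:R * x ^+ k).
Proof.
elim: k => [|k IH]; first by rewrite expr0 mulr1; exact: der_id.
have := derM (der_id x) IH.
have -> : k.+2%:R * x ^+ k.+1 =
  x *: (k.+1%:R * x ^+ k : R^o) + (1 : R) *: (x ^+ k.+1 : R^o).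
  by rewrite /GRing.scale /= -natr1 exprS; ring.
by apply: der_ext => t; rewrite [in RHS]exprS.
Qed.

(** The whole family in [n] is needed, since the derivative of each of these
    functions is a combination of two others. *)
Definition flat n (x : R) : R^o :=
  if 0 < x then x^-1 ^+ n * expR (- x^-1) else 0.

(** From [exp y >= (y / k) ^ k] with [y = 1 / x] and [k = n + 2]. *)
Lemma flat_bound n x : `|flat n x| <= n.+2%:R ^+ n.+2 * `|x| ^+ 2.
Proof.
rewrite /flat; case: ltP => x0; last by rewrite normr0 mulr_ge0// exprn_ge0.
have y0 : 0 < x^-1 by rewrite invr_gt0.
have n0 : 0 < n.+2%:R :> R by [].
rewrite gtr0_norm ?mulr_gt0 ?exprn_gt0 ?expR_gt0// gtr0_norm//.
have H : (x^-1 / n.+2%:R) ^+ n.+2 <= expR x^-1.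
  have -> : expR x^-1 = expR (x^-1 / n.+2%:R) ^+ n.+2.
    by rewrite -expRM_natl mulrC divfK// gt_eqF.
  apply: lerXn2r; rewrite ?nnegrE ?expR_ge0//; first by rewrite divr_ge0 ?ltW.
  by rewrite (le_trans _ (expR_ge1Dx _))// lerDr.
rewrite expRN; rewrite -ler_pdivlMr ?invr_gt0 ?expR_gt0// invrK.
have -> : x^-1 ^+ n = (n.+2%:R ^+ n.+2 * x ^+ 2) * (x^-1 / n.+2%:R) ^+ n.+2.
  have E : x^-1 ^+ n.+2 = x^-1 ^+ n * x^-1 ^+ 2 by rewrite -exprD addn2.
  rewrite expr_div_n E; have : n.+2%:R ^+ n.+2 != 0 :> R by rewrite expf_neq0 ?gt_eqF.
  move: (n.+2%:R ^+ n.+2) (x^-1 ^+ n) => B A B0; field.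
  by rewrite B0 gt_eqF.
by rewrite ler_wpM2l// mulr_ge0 ?exprn_ge0 ?ltW.
Qed.

Lemma der_flat n x : der (flat n) x (flat n.+2 x - n%:R * flat n.+1 x).
Proof.
have [x0|x0|->] := ltgtP x 0.
- rewrite /flat !ltNge (ltW x0)/= mulr0 subr0.
  have Nx : 0 < - x by rewrite oppr_gt0.
  apply: der_near Nx _ (der_cst 0 x) => h hx.
  by rewrite ifF//; apply/negbTE; rewrite -leNgt; have := ler_norm h; lra.
- have xn0 : x != 0 by rewrite gt_eqF.
  have dE : der (fun t => expR (- t^-1) : R^o) x (x^-1 ^+ 2 * expR (- x^-1)).
    have := der_comp (derN (der_inv xn0)) (der_expR (- x^-1)).
    by rewrite opprK exprVn.
  have := derM (der_invX n xn0) dE.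
  have -> : flat n.+2 x - n%:R * flat n.+1 x =
     x^-1 ^+ n *: (x^-1 ^+ 2 * expR (- x^-1) : R^o)
       + - (n%:R * x^-1 ^+ n.+1) *: (expR (- x^-1) : R^o).
    by rewrite /flat x0 /GRing.scale /= !exprS; ring.
  apply: der_near x0 _ => h hx; rewrite /flat ifT//.
  by have := ler_norm (- h); rewrite normrN; lra.
rewrite /flat ltxx mulr0 subr0; apply: derI => p cp.
exists (n.+2%:R ^+ n.+2 * p 1) => e e0; exists e => // h he.
rewrite add0r -/(flat n 0) -/(flat n h) /flat ltxx -/(flat n h) scaler0 !subr0.
rewrite csemi_realE// [leRHS](_ : _ = n.+2%:R ^+ n.+2 * (e * `|h|) * p 1); last by ring.
rewrite ler_wpM2r ?csemi_ge0// (le_trans (flat_bound _ _))// ler_wpM2l ?exprn_ge0//.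
by rewrite expr2 ler_wpM2r// ltW.
Qed.

Lemma smooth_flat : smooth_curve (flat 0).
Proof.
apply/smoothP => m; move: 0%N; elim: m => // m IH n.
exists (fun x => flat n.+2 x + (- n%:R) *: flat n.+1 x); split.
  by move=> x; have := @der_flat n x; rewrite /GRing.scale /= mulNr.
apply: CkD => //; apply: CkM => //; exact: (@Ck_cst _ R^o).
Qed.

Lemma smoothV (g : R -> R^o) : smooth_curve g -> (forall t, g t != 0) ->
  smooth_curve (fun t => (g t)^-1 : R^o).
Proof.
move=> /smoothP sg g0; apply/smoothP => n; elim: n => // n IH.
have [g' [dg Cg']] := sg n.+1.
exists (fun t => g' t *: ((g t)^-1 *: (-1 *: (g t)^-1) : R^o)); split; last first.
  by do 2!apply: CkM => //; apply: CkM => //; exact: (@Ck_cst _ R^o).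
move=> t; have := der_comp (dg t) (der_inv (g0 t)).
by congr der; rewrite /GRing.scale /= expr2 invfM; ring.
Qed.

(** The numerator lives on [`|x| < 3/4] and the second summand of the
    denominator on [1/2 < `|x|], so the denominator never vanishes. *)
Definition plateau x : R^o :=
  let a := flat 0 (9 / 16 + (-1) * (x * x)) in
  a * (a + flat 0 (- (1 / 4) + 1 * (x * x)))^-1.

Let den_gt0 x :
  0 < flat 0 (9 / 16 + (-1) * (x * x)) + flat 0 (- (1 / 4) + 1 * (x * x)).
Proof.
have f0 y : 0 <= flat 0 y by rewrite /flat; case: ifP; rewrite ?mulr_ge0 ?expR_ge0.
have fp y : 0 < y -> 0 < flat 0 y.
  by move=> y0; rewrite /flat y0 expr0 mul1r expR_gt0.
have [xx|xx] := ltP (x * x) (9 / 16).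
  apply: ltr_pwDl => //; apply: fp; lra.
apply: ltr_wpDl => //; apply: fp; lra.
Qed.

Lemma smooth_plateau : smooth_curve plateau.
Proof.
have ssq : smooth_curve (fun x => x * x : R^o) by exact: (@smoothM R R^o _ _ (@smooth_id R) (@smooth_id R)).
have sf a b : smooth_curve (fun x => flat 0 (a + b * (x * x))).
  apply: (@smooth_comp _ _ (fun x => a + b * (x * x) : R^o)) smooth_flat.
  exact: smooth_comp ssq (smooth_affine a b).
apply: (@smoothM R R^o) => //; apply: smoothV; first exact: (@smoothD R R^o).
by move=> t; rewrite gt_eqF// den_gt0.
Qed.

Let sqr_norm x : x * x = `|x| * `|x|.
Proof. by rewrite -normrM ger0_norm// -expr2 sqr_ge0. Qed.

Lemma plateau1 x : `|x| <= 1 / 2 -> plateau x = 1.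
Proof.
move=> x2; have x0 := normr_ge0 x; rewrite /plateau.
have -> : flat 0 (- (1 / 4) + 1 * (x * x)) = 0.
  rewrite /flat ifF//; apply/negbTE; rewrite -leNgt sqr_norm; nra.
rewrite addr0 divff// gt_eqF// /flat ifT ?expr0 ?mul1r ?expR_gt0//.
by rewrite sqr_norm; nra.
Qed.

Lemma plateau0 x : 3 / 4 <= `|x| -> plateau x = 0.
Proof.
move=> x2; rewrite /plateau /flat ifF ?mul0r//; apply/negbTE.
by rewrite -leNgt sqr_norm; nra.
Qed.

Lemma plateau_le1 x : `|plateau x| <= 1.
Proof.
rewrite /plateau; have f0 y : 0 <= flat 0 y.
  by rewrite /flat; case: ifP; rewrite ?mulr_ge0 ?expR_ge0.
rewrite ger0_norm; last by rewrite divr_ge0// addr_ge0.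
by rewrite ler_pdivrMr// [leRHS]mul1r lerDl.
Qed.

(** A bounded reparametrization that is the identity near 0; it turns local
    statements about curves in an open set into global ones. *)
Definition cutoff (d : R) t : R^o := plateau (0 + d^-1 * t) *: (t : R^o).

Lemma smooth_cutoff d : smooth_curve (cutoff d).
Proof.
apply: (@smoothM R R^o) (@smooth_id R).
exact: (@smooth_comp _ _ (fun t => 0 + d^-1 * t : R^o) plateau
  (smooth_affine 0 d^-1) smooth_plateau).
Qed.

Lemma cutoff_id d t : 0 < d -> `|t| <= d / 2 -> cutoff d t = t.
Proof.
move=> d0 td; rewrite /cutoff plateau1 ?scale1r// add0r normrM normfV (gtr0_norm d0).
by rewrite ler_pdivrMl//; lra.
Qed.

Lemma cutoff_lt d t : 0 < d -> `|cutoff d t| < d.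
Proof.
move=> d0; rewrite /cutoff; have [td|td] := leP (3 / 4) `|0 + d^-1 * t|.
  by rewrite plateau0// scale0r normr0.
rewrite [_ *: _]/(_ * _) normrM; apply: le_lt_trans (_ : `|t| < d).
  by rewrite -[leRHS]mul1r ler_wpM2r// plateau_le1.
move: td; rewrite add0r normrM normfV (gtr0_norm d0) ltr_pdivrMl//; lra.
Qed.

Lemma cutoff0 d : 0 < d -> cutoff d 0 = 0.
Proof. by move=> d0; rewrite cutoff_id// normr0 divr_ge0// ltW. Qed.

Lemma cder_supp (b : R -> R^o) n x : (forall x, 3 / 4 < `|x| -> b x = 0) ->
  smooth_curve b -> 3 / 4 < `|x| -> cder n b x = 0.
Proof.
move=> b0 sb xb; have d0 : 0 < `|x| - 3 / 4 by rewrite subr_gt0.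
have sc := smooth_cst (0 : R^o).
have := @cder_near _ R^o b (fun=> 0) x x (`|x| - 3 / 4) n d0 _ sb 0.
rewrite normr0 => /(_ _ d0); rewrite addr0 => ->.
  rewrite (@cder_tower _ R^o (fun _ _ => 0))// => _ t; exact: der_cst.
move=> h hd; rewrite b0//; have := ler_normD (x + h) (- h).
by rewrite addrK normrN; lra.
Qed.

Lemma smooth_supp_bounded (b : R -> R^o) : (forall x, 3 / 4 < `|x| -> b x = 0) ->
  smooth_curve b -> exists2 M, 0 <= M & forall x, `|b x| <= M.
Proof.
move=> b0 sb.
have cb : continuous (fun x => `|b x| : R).
  move=> x; apply: cvg_norm; apply/(@cvgrPdist_lt _ R^o) => e e0.
  have [d d0 hd] := smooth_continuous x sb (csemi_norm R) e0.
  exists d => // y /= xy; have := hd (y - x).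
  have -> : x + (y - x) = y by ring.
  by rewrite distrC [`|b x - _|]distrC; exact.
have N11 : -1 <= 1 :> R by lra.
have [y _ hy] := @EVT_max R (fun x => `|b x|) (-1) 1 N11 (continuous_subspaceT cb).
exists `|b y| => // x; have [x1|x1] := leP `|x| 1.
  by apply: hy; rewrite in_itv /= -ler_norml.
by rewrite b0 ?normr0//; apply: lt_trans x1; lra.
Qed.

End bump.

(** * Curves through rapidly converging sequences *)

Section geometric.
Variable R : realType.
Implicit Types (C e l : R).

Lemma geom_small C e l : 0 <= l < 1 -> 0 < e ->
  exists N, forall n, (N <= n)%N -> C * l ^+ n < e.
Proof.
move=> /andP[l0 l1] e0.
have : (C * l ^+ n) @[n --> \oo] --> (C * 0 : R).
  by rewrite mulr0; apply: cvg_geometric; rewrite ger0_norm.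
rewrite mulr0 => /(@cvgrPdist_lt _ R^o) /(_ _ e0) [N _ hN].
exists N => n /hN /=; rewrite sub0r normrN; apply: le_lt_trans; exact: ler_norm.
Qed.

Lemma geom_tail l M k : 0 <= l < 1 ->
  \sum_(i < k) l ^+ (M + i) <= l ^+ M / (1 - l).
Proof.
move=> /andP[l0 l1]; have l10 : 0 < 1 - l by rewrite subr_gt0.
rewrite ler_pdivlMr// -subr_ge0.
suff -> : l ^+ M - (\sum_(i < k) l ^+ (M + i)) * (1 - l) = l ^+ (M + k).
  exact: exprn_ge0.
elim: k => [|k IH]; first by rewrite big_ord0 mul0r subr0 addn0.
rewrite big_ord_recr /= mulrDl opprD addrA IH addnS exprSr; ring.
Qed.

End geometric.

Section special_curves.
Context {R : realType}.
Implicit Types (t : R) (n m : nat).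

(** The pieces of the curves are centred at the nodes, which tend to 0; the
    choice [2 ^ - n ^ 2] for their size beats all powers of the radii. *)
Definition node n : R := 2^-1 ^+ n.
Definition radius n : R := node n / 4.
Definition eps n : R := 2^-1 ^+ (n * n).

Let half01 : 0 <= (2^-1 : R) < 1. Proof. by apply/andP; split; lra. Qed.

Lemma node_gt0 n : 0 < node n. Proof. by rewrite exprn_gt0// invr_gt0. Qed.

Lemma radius_gt0 n : 0 < radius n. Proof. by rewrite divr_gt0// node_gt0. Qed.

Lemma eps_gt0 n : 0 < eps n. Proof. by rewrite exprn_gt0// invr_gt0. Qed.

Lemma node_half m n : (m < n)%N -> node n <= node m / 2.
Proof.
move=> mn; rewrite /node -exprSr; apply: ler_wiXn2l => //.
by rewrite invf_le1// ler1n.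
Qed.

Lemma node_le n : node n <= n.+1%:R^-1.
Proof.
rewrite /node exprVn lef_pV2 ?posrE ?exprn_gt0// -natrX ler_nat.
exact: ltn_expl.
Qed.

(** Decay faster than every power of the radii is stable under division by the
    radii, hence under termwise differentiation of the series below. *)
Definition rapid (e : nat -> R) := (forall n, 0 <= e n) /\
  forall k, exists C, forall n, e n / radius n ^+ k <= C * 2^-1 ^+ n.

Lemma rapid_eps : rapid eps.
Proof.
split=> [n|k]; first exact/ltW/eps_gt0.
exists (2 ^+ (k.+1 * k.+1 + 2 * k)) => n.
have two_gt0 m : 0 < 2 ^+ m :> R by exact: exprn_gt0.
have -> : radius n = (2 ^+ (n + 2))^-1.
  by rewrite /radius /node exprVn exprD invfM expr2; congr (_ * _^-1); ring.
rewrite /eps !exprVn -exprM.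
move: (two_gt0 (n * n)%N) (two_gt0 ((n + 2) * k)%N) (two_gt0 n).
set a := 2 ^+ (n * n); set b := 2 ^+ ((n + 2) * k); set c := 2 ^+ n.
move=> a0 b0 c0; rewrite ler_pdivlMr//.
have -> : a^-1 / b^-1 * c = (b * c) / a by field; rewrite !gt_eqF.
rewrite ler_pdivrMr// -!exprD.
rewrite ler_eXn2l ?ltr1n//; nia.
Qed.

Lemma rapid_div e : rapid e -> rapid (fun n => e n / radius n).
Proof.
move=> [e0 ek]; split=> [n|k]; first by rewrite divr_ge0// ltW// radius_gt0.
have [C hC] := ek k.+1; exists C => n.
by rewrite -mulrA -invfM -exprS.
Qed.

Section series.
Variables (V : lcsType R) (y : nat -> V).
Hypothesis by_ : forall p, csemi p -> exists M, forall n, p (y n) <= M.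

Definition bump_term (e : nat -> R) (b : R -> R^o) t n : V :=
  (e n * b ((t - node n) / radius n)) *: y n.

(** For [t > 0] all terms of index at least [2 / t] vanish at [t]; for
    [t <= 0] all terms do, and the sum is empty. *)
Definition bump_series e b t : V :=
  \sum_(n < Num.truncn (2 / t)) bump_term e b t n.

Definition supp (b : R -> R^o) := forall x, 3 / 4 < `|x| -> b x = 0.

Lemma bump_term0 e b t n : supp b -> (Num.truncn (2 / t) <= n)%N ->
  bump_term e b t n = 0.
Proof.
move=> sb tn; rewrite /bump_term sb ?mulr0 ?scale0r//.
have r0 := radius_gt0 n; have n0 := node_gt0 n.
rewrite normrM normfV (gtr0_norm r0) ltr_pdivlMr// /radius.
have [t0|t0] := leP t 0.
  rewrite ler0_norm; lra.
suff : 5 / 4 * node n < t by move=> ?; rewrite gtr0_norm; lra.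
have : 2 / t < n.+1%:R.
  by apply: lt_le_trans (truncnS_gt _) _; rewrite ler_nat.
rewrite ltr_pdivrMr// => H; have := node_le n.
have N0 : 0 < n.+1%:R :> R by [].
rewrite -[_^-1]mul1r ler_pdivlMr// => H2; nra.
Qed.

Lemma bump_seriesE e b t N : supp b -> (Num.truncn (2 / t) <= N)%N ->
  bump_series e b t = \sum_(n < N) bump_term e b t n.
Proof.
move=> sb tN; rewrite /bump_series -(subnKC tN) big_split_ord /=.
rewrite [X in _ + X]big1 ?addr0// => i _.
by rewrite bump_term0// leq_addr.
Qed.

Lemma bump_tail e b p : rapid e -> supp b -> smooth_curve b -> csemi p ->
  exists C, forall N t,
  p (\sum_(n < N) bump_term e b t n - bump_series e b t) <= C * 2^-1 ^+ N.
Proof.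
move=> [e0 /(_ 0) [C hC]] sb smb cp.
have [M M0 hM] := smooth_supp_bounded sb smb.
have [P hP] := by_ cp; have P0 := le_trans (csemi_ge0 cp _) (hP 0).
have hC' n : e n <= C * 2^-1 ^+ n by have := hC n; rewrite expr0 divr1.
have C0 : 0 <= C by have := le_trans (e0 0) (hC' 0); rewrite expr0 mulr1.
exists (C * M * P * 2) => N t.
set k := (Num.truncn (2 / t) - N)%N.
rewrite (@bump_seriesE e b t (N + k))//; last by rewrite /k; lia.
rewrite big_split_ord /= opprD addrA subrr sub0r csemiN//.
rewrite (le_trans (csemi_sum cp _ _ _))//.
apply: (@le_trans _ _ (\sum_(i < k) C * M * P * 2^-1 ^+ (N + i))).
  apply: ler_sum => i _; rewrite /bump_term csemiZ// normrM (ger0_norm (e0 _)).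
  rewrite [leRHS](_ : _ = C * 2^-1 ^+ (N + i) * M * P); last by ring.
  by do !apply: ler_pM => //; rewrite ?mulr_ge0// csemi_ge0.
rewrite -mulr_sumr -[leRHS]mulrA ler_wpM2l ?mulr_ge0//.
have := geom_tail N k half01; rewrite [in leRHS]mulrC.
by congr (_ <= _ * _); field.
Qed.

(** The series is differentiated termwise: only finitely many terms matter near
    any [t > 0], and the tails are uniformly geometric. *)
Lemma der_bump_series e b t : rapid e -> supp b -> smooth_curve b ->
  der (bump_series e b) t (bump_series (fun n => e n / radius n) (cder 1 b) t).
Proof.
move=> re sb smb.
have smb' := smooth_cder 1 smb.
have sb' : supp (cder 1 b) by move=> x; exact: cder_supp.
apply: (@der_limit R V nat \oo _
  (fun N t => \sum_(n < N) bump_term e b t n)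
  (fun N t => \sum_(n < N) bump_term (fun n => e n / radius n) (cder 1 b) t n)
  _ (bump_series (fun n => e n / radius n) (cder 1 b))).
- move=> N s; apply: der_sum => n.
  have := @der_comp _ R^o (fun t => - (node n / radius n) + (radius n)^-1 * t : R^o)
    b s (radius n)^-1 _ _ (@smooth_der _ _ b 0 _ smb).
  have da : der (fun t => - (node n / radius n) + (radius n)^-1 * t : R^o) s (radius n)^-1.
    have := derD (@der_cst R R^o (- (node n / radius n)) s) (derZ (radius n)^-1 (der_id s)).
    by rewrite add0r [_ *: 1]mulr1.
  move=> /(_ da) /(derZ (e n)) /derM /(_ (@der_cst _ _ (y n) s)).
  rewrite scaler0 add0r; have E u : - (node n / radius n) + (radius n)^-1 * u =
    (u - node n) / radius n by ring.
  rewrite E /bump_term; have -> : e n *: ((radius n)^-1 *: cder 1 b ((s - node n) / radius n)) =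
    e n / radius n * cder 1 b ((s - node n) / radius n) by rewrite /GRing.scale /= mulrA.
  by apply: der_ext => u; rewrite E.
- move=> s p cp d d0; have [C hC] := bump_tail re sb smb cp.
  have [N hN] := geom_small C half01 d0.
  by exists N => // n /= /hN; apply: le_lt_trans; exact: hC.
- move=> p cp d d0; exists 1 => //.
  have [C hC] := bump_tail (rapid_div re) sb' smb' cp.
  have [N hN] := geom_small C half01 d0.
  by exists N => // n /= /hN /ltW Cd h _; apply: le_trans Cd; exact: hC.
Qed.

Lemma smooth_bump_series e b : rapid e -> supp b -> smooth_curve b ->
  smooth_curve (bump_series e b).
Proof.
move=> re sb smb; apply/smoothP => n.
elim: n e b re sb smb => // n IH e b re sb smb.
exists (bump_series (fun n => e n / radius n) (cder 1 b)); split.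
  by move=> t; exact: der_bump_series.
apply: IH; [exact: rapid_div|by move=> x; exact: cder_supp|exact: smooth_cder].
Qed.

(** The supports of the terms are disjoint: consecutive nodes differ by a factor
    2, and the radius is a quarter of the node. *)
Lemma bump_series_node e b n t : supp b -> `|t - node n| <= radius n / 2 ->
  bump_series e b t = bump_term e b t n.
Proof.
move=> sb tn; set N := maxn (Num.truncn (2 / t)) n.+1.
have nN : (n < N)%N by rewrite leq_maxr.
rewrite (@bump_seriesE e b t N) ?leq_maxl//.
rewrite (bigD1 (Ordinal nN))//= big1 ?addr0// => -[m mN].
rewrite -val_eqE /= => mn; rewrite /bump_term sb ?mulr0 ?scale0r//.
have r0 := radius_gt0 m; rewrite normrM normfV (gtr0_norm r0) ltr_pdivlMr//.
have a0 := node_gt0 m; have b0 := node_gt0 n.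
move: tn; rewrite ler_distl /radius => /andP[t1 t2].
have [mn'|mn'|/eqP] := ltngtP m n; last by rewrite (negbTE mn).
  have H := node_half mn'; rewrite ltr0_norm; lra.
have H := node_half mn'; rewrite gtr0_norm; lra.
Qed.

End series.
End special_curves.

Section sequences_on_curves.
Context {R : realType}.
Implicit Types (V : lcsType R) (t : R) (n : nat).

(** A bounded sequence, scaled down by [eps n], is assumed by a smooth curve on
    intervals around the nodes. *)
Lemma plateau_curve V (y : nat -> V) :
  (forall p, csemi p -> exists M, forall n, p (y n) <= M) ->
  exists2 c : R -> V, smooth_curve c &
    forall n t, `|t - node n| <= radius n / 2 -> c t = eps n *: y n.
Proof.
move=> by_; have sb : supp (@plateau R) by move=> x /ltW; exact: plateau0.
exists (bump_series y eps (@plateau R)).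
  by apply: smooth_bump_series => //; [exact: rapid_eps|exact: smooth_plateau].
move=> n t tn; rewrite (bump_series_node _ _ sb tn) /bump_term plateau1 ?mulr1//.
have r0 := radius_gt0 n; rewrite normrM normfV (gtr0_norm (radius_gt0 _)).
by rewrite ler_pdivrMr ?radius_gt0//; move: tn; lra.
Qed.

(** Slope at the [n]-th node of the curve in [traverse]. *)
Definition speed n : R := eps n / radius n.

Lemma speed_gt0 n : 0 < speed n.
Proof. by rewrite divr_gt0 ?eps_gt0 ?radius_gt0. Qed.

(** The values at the nodes are prescribed by a plateau curve, to which a fixed
    series with profile [x * plateau x] adds the slopes. *)
Lemma traverse (s0 : R) (s : nat -> R) : (forall n, `|s n - s0| <= eps n) ->
  exists2 c : R -> R^o, smooth_curve c &
    forall n t, `|t - node n| <= radius n / 2 ->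
      c t = s n + speed n * (t - node n).
Proof.
move=> ss0.
have [|c1 sc1 hc1] := @plateau_curve R^o (fun n => (s n - s0) / eps n).
  move=> p cp; exists (p 1) => n; rewrite csemi_realE//.
  rewrite -[leRHS]mul1r ler_wpM2r ?csemi_ge0// normrM normfV.
  by rewrite (gtr0_norm (eps_gt0 n)) ler_pdivrMr ?eps_gt0// mul1r.
pose b (x : R) : R^o := x *: plateau x.
have sb : supp b by move=> x /ltW H; rewrite /b plateau0// scaler0.
pose c2 := @bump_series R R^o (fun=> 1) eps b.
have sc2 : smooth_curve c2.
  apply: smooth_bump_series => //; last exact: (@smoothM R R^o _ _ (@smooth_id R) (@smooth_plateau R)).
    by move=> p cp; exists (p 1).
  exact: rapid_eps.
exists (fun t => s0 + (c1 t + c2 t)).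
  exact: (@smoothD R R^o) (smooth_cst _) (@smoothD R R^o _ _ sc1 sc2).
move=> n t tn; rewrite (hc1 n)// /c2 (bump_series_node _ _ sb tn) /bump_term /b plateau1 /speed.
  by rewrite /GRing.scale /=; field; rewrite !gt_eqF ?eps_gt0 ?radius_gt0.
rewrite normrM normfV (gtr0_norm (radius_gt0 _)) ler_pdivrMr ?radius_gt0//.
by move: tn; lra.
Qed.

(** The [j]-th derivative of [G] at the [n]-th node is [speed n ^+ j] times that
    of [g n], and it converges because the nodes tend to 0. *)
Lemma traverse_cder V (G : R -> V) (g : nat -> R -> V) (t : nat -> R) j p :
  smooth_curve G -> (forall n, smooth_curve (g n)) -> csemi p ->
  (forall n u, `|u - node n| <= radius n / 2 ->
    G u = g n (t n + speed n * (u - node n))) ->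
  exists M N, forall n, (N <= n)%N ->
    speed n ^+ j * p (cder j (g n) (t n)) <= M.
Proof.
move=> sG sg cp Gg.
have [d d0 hd] := smooth_continuous 0 (smooth_cder j sG) cp ltr01.
have half01 : 0 <= (2^-1 : R) < 1 by apply/andP; split; lra.
have [N hN] := geom_small 1 half01 d0.
exists (p (cder j G 0) + 1), N => n /hN; rewrite mul1r -/(node n) => nd.
have r20 : 0 < (radius n : R) / 2 by rewrite divr_gt0 ?radius_gt0.
have sa : smooth_curve (fun h => g n (t n + speed n * h)).
  exact: smooth_comp (smooth_affine _ _) (sg n).
have := @cder_near R V G (fun h => g n (t n + speed n * h)) (node n) 0 _ j r20 _ sG 0.
rewrite normr0 !addr0 cder_affine// mulr0 addr0 => H.
have <- : p (cder j G (node n)) = speed n ^+ j * p (cder j (g n) (t n)).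
  rewrite H// ?csemiZ// ?gtr0_norm ?exprn_gt0 ?speed_gt0// => h /ltW hr.
  by rewrite add0r (Gg n) (addrC (node n)) addrK.
have := hd (node n); rewrite add0r (gtr0_norm (node_gt0 n)) => /(_ nd) /ltW H2.
by rewrite (le_trans (csemi_le_add cp _ (cder j G 0)))// lerD2l.
Qed.

(** Local boundedness can be tested on sequences, up to weights that may decay
    arbitrarily fast. *)
Lemma bounded_by_sequences (X : Type) (A : nat -> set X) (b : X -> R)
    (k : nat -> R) : (forall n, 0 < k n) ->
  (forall x : nat -> X, (forall n, A n (x n)) ->
    exists M N, forall n, (N <= n)%N -> k n * b (x n) <= M) ->
  exists n M, forall x, A n x -> b x <= M.
Proof.
move=> k0 H; apply: contrapT => /forallNP nb.
have {}nb n : exists x, A n x /\ n%:R / k n < b x.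
  have /forallNP /(_ (n%:R / k n)) /existsNP[x /not_implyP[Ax /negP]] := nb n.
  by rewrite -ltNge => bx; exists x.
have [x hx] := choice nb.
have [n|M [N hN]] := H x; first exact: (hx n).1.
have := hN (maxn N (Num.truncn M).+1) (leq_maxl _ _); apply/negP; rewrite -ltNge.
have := (hx (maxn N (Num.truncn M).+1)).2; rewrite ltr_pdivrMr// mulrC.
apply: le_lt_trans; apply/ltW; apply: lt_le_trans (truncnS_gt _) _.
by rewrite ler_nat leq_maxr.
Qed.

End sequences_on_curves.

(** * Smooth functions of two real variables *)

Section two_variables.
Context {R : realType} {V : lcsType R}.
Implicit Types (s t h : R) (k : R -> R -> V) (p : V -> R).

(** Smoothness on the plane in the sense of curves, without a product space. *)
Definition smooth2 k := forall a b : R -> R^o, smooth_curve a ->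
  smooth_curve b -> smooth_curve (fun u => k (a u) (b u)).

Lemma smooth2C k : smooth2 k -> smooth2 (fun s t => k t s).
Proof. by move=> sk a b sa sb; exact: sk. Qed.

Lemma smooth2_l k t : smooth2 k -> smooth_curve (k^~ t).
Proof. by move=> sk; exact: sk (@smooth_id R) (@smooth_cst R R^o t). Qed.

Lemma smooth2_r k s : smooth2 k -> smooth_curve (k s).
Proof. by move=> sk; exact: sk (@smooth_cst R R^o s) (@smooth_id R). Qed.

Lemma smooth2_shift k s0 t0 : smooth2 k ->
  smooth2 (fun s t => k (s0 + s) (t0 + t)).
Proof.
by move=> sk a b sa sb; apply: sk; apply: (@smoothD R R^o) => //; exact: smooth_cst.
Qed.

(** The pure partial derivatives are locally bounded: otherwise a smooth curve
    through a rapidly converging sequence of points where they are large would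
    have an unbounded derivative. *)
Lemma locally_bounded2 k p j s0 t0 : smooth2 k -> csemi p ->
  exists2 d, 0 < d & exists M, forall s t, `|s| < d -> `|t| < d ->
    p (cder j (k (s0 + s)) (t0 + t)) <= M.
Proof.
move=> sk cp.
have [||n [M hM]] := @bounded_by_sequences R (R * R)%type
  (fun n => [set x | `|x.1 - s0| <= eps n /\ `|x.2 - t0| <= eps n])
  (fun x => p (cder j (k x.1) x.2)) (fun n => speed n ^+ j).
- by move=> n; rewrite exprn_gt0// speed_gt0.
- move=> x hx.
  have [y|c1 sc1 hc1] := @plateau_curve R R^o (fun n => ((x n).1 - s0) / eps n).
    move=> cy; exists (y 1) => n; rewrite csemi_realE//.
    rewrite -[leRHS]mul1r ler_wpM2r ?csemi_ge0// normrM normfV.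
    by rewrite (gtr0_norm (eps_gt0 n)) ler_pdivrMr ?eps_gt0// mul1r (hx n).1.
  have [c2 sc2 hc2] := @traverse R t0 (fun n => (x n).2) (fun n => (hx n).2).
  apply: (@traverse_cder R V (fun u => k (s0 + c1 u) (c2 u))
    (fun n => k (x n).1) (fun n => (x n).2)) => //.
  + by apply: sk => //; apply: (@smoothD R R^o) => //; exact: smooth_cst.
  + by move=> n; exact: smooth2_r.
  + move=> n u un; rewrite (hc1 n)// (hc2 n)//; congr (k _ _).
    rewrite /GRing.scale /=; field; by rewrite gt_eqF ?eps_gt0.
exists (eps n); first exact: eps_gt0.
exists M => s t sn tn; apply: (hM (s0 + s, t0 + t)).
by rewrite /= ![_ + _ - _]addrC !addKr; split; exact: ltW.
Qed.

End two_variables.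

Section interpolation.
Context {R : realType} {V : lcsType R}.
Implicit Types (s t h : R) (p : V -> R).

Lemma smooth_bounded_itv (c : R -> V) p a r : smooth_curve c -> csemi p ->
  exists K, forall h, `|h| <= r -> p (c (a + h)) <= K.
Proof.
move=> sc cp; have [r0|r0] := ltP r 0.
  by exists 0 => h hr; have := le_lt_trans (le_trans (normr_ge0 h) hr) r0; rewrite ltxx.
have cc : continuous (fun h => p (c (a + h)) : R).
  move=> x; apply/(@cvgrPdist_lt _ R^o) => e e0.
  have [d d0 hd] := smooth_continuous (a + x) sc cp e0.
  exists d => // y /= xy; have := hd (y - x).
  have -> : a + x + (y - x) = a + y by ring.
  rewrite distrC => /(_ xy); apply: le_lt_trans; rewrite ler_norml.
  have := csemi_le_add cp (c (a + y)) (c (a + x)).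
  have := csemi_le_add cp (c (a + x)) (c (a + y)).
  rewrite (csemi_distC cp (c (a + x))); lra.
have Nr : - r <= r by lra.
have [y _ hy] := @EVT_max R (fun h => p (c (a + h))) (- r) r Nr (continuous_subspaceT cc).
by exists (p (c (a + y))) => h hr; apply: hy; rewrite in_itv /= -ler_norml.
Qed.

(** Iterated, the improvement of the bound converges geometrically to its fixed
    point [2 D]. *)
Lemma halving_bound (P : R -> Prop) (D K0 x : R) : P K0 ->
  (forall K, P K -> P (K / 2 + D)) -> (forall K, P K -> x <= K) -> x <= 2 * D.
Proof.
move=> PK0 PS Px; apply/ler_addgt0Pr => e e0.
have H i : P (2 * D + (K0 - 2 * D) * 2^-1 ^+ i).
  elim: i => [|i IH]; first by rewrite expr0 mulr1 addrC subrK.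
  have := PS _ IH; set q := 2^-1 ^+ i => Pq.
  have -> : 2 * D + (K0 - 2 * D) * 2^-1 ^+ i.+1 = (2 * D + (K0 - 2 * D) * q) / 2 + D.
    by rewrite exprS -/q; field.
  exact: Pq.
have half01 : 0 <= (2^-1 : R) < 1 by apply/andP; split; lra.
have [N hN] := geom_small (K0 - 2 * D) half01 e0.
by rewrite (le_trans (Px _ (H N)))// lerD2l ltW// hN.
Qed.

(** Interpolation inequality of Landau: the first derivative is controlled by
    the function and a derivative of higher order. The induction on the order
    uses the case of the second derivative for [u] and the previous case for
    its derivative; the bound for the first derivative then occurs on the right
    with a factor 1/2. *)
Lemma landau m : exists2 C : R, 1 <= C & forall (u : R -> V) p a d tau A B,
  csemi p -> smooth_curve u -> 0 < tau <= d ->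
  (forall h, `|h| <= d -> p (u (a + h)) <= A) ->
  (forall h, `|h| <= d -> p (cder m.+1 u (a + h)) <= B) ->
  forall h, `|h| <= d -> p (cder 1 u (a + h)) <= C * (A / tau + tau ^+ m * B).
Proof.
elim: m => [|m [C C1 IH]].
  exists 1 => // u p a d tau A B cp su /andP[t0 td] uA uB h hd.
  rewrite mul1r expr0 mul1r (le_trans (uB h hd))// lerDr divr_ge0 ?(ltW t0)//.
  by apply: le_trans (uA h hd); exact: csemi_ge0.
have C0 : 0 < C by exact: lt_le_trans C1.
exists (8 * C); first lra.
move=> u p a d tau A B cp su /andP[t0 td] uA uB h hd.
have A0 : 0 <= A by apply: le_trans (uA h hd); exact: csemi_ge0.
have B0 : 0 <= B by apply: le_trans (uB h hd); exact: csemi_ge0.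
have [K0 hK0] := smooth_bounded_itv a d (smooth_cder 1 su) cp.
pose D := 4 * C * (A / tau) + tau ^+ m.+1 * B / 2.
apply: (@le_trans _ _ (2 * D)); last first.
  have -> : 2 * D = 8 * C * (A / tau) + 1 * (tau ^+ m.+1 * B) by rewrite /D; field; rewrite gt_eqF.
  rewrite mulrDr lerD2l ler_wpM2r//; last lra.
  by rewrite mulr_ge0// exprn_ge0// ltW.
apply: (@halving_bound (fun K => forall h, `|h| <= d -> p (cder 1 u (a + h)) <= K) D K0) => //; last first.
  by move=> K; apply.
move=> K hK {}h {}hd.
have su' := smooth_cder 1 su.
have tt : 0 < tau <= d by rewrite t0.
have hK2 := IH (cder 1 u) p a d tau K B cp su' tt hK.
have {}hK2 : forall h, `|h| <= d -> p (cder 2 u (a + h)) <= C * (K / tau + tau ^+ m * B).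
  apply: hK2 => {}h {}hd; rewrite /cder -iterD addn1; exact: uB.
set K2 := C * _ in hK2.
(* this step makes the coefficient of [K] equal to 1/2 *)
pose sg := tau / (2 * C).
have sg0 : 0 < sg by rewrite divr_gt0// mulr_gt0.
have sgd : sg <= d.
  apply: le_trans td; rewrite ler_pdivrMr ?mulr_gt0//.
  by rewrite -[leLHS]mulr1 ler_wpM2l ?ltW//; lra.
(* a step towards the centre stays in the interval *)
pose k := if 0 <= h then - sg else sg.
have ksg : `|k| = sg by rewrite /k; case: ifP => _; rewrite ?normrN gtr0_norm.
have hkd s : `|s| <= `|k| -> 0 <= s * k -> `|h + s| <= d.
  rewrite ksg; move: hd; rewrite /k !ler_norml => /andP[h1 h2] /andP[s1 s2].
  case: ifPn => [h0 sk|]; last first.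
    rewrite -ltNge => h0 sk; have s0 : 0 <= s by rewrite -(pmulr_lge0 _ sg0).
    apply/andP; split; lra.
  have s0 : s <= 0 by rewrite -oppr_ge0 -(pmulr_lge0 _ sg0) mulNr -mulrN.
  apply/andP; split; lra.
have H : p (u (a + h + k) - u (a + h) - k *: cder 1 u (a + h)) <= K2 * `|k| ^+ 2.
  have := @mvt R V (fun s => u (a + h + s * k) - s *: (k *: cder 1 u (a + h)))
    (fun s => k *: cder 1 u (a + h + s * k) - k *: cder 1 u (a + h)) p (K2 * `|k| ^+ 2) 0 1 cp ler01.
  rewrite mul1r mul0r !scale1r scale0r !subr0 addr0 mulr1.
  have -> : u (a + h + k) - k *: cder 1 u (a + h) - u (a + h) =
    u (a + h + k) - u (a + h) - k *: cder 1 u (a + h) by lmod R V.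
  have dl s : der (fun s => a + h + s * k : R^o) s k.
    have := derD (@der_cst R R^o (a + h) s) (derM (der_id s) (@der_cst R R^o k s)).
    by rewrite scaler0 !add0r [1 *: _]mul1r.
  apply=> s s01.
    apply: derB; first exact: der_comp (dl s) (@smooth_der _ _ u 0 _ su).
    have := derM (der_id s) (der_cst (k *: cder 1 u (a + h)) s).
    by rewrite scaler0 add0r scale1r.
  rewrite -scalerBr csemiZ// mulrC expr2 mulrA ler_wpM2r//.
  have s0 : 0 <= s by case/andP: s01.
  have s1 : s <= 1 by case/andP: s01.
  have k2 : 0 <= k * k by rewrite -expr2 sqr_ge0.
  have := @mvt R V (fun r => cder 1 u (a + h + r * k))
    (fun r => k *: cder 2 u (a + h + r * k)) p (K2 * `|k|) 0 s cp s0.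
  rewrite mul0r addr0 subr0 => /(_ _ _) H.
  apply: le_trans (H _ _) _.
  - by move=> r _; exact: der_comp (dl r) (@smooth_der _ _ u 1 _ su).
  - move=> r /andP[r0 rs]; rewrite csemiZ// mulrC ler_wpM2r// -addrA.
    apply: hK2; apply: hkd; last by rewrite -mulrA mulr_ge0.
    rewrite normrM ger0_norm// -[leRHS]mul1r ler_wpM2r//; exact: le_trans rs s1.
  - rewrite -[leRHS]mulr1 ler_wpM2l// mulr_ge0//.
    apply: le_trans (hK2 _ hd); exact: csemi_ge0.
have hkd' : `|h + k| <= d by apply: hkd => //; rewrite -expr2 sqr_ge0.
rewrite ksg in H.
have H2 : sg * p (cder 1 u (a + h)) <= 2 * A + K2 * sg ^+ 2.
  rewrite -{1}ksg -csemiZ//.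
  have -> : k *: cder 1 u (a + h) = (u (a + h + k) - u (a + h)) -
      (u (a + h + k) - u (a + h) - k *: cder 1 u (a + h)) by lmod R V.
  rewrite (le_trans (csemiB cp _ _))// lerD// (le_trans (csemiB cp _ _))//.
  by rewrite mulr_natl mulr2n lerD// ?uA// -addrA uA.
rewrite -(ler_pM2l sg0) (le_trans H2)// /K2 /D /sg [tau ^+ m.+1]exprS.
rewrite le_eqVlt; apply/orP; left; apply/eqP; field; rewrite !gt_eqF//.
Qed.

End interpolation.

Section geometric_families.
Context {R : realType} {V : lcsType R}.
Variables (p : V -> R) (a : R).
Hypothesis cp : csemi p.
Implicit Types (w : nat -> R -> V) (l : R).

(** The threshold and the neighbourhood may depend on [j], since local
    boundedness is known for one derivative at a time. *)
Definition geometric_near w j l := exists C N, 0 <= C /\ exists2 d, 0 < d &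
  forall n, (N <= n)%N -> forall h, `|h| <= d ->
    p (cder j (w n) (a + h)) <= C * l ^+ n.

(** With [mu ^+ 2 = l] and [m] such that [2 * mu ^+ m < mu], the inequality
    [landau] for [tau] proportional to [mu ^+ n] bounds the first derivative by
    a multiple of [l ^+ n / mu ^+ n + mu ^+ (n * m) * 2 ^+ n], hence of
    [mu ^+ n]. *)
Lemma geometric_near_step w l : (forall n, smooth_curve (w n)) -> 0 < l < 1 ->
  geometric_near w 0 l -> (forall j, geometric_near w j 2) ->
  exists2 l', 0 < l' < 1 & geometric_near w 1 l'.
Proof.
move=> sw /andP[l0 l1] [C0 [N0 [C00 [d0 d00 h0]]]] hw.
pose mu := Num.sqrt l.
have mu0 : 0 < mu by rewrite sqrtr_gt0.
have mumu : mu * mu = l by rewrite -expr2 sqr_sqrtr// ltW.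
have mu1 : mu < 1 by rewrite -sqrtr1 ltr_sqrt.
have mu01 : 0 <= mu < 1 by rewrite ltW.
have [m0 hm] := geom_small 2 mu01 mu0.
have {}hm : 2 * mu ^+ m0 < mu by exact: hm.
have [Cm [Nm [Cm0 [dm dm0 hdm]]]] := hw m0.+1.
have [C C1 hC] := @landau R V m0.
have CC0 : 0 <= C by lra.
pose d := Num.min d0 dm.
have dd0 : 0 < d by rewrite lt_min d00.
exists mu; first by rewrite mu0.
exists (C * (C0 / d + d ^+ m0 * Cm)), (maxn N0 Nm); split.
  by rewrite mulr_ge0// addr_ge0// ?divr_ge0 ?mulr_ge0 ?exprn_ge0 ?(ltW dd0).
exists d => // n; rewrite geq_max => /andP[nN0 nNm] h hd.
have mun : 0 < mu ^+ n by exact: exprn_gt0.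
have mun1 : mu ^+ n <= 1 by rewrite exprn_ile1// ltW.
have := hC (w n) p a d (d * mu ^+ n) (C0 * l ^+ n) (Cm * 2 ^+ n) cp (sw n).
rewrite mulr_gt0//= ger_pMr// mun1 => /(_ isT _ _ h hd) H.
apply: le_trans (H _ _) _.
- move=> k kd; apply: h0 => //; apply: le_trans kd _.
  by rewrite /d ge_min lexx.
- move=> k kd; apply: hdm => //; apply: le_trans kd _.
  by rewrite /d ge_min lexx orbT.
rewrite -[leRHS]mulrA ler_wpM2l// mulrDl; apply: lerD.
  rewrite -mumu exprMn le_eqVlt; apply/orP; left; apply/eqP; field.
  by rewrite !gt_eqF.
rewrite exprMn -!mulrA; apply: ler_wpM2l; first by rewrite exprn_ge0 ?(ltW dd0).
rewrite mulrCA; apply: ler_wpM2l => //.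
rewrite -exprM mulnC exprM -exprMn; apply: lerXn2r.
- by rewrite nnegrE mulr_ge0 ?exprn_ge0 ?ltW.
- by rewrite nnegrE ltW.
- by rewrite mulrC ltW.
Qed.

Lemma geometric_near_all w l : (forall n, smooth_curve (w n)) -> 0 < l < 1 ->
  geometric_near w 0 l -> (forall j, geometric_near w j 2) ->
  forall j, exists2 l', 0 < l' < 1 & geometric_near w j l'.
Proof.
move=> sw l01 hw0 hw j; elim: j => [|j [l' l'01 IH]]; first by exists l.
apply: (@geometric_near_step (fun n => cder j (w n)) l') => //.
  by move=> n; exact: smooth_cder.
move=> i; have [C [N [C0 [d d0 hd]]]] := hw (i + j)%N.
exists C, N; split=> //; exists d => // n nN h hh.
by rewrite /cder -iterD; exact: hd.
Qed.

End geometric_families.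

Section partial_derivative.
Context {R : realType} {V : lcsType R}.
Implicit Types (s t h : R) (k : R -> R -> V) (p : V -> R).

Definition dleft k t : V := cder 1 (k^~ t) 0.

(** The second order remainder at [s = 0] is uniform in [t]. *)
Lemma dleft_taylor k p a : smooth2 k -> csemi p ->
  exists2 d, 0 < d & exists2 M, 0 <= M & forall s t, `|s| < d -> `|t| < d ->
    p (k s (a + t) - k 0 (a + t) - s *: dleft k (a + t)) <= M * `|s| ^+ 2.
Proof.
move=> sk cp; have [d d0 [M hM]] := locally_bounded2 2 a 0 (smooth2C sk) cp.
have M0 : 0 <= M.
  by apply: le_trans (hM 0 0 _ _); rewrite ?normr0// csemi_ge0.
exists d => //; exists M => // s t sd td.
have sl := smooth2_l (a + t) sk.
have := @taylor2 _ _ (k^~ (a + t)) (cder 1 (k^~ (a + t))) (cder 2 (k^~ (a + t))) p M 0 s cp.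
rewrite !add0r; apply.
- by move=> u; exact: (@smooth_der _ _ _ 0 u sl).
- by move=> u; exact: (@smooth_der _ _ _ 1 u sl).
- by move=> u us; apply: hM => //; exact: le_lt_trans us sd.
Qed.

Let approx k n t : V := 2 ^+ n *: (k (2^-1 ^+ n) t - k 0 t).

Let smooth_approx k n : smooth2 k -> smooth_curve (approx k n).
Proof. by move=> sk; apply/smoothZ/smoothB; exact: smooth2_r. Qed.

Let half_small (d : R) : 0 < d -> exists N, forall n, (N <= n)%N -> 2^-1 ^+ n < d.
Proof.
move=> d0; have half01 : 0 <= (2^-1 : R) < 1 by apply/andP; split; lra.
have [N hN] := geom_small 1 half01 d0; exists N => n /hN.
by rewrite mul1r.
Qed.

Let approx_near k p a : smooth2 k -> csemi p -> exists M N, 0 <= M /\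
  exists2 d, 0 < d & forall n, (N <= n)%N -> forall h, `|h| < d ->
  p (approx k n (a + h) - dleft k (a + h)) <= M * 2^-1 ^+ n.
Proof.
move=> sk cp; have [d d0 [M M0 hM]] := dleft_taylor a sk cp.
have [N hN] := half_small d0; exists M, N; split=> //; exists d => // n /hN nd h hd.
have n0 : 0 < 2^-1 ^+ n :> R by rewrite exprn_gt0.
have := hM (2^-1 ^+ n) h; rewrite gtr0_norm// => /(_ nd hd).
rewrite /approx; have -> : 2 ^+ n = (2^-1 ^+ n)^-1 :> R by rewrite exprVn invrK.
move: (2^-1 ^+ n) n0 {nd} => q q0 H.
have -> : q^-1 *: (k q (a + h) - k 0 (a + h)) - dleft k (a + h) =
  q^-1 *: (k q (a + h) - k 0 (a + h) - q *: dleft k (a + h)).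
  by lm_coefs R V; field; rewrite gt_eqF.
by rewrite csemiZ// normfV gtr0_norm// ler_pdivrMl// mulrCA.
Qed.

Let step k n t := approx k n.+1 t - approx k n t.

Let smooth_step k n : smooth2 k -> smooth_curve (step k n).
Proof. by move=> sk; apply: smoothB; exact: smooth_approx. Qed.

Let step_half k p a : smooth2 k -> csemi p -> geometric_near p a (step k) 0 2^-1.
Proof.
move=> sk cp; have [M [N [M0 [d d0 hd]]]] := approx_near a sk cp.
exists (2 * M), N; split; first exact: mulr_ge0.
exists (d / 2); first by rewrite divr_gt0.
move=> n Nn h hd2; have hd' : `|h| < d by lra.
have H1 := hd n Nn h hd'; have H2 := hd n.+1 (leqW Nn) h hd'.
rewrite /cder /= /step (le_trans (csemi_triangle cp (dleft k (a + h)) _ _))//.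
rewrite (csemi_distC cp (dleft _ _)) (le_trans (lerD H2 H1))// exprS.
have : 0 <= M * 2^-1 ^+ n by rewrite mulr_ge0// exprn_ge0.
by move: (2^-1 ^+ n) => q; lra.
Qed.

Let step_two k p a j : smooth2 k -> csemi p -> geometric_near p a (step k) j 2.
Proof.
move=> sk cp; have [d d0 [M hM]] := locally_bounded2 j 0 a sk cp.
have M0 : 0 <= M.
  by apply: le_trans (hM 0 0 _ _); rewrite ?normr0// csemi_ge0.
have [N hN] := half_small d0.
exists (6 * M), N; split; first exact: mulr_ge0.
exists (d / 2); first by rewrite divr_gt0.
move=> n Nn h hd2; have hd' : `|h| < d by lra.
have H m : (N <= m)%N -> p (cder j (approx k m) (a + h)) <= 2 * M * 2 ^+ m.
  move=> Nm; rewrite /approx cderZ; last by apply: smoothB; exact: smooth2_r.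
  rewrite cderB; [|exact: smooth2_r..].
  rewrite csemiZ// mulrC ger0_norm ?exprn_ge0// ler_wpM2r ?exprn_ge0//.
  rewrite (le_trans (csemiB cp _ _))// mulr_natl mulr2n lerD//.
    have := hM (2^-1 ^+ m) h; rewrite add0r; apply=> //.
    by rewrite ger0_norm ?exprn_ge0// hN.
  by have := hM 0 h; rewrite add0r normr0; exact.
rewrite /step cderB; [|exact: smooth_approx..].
rewrite (le_trans (csemiB cp _ _))// (le_trans (lerD (H _ (leqW Nn)) (H _ Nn)))//.
rewrite exprS; have : 0 <= 2 ^+ n :> R by exact: exprn_ge0.
by move: (2 ^+ n) => q; lra.
Qed.

(** The partial derivative is a limit of difference quotients along
    [s = 2 ^- n]. Consecutive quotients differ by a multiple of [2 ^- n], while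
    their [t]-derivatives grow at most like [2 ^+ n]; by interpolation all
    derivatives of the differences decay geometrically, so all derivatives
    converge locally uniformly. *)
Lemma smooth_dleft k : uniform_complete V -> smooth2 k -> smooth_curve (dleft k).
Proof.
move=> cV sk.
have geo p a j : csemi p -> exists2 l, 0 < l < 1 & geometric_near p a (step k) j l.
  move=> cp; have half01 : 0 < (2^-1 : R) < 1 by apply/andP; split; lra.
  apply: (geometric_near_all cp (l := 2^-1)) => //.
  - by move=> n; exact: smooth_step.
  - exact: step_half.
  - by move=> i; exact: step_two.
have tail p a j : csemi p -> forall e, 0 < e -> exists N, exists2 d, 0 < d &
    forall n m, (N <= n)%N -> (n <= m)%N -> forall h, `|h| < d ->
    p (cder j (approx k m) (a + h) - cder j (approx k n) (a + h)) <= e.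
  move=> cp e e0; have [l l01 [C [N [C0 [d d0 hd]]]]] := geo p a j cp.
  have l01' : 0 <= l < 1 by case/andP: l01 => /ltW ->.
  have [N' hN'] := geom_small (C / (1 - l)) l01' e0.
  exists (maxn N N'), d => // n m; rewrite geq_max => /andP[Nn N'n] nm h /ltW hh.
  apply: le_trans (ltW (hN' n N'n)); rewrite -(subnKC nm); set i := (m - n)%N.
  apply: (@le_trans _ _ (\sum_(q < i) C * l ^+ (n + q))); last first.
    rewrite -mulr_sumr -[leRHS]mulrA ler_wpM2l//.
    by rewrite (le_trans (geom_tail n i l01'))// mulrC.
  elim: i => [|i IH]; first by rewrite addn0 subrr csemi0// big_ord0.
  rewrite big_ord_recr /= addrC addnS.
  rewrite (le_trans (csemi_triangle cp (cder j (approx k (n + i)) (a + h)) _ _))//.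
  rewrite lerD//; have := hd (n + i)%N (leq_trans Nn (leq_addr _ _)) h hh.
  by rewrite /step cderB//; exact: smooth_approx.
have lim (jt : nat * R) : exists l : V, forall p, csemi p -> forall e, 0 < e ->
    \forall n \near \oo, p (cder jt.1 (approx k n) jt.2 - l) < e.
  apply: csemi_complete => // p cp e e0.
  have e20 : 0 < e / 2 by rewrite divr_gt0.
  have [N [d d0 hd]] := tail p jt.2 jt.1 cp _ e20.
  exists [set n | (N <= n)%N]; first by exists N.
  have H n m : (N <= n)%N -> (n <= m)%N ->
      p (cder jt.1 (approx k m) jt.2 - cder jt.1 (approx k n) jt.2) < e.
    move=> Nn nm; have := hd n m Nn nm 0; rewrite normr0 addr0 => /(_ d0).
    by move=> /le_lt_trans; apply; lra.
  move=> n m /= Nn Nm; have [nm|mn] := leqP n m.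
    by rewrite csemi_distC//; exact: H.
  by apply: H => //; exact: ltnW.
have [L hL] := choice lim.
have dL j t : der (fun t => L (j, t)) t (L (j.+1, t)).
  apply: (@der_limit R V nat \oo _ (fun n => cder j (approx k n))
    (fun n => cder j.+1 (approx k n)) _ (fun t => L (j.+1, t))).
  - by move=> n s; apply: smooth_der; exact: smooth_approx.
  - by move=> s p cp e e0; exact: (hL (j, s)).
  - move=> p cp e e0; have e20 : 0 < e / 2 by rewrite divr_gt0.
    have [N [d d0 hd]] := tail p t j.+1 cp _ e20.
    exists d => //; exists N => // n /= Nn h hh.
    have [N' _ hN'] := hL (j.+1, t + h) p cp _ e20.
    have := hN' _ (leq_maxr n N'); have := hd n _ Nn (leq_maxl n N') h hh => /= H1 /ltW H2.
    rewrite (le_trans (csemi_triangle cp (cder j.+1 (approx k (maxn n N')) (t + h)) _ _))//.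
    by rewrite csemi_distC// [leRHS]splitr lerD.
have := @smooth_tower R V (fun j t => L (j, t)) dL; apply: smooth_ext => t.
apply/eqP; rewrite -subr_eq0; apply/eqP/csemi_eq0 => p cp.
apply/eqP; rewrite eq_le csemi_ge0// andbT; apply/ler_addgt0Pr => e e0.
rewrite add0r; have e20 : 0 < e / 2 by rewrite divr_gt0.
have [N _ hN] := hL (0%N, t) p cp _ e20.
have [M [N1 [M0 [d d0 hd]]]] := approx_near t sk cp.
have half01 : 0 <= (2^-1 : R) < 1 by apply/andP; split; lra.
have [N2 hN2] := geom_small M half01 e20.
pose n := maxn N (maxn N1 N2).
have Nn : (N <= n)%N by rewrite leq_maxl.
have N1n : (N1 <= n)%N by rewrite /n; lia.
have N2n : (N2 <= n)%N by rewrite /n; lia.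
have /ltW := hN n Nn; have := hd n N1n 0; rewrite normr0 !addr0 => /(_ d0) H1 H2.
have {}H1 := le_trans H1 (ltW (hN2 n N2n)).
rewrite (le_trans (csemi_triangle cp (approx k n t) _ _))// [leRHS]splitr lerD//.
by rewrite csemi_distC.
Qed.

(** The increment along the diagonal is split into a first-order term at
    [(t, t + h)], whose remainder is uniform by [dleft_taylor], and an increment
    of [k t]; the coefficient [dleft] is continuous, being smooth. *)
Lemma der_diag k t : uniform_complete V -> smooth2 k ->
  der (fun t => k t t) t (cder 1 (k^~ t) t + cder 1 (k t) t).
Proof.
move=> cV sk.
pose g s u := k (t + s) (t + u).
have sg : smooth2 g by exact: smooth2_shift.
have sd := smooth_dleft cV sg.
have E1 : cder 1 (k^~ t) t = dleft g 0.
  have := @cder_near _ _ (k^~ t) (g^~ 0) t 0 1 1 ltr01 _ (smooth2_l t sk) 0.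
  rewrite normr0 !addr0; apply=> // h _; by rewrite /g add0r addr0.
have E2 : cder 1 (k t) t = cder 1 (g 0) 0.
  have := @cder_near _ _ (k t) (g 0) t 0 1 1 ltr01 _ (smooth2_r t sk) 0.
  rewrite normr0 !addr0; apply=> // h _; by rewrite /g add0r addr0.
rewrite E1 E2; apply: derI => p cp.
have [d d0 [M M0 hM]] := dleft_taylor 0 sg cp.
exists (M + 2) => e e0.
have [d1 d10 h1] := smooth_continuous 0 sd cp e0.
have [d2 d20 h2] := @smooth_der _ _ (g 0) 0 0 (smooth2_r 0 sg) p cp _ e0.
exists (Num.min (Num.min d d1) (Num.min d2 e)); first by rewrite !lt_min d0 d10 d20.
move=> h; rewrite !lt_min => /andP[/andP[hd /h1 H1] /andP[/h2 H2 he]].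
have := hM h h hd hd; rewrite !add0r in H1 H2 * => H3.
have gE : k t t = g 0 0 by rewrite /g addr0.
rewrite gE -[k (t + h) (t + h)]/(g h h).
rewrite [X in p X](_ : _ = (g h h - g 0 h - h *: dleft g h) +
  (h *: (dleft g h - dleft g 0) + (g 0 h - g 0 0 - h *: cder 1 (g 0) 0))); last first.
  by lmod R V.
rewrite (le_trans (csemiD cp _ _))//.
have -> : (M + 2) * e * `|h| = M * e * `|h| + (`|h| * e + e * `|h|) by ring.
rewrite lerD//.
  by rewrite (le_trans H3)// expr2 mulrA ler_wpM2r// ler_wpM2l// ltW.
rewrite (le_trans (csemiD cp _ _))// lerD//.
by rewrite csemiZ// ler_wpM2l// ltW.
Qed.

End partial_derivative.

(** * Difference quotients of smooth curves *)

Section hadamard.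
Context {R : realType} {V : lcsType R}.
Implicit Types (t h : R) (g c : R -> V) (p : V -> R).

Let cderS j g : cder j.+1 g = cder j (cder 1 g).
Proof. by rewrite /cder -iterD addn1. Qed.

Lemma der_powZ m (a : V) t :
  der (fun t => (t ^+ m.+1 / (m.+1)`!%:R) *: a) t ((t ^+ m / m`!%:R) *: a).
Proof.
have -> : t ^+ m / m`!%:R = (m.+1)`!%:R^-1 * (m.+1%:R * t ^+ m).
  rewrite factS natrM; field.
  by rewrite nat1r !pnatr_eq0 -lt0n fact_gt0.
have := derM (derZ (m.+1)`!%:R^-1 (der_exp m t)) (der_cst a t).
rewrite scaler0 add0r; apply: der_ext => s.
by congr (_ *: _); rewrite [LHS]mulrC.
Qed.

(** By induction on [m], integrating the estimate for the derivative of [g] with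
    the mean value inequality. *)
Lemma peano g p m e : smooth_curve g -> csemi p -> 0 < e ->
  (forall j, (j < m)%N -> cder j g 0 = 0) ->
  exists2 d, 0 < d & forall h, `|h| < d ->
    p (g h - (h ^+ m / m`!%:R) *: cder m g 0
       - (h ^+ m.+1 / (m.+1)`!%:R) *: cder m.+1 g 0) <= e * `|h| ^+ m.+1.
Proof.
move=> + cp e0; elim: m g => [|m IH] g sg g0.
  have [d d0 hd] := @smooth_der _ _ g 0 0 sg p cp e e0.
  exists d => // h /hd; rewrite add0r !expr1 expr0 !divr1.
  by rewrite scale1r.
have [j jm|d d0 hd] := IH (cder 1 g) (smooth_cder 1 sg).
  by rewrite -cderS g0.
exists d => // h hh.
have := @mvt_norm R V
  (fun s => g s - (s ^+ m.+1 / (m.+1)`!%:R) *: cder m.+1 g 0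
              - (s ^+ m.+2 / (m.+2)`!%:R) *: cder m.+2 g 0)
  (fun s => cder 1 g s - (s ^+ m / m`!%:R) *: cder m.+1 g 0
              - (s ^+ m.+1 / (m.+1)`!%:R) *: cder m.+2 g 0)
  p (e * `|h| ^+ m.+1) 0 h cp.
have g00 : g 0 = 0 := g0 0%N isT.
rewrite !add0r !expr0n /= !mul0r !scale0r !subr0 g00 subr0.
rewrite -mulrA -exprSr; apply.
  move=> s sh; rewrite add0r; apply: derB; last exact: der_powZ.
  by apply: derB; [exact: (@smooth_der _ _ g 0)|exact: der_powZ].
move=> s sh; rewrite add0r; have := hd s (le_lt_trans sh hh).
rewrite -!cderS; move=> /le_trans; apply.
apply: ler_wpM2l; first exact: ltW.
by apply: lerXn2r; rewrite ?nnegrE.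
Qed.

(** The value at 0 is the limit of [g t / t ^+ m] when [g] vanishes to order
    [m] at 0. *)
Definition quotient m g t : V :=
  if t == 0 then (m`!%:R)^-1 *: cder m g 0 else t^-1 ^+ m *: g t.

(** Numerator of the derivative of [g t / t ^+ m] over [t ^+ m.+1]. *)
Let euler m g t : V := t *: cder 1 g t - m%:R *: g t.

Let smooth_euler m g : smooth_curve g -> smooth_curve (euler m g).
Proof.
move=> sg; apply: smoothB; last exact: smoothZ.
by apply: smoothM; [exact: smooth_id|exact: smooth_cder].
Qed.

Let cder_euler m g j : smooth_curve g ->
  cder j (euler m g) = (fun t => t *: cder j.+1 g t + (j%:R - m%:R) *: cder j g t).
Proof.
move=> sg; have -> : euler m g = (fun t => t *: cder 1 g t + (0%:R - m%:R) *: cder 0 g t).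
  by apply/funext => t; rewrite sub0r scaleNr.
apply: (@cder_tower R V (fun j t => t *: cder j.+1 g t + (j%:R - m%:R) *: cder j g t)).
move=> i t.
have := derD (derM (der_id t) (@smooth_der _ _ g i.+1 t sg))
  (derZ (i%:R - m%:R) (@smooth_der _ _ g i t sg)).
by congr der; rewrite -natr1; lmod R V.
Qed.

(** [euler m g] vanishes to order [m.+1] when [g] vanishes to order [m], so
    these quotients form a class stable under differentiation. *)
Lemma der_quotient m g t : smooth_curve g ->
  (forall j, (j < m)%N -> cder j g 0 = 0) ->
  der (quotient m g) t (quotient m.+1 (euler m g) t).
Proof.
move=> sg g0; have [->|t0] := eqVneq t 0.
  apply: derI => p cp; exists 1 => e e0.
  have [d d0 hd] := peano sg cp e0 g0.
  exists d => // h hh; rewrite add0r mul1r /quotient eqxx.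
  have [->|h0] := eqVneq h 0.
    by rewrite scale0r subr0 subrr csemi0// normr0 mulr0.
  have m1 : m.+1%:R - m%:R = 1 :> R by rewrite -natr1; ring.
  rewrite cder_euler// scale0r add0r m1 scale1r.
  have -> : h^-1 ^+ m *: g h - m`!%:R^-1 *: cder m g 0 - h *: ((m.+1)`!%:R^-1 *: cder m.+1 g 0)
    = h^-1 ^+ m *: (g h - (h ^+ m / m`!%:R) *: cder m g 0
       - (h ^+ m.+1 / (m.+1)`!%:R) *: cder m.+1 g 0).
    have x0 : h ^+ m != 0 by rewrite expf_neq0.
    rewrite exprVn exprSr; move: (h ^+ m) (m`!%:R^-1) ((m.+1)`!%:R^-1) x0 => x a b x0.
    by lm_coefs R V; field.
  rewrite csemiZ// normrX normfV.
  have hm0 : 0 < `|h| ^+ m by rewrite exprn_gt0// normr_gt0.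
  rewrite exprVn ler_pdivrMl// (le_trans (hd _ hh))// exprSr mulrCA.
  by rewrite mulrA.
have at0 : 0 < `|t| by rewrite normr_gt0.
rewrite /quotient (negbTE t0).
have := derM (der_invX m t0) (@smooth_der _ _ g 0 t sg).
have -> : t^-1 ^+ m *: cder 1 g t + - (m%:R * t^-1 ^+ m.+1) *: cder 0 g t =
  t^-1 ^+ m.+1 *: euler m g t.
  rewrite /euler /cder /=; by rewrite exprSr; lm_coefs R V; field.
apply: der_near at0 _ => h ht; rewrite ifF//; apply/negbTE.
by rewrite -normr_gt0; have := ler_normD (t + h) (- h); rewrite addrK normrN; lra.
Qed.

Lemma Ck_quotient n m g : smooth_curve g ->
  (forall j, (j < m)%N -> cder j g 0 = 0) -> Ck n (quotient m g).
Proof.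
elim: n m g => // n IH m g sg g0; exists (quotient m.+1 (euler m g)); split.
  by move=> t; exact: der_quotient.
apply: IH; first exact: smooth_euler.
move=> j; rewrite ltnS leq_eqVlt cder_euler// scale0r add0r => /orP[/eqP ->|jm].
  by rewrite subrr scale0r.
by rewrite g0// scaler0.
Qed.

(** The quotient is differentiated directly, because the formula for [q h] as an
    average of the derivative of [c] would require integrals in [V]. *)
Lemma hadamard c t : smooth_curve c -> exists2 q, smooth_curve q &
  (forall h, c (t + h) = c t + h *: q h) /\ q 0 = cder 1 c t.
Proof.
move=> sc; pose g h := c (t + 1 * h) - c t.
have s1 : smooth_curve (fun h => c (t + 1 * h)) by exact: smooth_comp (smooth_affine _ _) sc.
have s2 := smooth_cst (c t).
have sg : smooth_curve g by exact: smoothB.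
exists (quotient 1 g).
  apply/smoothP => n; apply: Ck_quotient => // -[|//] _.
  by rewrite /cder /= /g mulr0 addr0 subrr.
split=> [h|].
  rewrite /quotient; have [->|h0] := eqVneq h 0.
    by rewrite scale0r !addr0.
  by rewrite expr1 scalerA divff// scale1r /g mul1r; lmod R V.
rewrite /quotient eqxx invr1 scale1r /g cderB// cder_affine//.
rewrite mulr0 addr0 expr1n scale1r.
by rewrite (@cder_tower R V (fun j _ => if j is 0 then c t else 0) 1) ?subr0// => -[|j] s; exact: der_cst.
Qed.

End hadamard.

(** * Directional derivatives *)

Section directional_derivatives.
Context {R : realType} {E F : lcsType R} (U : set E).
Hypotheses (openU : open U) (cF : uniform_complete F).
Implicit Types (x v : E) (c : R -> E) (g : E -> F) (t s h : R).

Definition ddir g x v : F :=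
  flim (h^-1 *: (g (x + h *: v) - g x) @[h --> (0 : R)^']).

(** Smoothness along the curves in [U], for functions with parameters in [E]
    that vary along smooth curves as well. *)
Definition usmooth g := forall c, smooth_curve c -> (forall t, U (c t)) ->
  smooth_curve (fun t => g (c t)).

Definition csmooth n (G : E -> epow E n -> F) :=
  forall c (w : 'I_n -> R -> E), smooth_curve c -> (forall t, U (c t)) ->
    (forall i, smooth_curve (w i)) ->
    smooth_curve (fun t => G (c t) (fun i => w i t)).

Lemma csmooth_usmooth n (G : E -> epow E n -> F) (v : epow E n) : csmooth G ->
  usmooth (fun x => G x v).
Proof. by move=> sG c sc cU; apply: sG => // i; exact: smooth_cst. Qed.

Lemma ddirE g x v l : der (fun h => g (x + h *: v)) 0 l -> ddir g x v = l.
Proof.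
move=> /curve_deriveE <-; rewrite /curve_derive /ddir.
suff -> : (fun h => h^-1 *: (g (x + h *: v) - g x)) =
  curve_quotient (fun h => g (x + h *: v)) 0 by [].
by apply/funext => h; rewrite /curve_quotient add0r scale0r addr0.
Qed.

(** Openness in the form needed to deform curves inside [U]. *)
Lemma tube c (v : R -> E) t : smooth_curve c -> smooth_curve v -> U (c t) ->
  exists2 d, 0 < d & forall s h, `|s| < d -> `|h| < d ->
    U (c (t + h) + s *: v (t + h)).
Proof.
move=> sc sv Uct; have /nbhs_csemi[p [cp [e e0 he]]] : nbhs (c t) U.
  by apply: open_nbhs_nbhs.
have e20 : 0 < e / 2 by rewrite divr_gt0.
have [d1 d10 h1] := smooth_continuous t sc cp e20.
have [d2 d20 h2] := smooth_continuous t sv cp ltr01.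
pose K := p (v t) + 1; have K0 : 0 < K by rewrite ltr_wpDl// csemi_ge0.
exists (Num.min (Num.min d1 d2) (e / 2 / K)).
  by rewrite !lt_min d10 d20 divr_gt0.
move=> s h; rewrite !lt_min => /andP[_ sK] /andP[/andP[/h1 H1 /h2 H2] _].
apply: he; have -> : c (t + h) + s *: v (t + h) - c t =
  (c (t + h) - c t) + s *: v (t + h) by lmod R E.
rewrite (le_lt_trans (csemiD cp _ _))// [ltRHS]splitr ltr_leD// csemiZ//.
have H3 : p (v (t + h)) <= K.
  by rewrite (le_trans (csemi_le_add cp _ (v t)))// lerD2l ltW.
by rewrite (le_trans (ler_wpM2l _ H3))// -ler_pdivlMr// ltW.
Qed.

Lemma der_line g x v : usmooth g -> U x ->
  der (fun h => g (x + h *: v)) 0 (ddir g x v).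
Proof.
move=> sg Ux.
have [d d0 hd] := @tube (fun=> x) (fun=> v) 0 (smooth_cst x) (smooth_cst v) Ux.
have d20 : 0 < d / 2 by rewrite divr_gt0.
have sc : smooth_curve (fun h => x + cutoff d h *: v).
  apply: smoothD; first exact: smooth_cst.
  by apply: smoothM; [exact: smooth_cutoff|exact: smooth_cst].
have sgc : smooth_curve (fun h => g (x + cutoff d h *: v)).
  apply: (sg _ sc) => h; apply: (hd _ 0); first exact: cutoff_lt.
  by rewrite normr0.
suff dg : der (fun h => g (x + h *: v)) 0 (cder 1 (fun h => g (x + cutoff d h *: v)) 0).
  by rewrite (ddirE dg).
apply: der_near d20 _ (@smooth_der _ _ _ 0 0 sgc) => h /ltW hd2.
by rewrite /cder /= add0r cutoff_id.
Qed.

Lemma ddirZ g x a v : usmooth g -> U x -> ddir g x (a *: v) = a *: ddir g x v.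
Proof.
move=> sg Ux; apply: ddirE.
have := @der_comp _ F (fun h => 0 + a * h : R^o) (fun h => g (x + h *: v)) 0 a (ddir g x v).
rewrite mulr0 addr0; have da : der (fun h => 0 + a * h : R^o) 0 a.
  have := derD (@der_cst R R^o 0 0) (derZ a (der_id 0)).
  by rewrite add0r [a *: _]mulr1.
move=> /(_ da (der_line _ _ _)); rewrite /= => /(_ sg Ux).
by apply: der_ext => h; rewrite add0r scalerA mulrC.
Qed.

(** The direction [v + w] is the diagonal of [g (x + s v + t w)]. *)
Lemma ddirD g x v w : usmooth g -> U x ->
  ddir g x (v + w) = ddir g x v + ddir g x w.
Proof.
move=> sg Ux; have sv : smooth_curve (fun h : R => x + h *: v).
  apply: smoothD; first exact: smooth_cst.
  by apply: smoothM; [exact: smooth_id|exact: smooth_cst].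
have Ux0 : U (x + (0 : R) *: v) by rewrite scale0r addr0.
have [d d0 hd] := @tube _ (fun=> w) 0 sv (smooth_cst w) Ux0.
have d20 : 0 < d / 2 by rewrite divr_gt0.
pose k s t := g (x + cutoff d s *: v + cutoff d t *: w).
have sk : smooth2 k.
  move=> a b sa sb; apply: sg.
    apply: smoothD; [apply: smoothD; first exact: smooth_cst|];
    apply: smoothM; (try exact: smooth_cst); apply: smooth_comp => //;
    exact: smooth_cutoff.
  by move=> t; have := hd _ _ (cutoff_lt (b t) d0) (cutoff_lt (a t) d0); rewrite add0r.
apply: ddirE; have := der_diag 0 cF sk.
have dv u (f : R -> F) : (forall h, `|h| < d / 2 -> f h = g (x + h *: u)) ->
    cder 1 f 0 = ddir g x u.
  move=> fg; apply: curve_deriveE; apply: der_near d20 _ (der_line u sg Ux) => h hd2.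
  by rewrite !add0r fg.
rewrite (dv v); last first.
  by move=> h /ltW hd2; rewrite /k cutoff_id// cutoff0// scale0r addr0.
rewrite (dv w); last first.
  by move=> h /ltW hd2; rewrite /k [cutoff d h]cutoff_id// cutoff0// scale0r addr0.
apply: der_near d20 _ => h /ltW hd2; rewrite /k !add0r cutoff_id//.
by rewrite scalerDr addrA.
Qed.

(** Writing [c (t + h) = c t + h *: q h], the composite is the diagonal of
    [g (c t + s *: q u)], which is constant in [u] for [s = 0]. *)
Lemma chain_rule g c t : usmooth g -> smooth_curve c -> (forall t, U (c t)) ->
  der (fun t => g (c t)) t (ddir g (c t) (cder 1 c t)).
Proof.
move=> sg sc cU; have [q sq [cq q0]] := hadamard t sc.
have [d d0 hd] := @tube (fun=> c t) q 0 (smooth_cst (c t)) sq (cU t).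
have d20 : 0 < d / 2 by rewrite divr_gt0.
pose k s u := g (c t + cutoff d s *: q (cutoff d u)).
have sk : smooth2 k.
  move=> a b sa sb; apply: sg.
    apply: smoothD; first exact: smooth_cst.
    apply: smoothM; first by apply: smooth_comp => //; exact: smooth_cutoff.
    by apply: smooth_comp => //; apply: smooth_comp => //; exact: smooth_cutoff.
  by move=> s; have := hd _ _ (cutoff_lt (a s) d0) (cutoff_lt (b s) d0); rewrite add0r.
have := der_diag 0 cF sk.
have -> : cder 1 (k 0) 0 = 0.
  apply: curve_deriveE; apply: der_ext (der_cst (g (c t)) 0) => h.
  by rewrite /k cutoff0// scale0r addr0.
have -> : cder 1 (k^~ 0) 0 = ddir g (c t) (cder 1 c t).
  apply: curve_deriveE; apply: der_near d20 _ (der_line (cder 1 c t) sg (cU t)).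
  by move=> h /ltW hd2; rewrite /k !add0r cutoff_id// cutoff0// q0.
rewrite addr0; apply: der_near d20 _ => h /ltW hd2.
by rewrite /k add0r cutoff_id// -cq.
Qed.

(** Near each time the derivative is the partial derivative at [s = 0] of
    [G (c t + s *: w t)]; cutoffs in both variables keep the argument in
    [U]. *)
Lemma csmooth_ddir n (G : E -> epow E n -> F) : csmooth G ->
  @csmooth n.+1 (fun x (v : epow E n.+1) => ddir (fun y => G y (fun i => v (lift ord0 i))) x (v ord0)).
Proof.
move=> sG c w sc cU sw; apply: smooth_local => t.
pose w' := fun i : 'I_n => w (lift ord0 i).
have [d d0 hd] := tube sc (sw ord0) (cU t).
have d20 : 0 < d / 2 by rewrite divr_gt0.
pose T u := t + cutoff d u.
pose k s u := G (c (T u) + cutoff d s *: w ord0 (T u)) (fun i => w' i (T u)).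
have sk : smooth2 k.
  move=> a b sa sb.
  have sT : smooth_curve (fun u => T (b u) : R^o).
    apply: (@smoothD R R^o); first exact: (@smooth_cst R R^o).
    by apply: smooth_comp => //; exact: smooth_cutoff.
  apply: sG.
  - apply: smoothD; first exact: smooth_comp.
    apply: smoothM; first by apply: smooth_comp => //; exact: smooth_cutoff.
    exact: smooth_comp.
  - by move=> u; apply: hd; exact: cutoff_lt.
  - by move=> i; apply: smooth_comp => //; exact: sw.
exists (dleft k); split; first exact: smooth_dleft.
exists (d / 2) => // h /ltW hd2; apply/esym/curve_deriveE.
have sg : usmooth (fun y => G y (fun i => w' i (t + h))) by exact: csmooth_usmooth.
apply: der_near d20 _ (der_line (w ord0 (t + h)) sg (cU _)) => s /ltW sd.
by rewrite /k /T !add0r !cutoff_id.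
Qed.

(** The arguments are released one at a time, each step being an instance of
    [der_diag]. The derivative in a single argument is computed with the smooth
    difference quotient of [hadamard], as linear maps that are smooth along
    curves need not be continuous. *)
Lemma der_multilinear n (m : epow E n -> F) (w : 'I_n -> R -> E) t :
  multilinear_map m ->
  (forall w : 'I_n -> R -> E, (forall i, smooth_curve (w i)) ->
     smooth_curve (fun t => m (fun i => w i t))) ->
  (forall i, smooth_curve (w i)) ->
  der (fun t => m (fun i => w i t)) t
   (\sum_(i < n) m (@dfwith _ (fun=> E) (fun i => w i t) i (cder 1 (w i) t))).
Proof.
move=> lm sm sw.
pose mix l s : epow E n := fun i => if (i < l)%N then w i s else w i t.
have smix (a : 'I_n -> R -> E) : (forall i, smooth_curve (a i)) ->
    smooth_curve (fun t => m (fun i => a i t)) by exact: sm.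
suff H l : (l <= n)%N -> der (fun s => m (mix l s)) t
   (\sum_(i < n | (i < l)%N) m (@dfwith _ (fun=> E) (fun i => w i t) i (cder 1 (w i) t))).
  have := H n (leqnn n); rewrite (eq_bigl xpredT); last by move=> i; rewrite ltn_ord.
  have -> // : (fun s => m (mix n s)) = (fun s => m (fun i => w i s)).
  by apply/funext => s; congr m; apply/funext => i; rewrite /mix ltn_ord.
elim: l => [|l IH] ln.
  rewrite big_pred0//; apply: der_ext (der_cst (m (fun i => w i t)) t) => s.
  by congr m; apply/funext => i.
pose il := Ordinal ln.
pose k s u := m (fun i => if (i < l)%N then w i s else if i == il then w i u else w i t).
have sk : smooth2 k.
  move=> a b sa sb; apply: (smix (fun i u => if (i < l)%N then w i (a u)
    else if i == il then w i (b u) else w i t)) => i.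
  case: (i < l)%N; first exact: smooth_comp.
  by case: (i == il); [exact: smooth_comp|exact: smooth_cst].
have := der_diag t cF sk.
have -> : cder 1 (k^~ t) t =
  \sum_(i < n | (i < l)%N) m (@dfwith _ (fun=> E) (fun i => w i t) i (cder 1 (w i) t)).
  apply: curve_deriveE; apply: der_ext (IH (ltnW ln)) => s.
  congr m; apply/funext => i; rewrite /mix; case: ifP => // _; by case: ifP.
pose L v := m (@dfwith _ (fun=> E) (fun i => w i t) il v).
have kL u : k t u = L (w il u).
  congr m; apply/funext => i; have [->|ne] := eqVneq i il.
    by rewrite dfwithin ltnn.
  by rewrite dfwithout 1?eq_sym//; case: ifP.
have LP a x y : L (a *: x + y) = a *: L x + L y by exact: lm.
have -> : cder 1 (k t) t = L (cder 1 (w il) t).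
  have [q sq [wq q0]] := hadamard t (sw il).
  have sL : smooth_curve (fun u => L (q u)).
    apply: smooth_ext (smix (fun i u => if i == il then q u else w i t) _).
      move=> u; congr m; apply/funext => i; have [->|ne] := eqVneq i il.
        by rewrite dfwithin.
      by rewrite dfwithout 1?eq_sym.
    by move=> i; case: (i == il) => //; exact: smooth_cst.
  apply: curve_deriveE => p cp e e0.
  have [d d0 hd] := smooth_continuous 0 sL cp e0.
  exists d => // h /hd; rewrite add0r q0 !kL => /ltW H.
  have -> : L (w il (t + h)) - L (w il t) - h *: L (cder 1 (w il) t) =
    h *: (L (q h) - L (cder 1 (w il) t)).
    have LwE : L (w il (t + h)) = h *: L (q h) + L (w il t) by rewrite wq addrC LP.
    by rewrite LwE; lmod R F.
  by rewrite csemiZ// mulrC ler_wpM2r.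
rewrite [X in der _ _ (_ + X)](_ : _ =
  m (@dfwith _ (fun=> E) (fun i => w i t) il (cder 1 (w il) t)))//.
rewrite [X in _ -> der _ _ X](bigD1 il)//= addrC.
have -> : \sum_(i < n | (i < l.+1)%N && (i != il))
   m (@dfwith _ (fun=> E) (fun i => w i t) i (cder 1 (w i) t)) =
  \sum_(i < n | (i < l)%N) m (@dfwith _ (fun=> E) (fun i => w i t) i (cder 1 (w i) t)).
  by apply: eq_bigl => i; rewrite -val_eqE /= ltnS; lia.
move=> dk; apply: der_ext dk => s; congr m; apply/funext => i; rewrite /mix -val_eqE /=.
by rewrite ltnS; case: ltngtP.
Qed.

Lemma product_rule n (G : E -> epow E n -> F) c (w : 'I_n -> R -> E) t :
  csmooth G -> (forall x, U x -> multilinear_map (G x)) ->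
  smooth_curve c -> (forall t, U (c t)) -> (forall i, smooth_curve (w i)) ->
  der (fun t => G (c t) (fun i => w i t)) t
   (ddir (fun x => G x (fun i => w i t)) (c t) (cder 1 c t) +
    \sum_(i < n) G (c t) (@dfwith _ (fun=> E) (fun i => w i t) i (cder 1 (w i) t))).
Proof.
move=> sG lG sc cU sw; pose k s u := G (c s) (fun i => w i u).
have sk : smooth2 k.
  by move=> a b sa sb; apply: (sG (fun u => c (a u)) (fun i u => w i (b u)));
    [exact: smooth_comp|move=> u; exact: cU|move=> i; exact: smooth_comp].
have := der_diag t cF sk.
have -> : cder 1 (k^~ t) t = ddir (fun x => G x (fun i => w i t)) (c t) (cder 1 c t).
  by apply/curve_deriveE/chain_rule => //; exact: csmooth_usmooth.
suff -> : cder 1 (k t) t =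
  \sum_(i < n) G (c t) (@dfwith _ (fun=> E) (fun i => w i t) i (cder 1 (w i) t)) by [].
apply/curve_deriveE/der_multilinear => //; first exact: lG.
move=> a sa; apply: (sG (fun=> c t)) => //; exact: smooth_cst.
Qed.

End directional_derivatives.

Section multilinear.
Context {R : realType} {E F : lcsType R}.

Lemma multilinear_scale n (m : epow E n -> F) (a : R) (v : epow E n) :
  multilinear_map m -> m (fun i => a *: v i) = a ^+ n *: m v.
Proof.
move=> lm; suff H l : (l <= n)%N ->
    m (fun i => if (i < l)%N then a *: v i else v i) = a ^+ l *: m v.
  by rewrite -H//; congr m; apply/funext => i; rewrite ltn_ord.
elim: l => [|l IH] ln; first by rewrite expr0 scale1r.
pose il := Ordinal ln.
pose w : epow E n := fun i => if (i < l)%N then a *: v i else v i.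
have L0 : m (@dfwith _ (fun=> E) w il 0) = 0.
  by have := lm il w (-1) 0 0; rewrite scaler0 addr0 scaleN1r addNr.
have := lm il w a (v il) 0; rewrite L0 !addr0 => H.
rewrite exprS -scalerA -IH ?(ltnW ln)// -/w.
have -> : w = @dfwith _ (fun=> E) w il (v il).
  apply/funext => i; have [->|ne] := eqVneq i il; last by rewrite dfwithout// eq_sym.
  by rewrite dfwithin /w ltnn.
rewrite -H; congr m; apply/funext => i; have [->|ne] := eqVneq i il.
  by rewrite dfwithin leqnn.
rewrite dfwithout 1?eq_sym// /w; move: ne; rewrite -val_eqE /= ltnS.
by case: ltngtP.
Qed.

(** The boxes form a base of neighbourhoods of 0 in the product topology. *)
Lemma epow_bounded n (B : set (epow E n)) : tvs_bounded B <->
  forall i p, csemi p -> exists M, forall v, B v -> p (v i) <= M.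
Proof.
split=> [bB i p cp|hB W W0].
  have W0 : nbhs (0 : epow E n) [set v | p (v i) < 1].
    have pc := @proj_continuous 'I_n (fun _ => E) i (0 : epow E n).
    apply: (pc [set x | p x < 1]); exact: csemi_nbhs0.
  have [r r0 /(_ (r + 1))] := bB _ W0.
  rewrite gtr0_norm ?addr_gt0// ltrDl => /(_ ltr01) h.
  exists (r + 1) => v /h[y /= py <-].
  rewrite [X in p X](_ : _ = (r + 1) *: y i)// csemiZ// gtr0_norm ?addr_gt0//.
  by rewrite -[leRHS]mulr1 ler_pM2l ?addr_gt0// ltW.
have {}hB i : tvs_bounded [set v i | v in B].
  apply/tvs_bounded_csemi => p cp; have [M hM] := hB i p cp.
  by exists M => _ [v Bv <-]; exact: hM.
(* [W] contains a box, because the filter of the boxes converges to 0 *)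
have [A A0 AW] : exists2 A : 'I_n -> set E, (forall i, nbhs 0 (A i)) &
    forall v : epow E n, (forall i, A i (v i)) -> W v.
  pose Phi := filter_from [set A : 'I_n -> set E | forall i, nbhs 0 (A i)]
    (fun A => [set v : epow E n | forall i, A i (v i)]).
  have FPhi : Filter Phi.
    apply: filter_from_filter; first by exists (fun=> setT) => i; exact: filterT.
    move=> A A' A0 A'0; exists (fun i => A i `&` A' i).
      by move=> i; exact: filterI.
    by move=> v AAv; split=> i; have [] := AAv i.
  suff : Phi --> (0 : epow E n) by move=> /(_ W W0) [A A0 AW]; exists A.
  apply/cvg_sup => i A [_ [[C oC <-] C0] CA].
  exists (fun j => if j == i then C else setT).
    move=> j; case: ifP => _; last exact: filterT.
    by apply: open_nbhs_nbhs; split.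
  by move=> v /(_ i); rewrite eqxx => Cv; exact: CA.
have /choice[r hr] : forall i, exists r, 0 < r /\ forall s : R, r < `|s| ->
    [set v i | v in B] `<=` *:%R s @` A i.
  by move=> i; have [r r0 hr] := hB i _ (A0 i); exists r.
exists (1 + \sum_i r i).
  by rewrite ltr_wpDr// sumr_ge0// => i _; exact/ltW/(hr i).1.
move=> s sr v Bv; have s0 : s != 0.
  rewrite -normr_gt0; apply: lt_trans sr.
  by rewrite ltr_wpDr// sumr_ge0// => i _; exact/ltW/(hr i).1.
exists (s^-1 *: v); last by rewrite scalerA divff// scale1r.
apply: AW => i; have ris : r i < `|s|.
  apply: le_lt_trans sr; rewrite (bigD1 i)//= addrCA lerDl.
  by rewrite addr_ge0// sumr_ge0// => j _; exact/ltW/(hr j).1.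
have [u Au vu] : ( *:%R s @` A i) (v i) by apply: (hr i).2 => //; exists v.
by rewrite [X in A i X](_ : _ = s^-1 *: v i)// -vu scalerA mulVf// scale1r.
Qed.

End multilinear.

(** * Bounds for differentials on bounded sets *)

Section bounds.
Context {R : realType} {E F : lcsType R} (U : set E) (n : nat).
Variable G : E -> epow E n -> F.
Hypotheses (sG : csmooth U G) (lG : forall x, U x -> multilinear_map (G x)).
Variable c : R -> E.
Hypotheses (sc : smooth_curve c) (cU : forall t, U (c t)).
Variable B : set (epow E n).
Hypothesis bB : tvs_bounded B.

Lemma smooth_along v : smooth_curve (fun t => G (c t) v).
Proof. by apply: sG => // i; exact: smooth_cst. Qed.

(** If the bound failed, a smooth curve [w] in [E^n] passing rapidly through
    multiples of bad vectors, together with a reparametrization of [c] passing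
    at positive speed through the bad times, would contradict smoothness. *)
Lemma locally_bounded_on j p t0 : csemi p ->
  exists2 d, 0 < d & exists M, forall h v, `|h| < d -> B v ->
    p (cder j (fun t => G (c t) v) (t0 + h)) <= M.
Proof.
move=> cp.
have [||k [M hM]] := @bounded_by_sequences R (epow E n * R)%type
  (fun k => [set x | B x.1 /\ `|x.2 - t0| <= eps k])
  (fun x => p (cder j (fun t => G (c t) x.1) x.2))
  (fun k => speed k ^+ j * eps k ^+ n).
- by move=> k; rewrite mulr_gt0 ?exprn_gt0 ?speed_gt0 ?eps_gt0.
- move=> x hx.
  have /choice[w hw] : forall i : 'I_n, exists w : R -> E, smooth_curve w /\
      forall k t, `|t - node k| <= radius k / 2 -> w t = eps k *: (x k).1 i.
    move=> i; have [|w sw hw] := @plateau_curve R E (fun k => (x k).1 i); last by exists w.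
    move=> q cq; have [M hM] := (epow_bounded _).1 bB i q cq.
    by exists M => k; apply: hM; exact: (hx k).1.
  have [T sT hT] := @traverse R t0 (fun k => (x k).2) (fun k => (hx k).2).
  have sg k : smooth_curve (fun t => eps k ^+ n *: G (c t) (x k).1).
    exact/smoothZ/smooth_along.
  have sGT : smooth_curve (fun u => G (c (T u)) (fun i => w i u)).
    apply: (sG (c := fun u => c (T u))) => //; last by move=> i; exact: (hw i).1.
    exact: smooth_comp.
  have [|M [N hMN]] := traverse_cder j sGT sg cp (t := fun k => (x k).2).
    move=> k u uk; rewrite (hT k)// -multilinear_scale; last exact: lG.
    by congr (G _); apply/funext => i; rewrite ((hw i).2 k).
  exists M, N => k /hMN; rewrite cderZ; last exact: smooth_along.
  by rewrite csemiZ// gtr0_norm ?exprn_gt0 ?eps_gt0// mulrA.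
exists (eps k); first exact: eps_gt0.
exists M => h v hk Bv; apply: (hM (v, t0 + h)); split=> //=.
by rewrite addrC addKr ltW.
Qed.

(** Hence the difference quotients converge uniformly on [B]. *)
Lemma uniform_der j p t e : csemi p -> 0 < e ->
  exists2 d, 0 < d & forall h v, `|h| < d -> B v ->
    p (cder j (fun t => G (c t) v) (t + h) - cder j (fun t => G (c t) v) t
       - h *: cder j.+1 (fun t => G (c t) v) t) <= e * `|h|.
Proof.
move=> cp e0; have [d d0 [M hM]] := locally_bounded_on j.+2 t cp.
have K0 : 0 < `|M| + 1 by rewrite ltr_wpDl.
exists (Num.min d (e / (`|M| + 1))); first by rewrite lt_min d0 divr_gt0.
move=> h v; rewrite lt_min => /andP[hd he] Bv; have sv := smooth_along v.
apply: (@le_trans _ _ ((`|M| + 1) * `|h| ^+ 2)).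
  apply: (@taylor2 R F _ _ (cder j.+2 (fun t => G (c t) v))) => //.
  - by move=> s; exact: (@smooth_der _ _ _ j s sv).
  - by move=> s; exact: (@smooth_der _ _ _ j.+1 s sv).
  - move=> s sh; rewrite (le_trans (hM _ _ (le_lt_trans sh hd) Bv))//.
    by rewrite (le_trans (ler_norm M))// lerDl.
rewrite expr2 mulrA ler_wpM2r// mulrC -ler_pdivlMr//; exact: ltW.
Qed.

End bounds.

(** * Differentials of smooth maps *)

Section differentials.
Context {R : realType} {E F : lcsType R} (U : set E).

Definition fcons n (a : E) (v : epow E n) : epow E n.+1 :=
  fun i => oapp v a (unlift ord0 i).

Definition ftail n (v : epow E n.+1) : epow E n := fun i => v (lift ord0 i).

Lemma fcons0 n a (v : epow E n) : fcons a v ord0 = a.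
Proof. by rewrite /fcons unlift_none. Qed.

Lemma ftail_fcons n a (v : epow E n) : ftail (fcons a v) = v.
Proof. by apply/funext => i; rewrite /ftail /fcons liftK. Qed.

Lemma fcons_ftail n (v : epow E n.+1) : fcons (v ord0) (ftail v) = v.
Proof.
apply/funext => i; rewrite /fcons.
by case: unliftP => [j ->|->].
Qed.

Lemma valL0E (g : U -> F) (x : U) : 'valL_0 g (\val x) = g x.
Proof. by have /(congr1 (fun h => h x)) := valLK 0 g. Qed.

Lemma valL0_out (g : U -> F) x : ~ U x -> 'valL_0 g x = 0.
Proof.
by move=> nUx; rewrite /valL_ oinv_set_val /= insubN// notin_setE.
Qed.

(** The extension by 0 keeps multilinearity valid at every point of [E]. *)
Definition dext n (f : U -> F) (x : E) (v : epow E n) : F :=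
  'valL_0 (fun y : U => differential f y v) x.

Lemma dextE n (f : U -> F) (x : U) (v : epow E n) :
  dext f (\val x) v = differential f x v.
Proof. exact: valL0E. Qed.

Lemma dextS n (f : U -> F) x (v : epow E n.+1) : U x ->
  dext f x v = ddir (fun y => dext f y (ftail v)) x (v ord0).
Proof.
move=> Ux; pose x' : U := SigSub (mem_set Ux).
rewrite -[x in LHS]/(\val x') dextE /= /dir_derive /ddir; congr flim.
by rewrite -(valL0E (fun y : U => differential f y (ftail v))).
Qed.


Hypotheses (openU : open U) (cF : uniform_complete F).
Variable f : U -> F.
Hypothesis sf : smooth f.

Lemma csmooth_dext n : csmooth U (@dext n f).
Proof.
elim: n => [|n IH] c w sc cU sw; last first.
  have := csmooth_ddir openU cF IH sc cU sw; apply: smooth_ext => t.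
  by rewrite dextS.
pose c' t : U := SigSub (mem_set (cU t)).
have := sf (c := c') sc; apply: smooth_ext => t.
by rewrite -[c t]/(\val (c' t)) dextE.
Qed.

Lemma usmooth_dext n (v : epow E n) : usmooth U (fun x => dext f x v).
Proof. exact: csmooth_usmooth (@csmooth_dext n). Qed.

Lemma multilinear_dext n x : multilinear_map (dext f x : epow E n -> F).
Proof.
have [Ux|nUx] := pselect (U x); last first.
  by move=> i v a y z; rewrite /dext !valL0_out// scaler0 addr0.
elim: n x Ux => [x _ []//|n IH x Ux i v a y z].
have d0E (u : E) : dext f x (@dfwith _ (fun=> E) v ord0 u) =
    ddir (fun y => dext f y (ftail v)) x u.
  rewrite dextS// dfwithin; congr ddir; apply/funext => y'; congr dext.
  by apply/funext => k; rewrite /ftail dfwithout// neq_lift.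
have dE j (u : E) : dext f x (@dfwith _ (fun=> E) v (lift ord0 j) u) =
    ddir (fun y => dext f y (@dfwith _ (fun=> E) (ftail v) j u)) x (v ord0).
  have j0 : lift ord0 j != ord0 by rewrite eq_sym neq_lift.
  rewrite dextS// dfwithout//; congr ddir; apply/funext => y'; congr dext.
  apply/funext => k; rewrite /ftail; have [->|jk] := eqVneq k j.
    by rewrite !dfwithin.
  have kj : j != k by rewrite eq_sym.
  by rewrite (dfwithout _ _ kj) dfwithout.
case: (unliftP ord0 i) => [j ->|->].
  rewrite !dE; apply: ddirE.
  have := derD (derZ a (der_line openU (v ord0) (usmooth_dext (@dfwith _ (fun=> E) (ftail v) j y)) Ux))
    (der_line openU (v ord0) (usmooth_dext (@dfwith _ (fun=> E) (ftail v) j z)) Ux).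
  apply: der_ext => h; have [Uh|nUh] := pselect (U (x + h *: v ord0)).
    by rewrite (IH _ Uh).
  by rewrite /dext !valL0_out// scaler0 addr0.
have sg := usmooth_dext (ftail v).
by rewrite !d0E (ddirD openU cF _ _ sg Ux) (ddirZ openU _ _ sg Ux).
Qed.

Definition dcurve n (c : R -> E) (w : 'I_n -> R -> E) (t : R) : F :=
  dext f (c t) (fun i => w i t).

(** The argument [v ord0] of [d^(n+1) f] is the last direction of
    differentiation, so the derivative of [c] is put in front. *)
Lemma der_dcurve n c (w : 'I_n -> R -> E) t : smooth_curve c ->
  (forall t, U (c t)) -> (forall i, smooth_curve (w i)) ->
  der (dcurve c w) t
   (dext f (c t) (fcons (cder 1 c t) (fun i => w i t)) +
    \sum_(i < n) dext f (c t) (@dfwith _ (fun=> E) (fun i => w i t) i (cder 1 (w i) t))).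
Proof.
move=> sc cU sw; rewrite dextS// ftail_fcons fcons0.
apply: (product_rule openU cF t (@csmooth_dext n)) => // x _.
exact: multilinear_dext.
Qed.

(** The case of a constant curve in [locally_bounded_on]. *)
Lemma bounded_dext n x : U x -> bounded_map (dext f x : epow E n -> F).
Proof.
move=> Ux B bB; apply/tvs_bounded_csemi => p cp.
have [d d0 [M hM]] := locally_bounded_on (@csmooth_dext n)
  (fun x _ => multilinear_dext x) (smooth_cst x) (fun=> Ux) bB 0 0 cp.
exists M => _ [v Bv <-]; have := hM 0 v; rewrite normr0; exact.
Qed.

End differentials.

(** * The topology of uniform convergence of all differentials *)

Section Cinfty_topology.

Lemma sup_entourage (T : choiceType) (I : Type) (Tc : I -> Uniform T) (i : I)
    (A : set (T * T)) :
  @entourage (Uniform.Pack (Tc i)) A -> @entourage (sup_topology Tc) A.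
Proof.
move=> eA.
have kA : `[< @entourage (Uniform.Pack (Tc ((i : {classic I}), A).1)) ((i : {classic I}), A).2 >].
  exact/asboolP.
pose a : {p : {classic I} * set (T * T) |
  `[< @entourage (Uniform.Pack (Tc p.1)) p.2 >]} := exist _ ((i : {classic I}), A) kA.
rewrite /entourage /=; exists A => //.
exact: (finI_from1 _ (i := a)).
Qed.

Context {R : realType} {E F : lcsType R} (U : set E).

Definition diff_near (n : nat) (K : set E) (B : set (epow E n)) (W : set F)
    (f g : Cinfty U F) := forall (x : U) v, K (\val x) -> B v ->
  W (differential (\val g) x v - differential (\val f) x v).

Lemma entourage_Cinfty n (K : set E) (B : set (epow E n)) (W : set F) :
  compact K -> K `<=` U -> tvs_bounded B -> nbhs 0 W ->
  entourage [set fg : Cinfty U F * Cinfty U F | diff_near K B W fg.1 fg.2].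
Proof.
move=> cK KU bB W0; rewrite /entourage /=.
apply: (@sup_entourage _ _ (fun n : nat =>
     Uniform.class (initial_topology (@uncurried_differential R E U F n))) n).
pose S := ((\val : U -> E) @^-1` K) `*` B.
have cS : @Defs.compact_bounded R E U n S by exists K, B.
exists [set fg : ((U * epow E n)%type -> F) * ((U * epow E n)%type -> F) |
    forall xv, S xv -> W (fg.2 xv - fg.1 xv)]; last first.
  by move=> [f g] /= H x v Kx Bv; exact: (H (x, v)).
apply: (@sup_entourage _ _ (fun k : sigT (@Defs.compact_bounded R E U n) =>
       Uniform.class {uniform` projT1 k -> F}) (existT _ S cS)).
rewrite uniform_entourage; exists [set xy : F * F | W (xy.2 - xy.1)] => //.
exact: entourage_nbhs0.
Qed.

Lemma nbhs_Cinfty n (K : set E) (B : set (epow E n)) (W : set F) (f : Cinfty U F) :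
  compact K -> K `<=` U -> tvs_bounded B -> nbhs 0 W ->
  nbhs f [set g | diff_near K B W f g].
Proof.
move=> cK KU bB W0; rewrite -nbhs_entourageE.
exists [set fg : Cinfty U F * Cinfty U F | diff_near K B W fg.1 fg.2].
  exact: entourage_Cinfty.
by move=> g /xsectionP.
Qed.

Lemma cvg_Cinfty (Phi : set_system (Cinfty U F)) (f : Cinfty U F) : Filter Phi ->
  (forall n (K : set E) (B : set (epow E n)) (W : set F),
    compact K -> K `<=` U -> tvs_bounded B -> nbhs 0 W ->
    \forall g \near Phi, diff_near K B W f g) ->
  Phi --> f.
Proof.
move=> FPhi H; apply/cvg_sup => n A [_ [[Q oQ <-] fQ] QA].
suff : @uncurried_differential R E U F n @ Phi --> @uncurried_differential R E U F n f.
  have nQ : nbhs (@uncurried_differential R E U F n f) Q by apply: open_nbhs_nbhs.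
  by move=> /(_ Q nQ) PQ; apply: (filterS QA); exact: PQ.
apply/fam_cvgP => _ [K [B [cK KU bB ->]]] P /uniform_nbhs[Z [eZ ZP]].
have [W W0 WZ] := nbhs0_entourage eZ.
have := H n K B W cK KU bB W0; rewrite near_simpl => HW.
apply: (@filterS _ Phi _ _ _ _ HW) => g fg.
by apply: ZP => -[x v] [Kx Bv]; apply: WZ; exact: fg.
Qed.

End Cinfty_topology.

(** * Completeness *)

Section curve_sets.
Context {R : realType} {E : lcsType R}.

Definition unit_itv : set R := [set h | `|h| <= 1].

Lemma smooth_is_continuous (c : R -> E) : smooth_curve c -> continuous c.
Proof.
move=> sc t A /nbhs_csemi[p [cp [e e0 pA]]].
have [d d0 hd] := smooth_continuous t sc cp e0.
exists d => // s /= ts; apply: pA.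
have -> : s = t + (s - t) by rewrite addrC subrK.
by apply: hd; rewrite distrC.
Qed.

Lemma compact_curve (c : R -> E) a : smooth_curve c ->
  compact [set c (a + h) | h in unit_itv].
Proof.
move=> sc; have -> : [set c (a + h) | h in unit_itv] =
    c @` `[a - 1, a + 1]%classic.
  apply/seteqP; split=> [_ [h /= h1 <-]|_ [t /= t1 <-]].
    by exists (a + h) => //=; rewrite in_itv /= -ler_distl addrC addKr.
  exists (t - a); last by rewrite addrC subrK.
  by move: t1; rewrite in_itv /= -ler_distl.
apply: continuous_compact; last exact: segment_compact.
by apply: continuous_subspaceT; exact: smooth_is_continuous.
Qed.

Lemma bounded_curves n (u : 'I_n -> R -> E) a : (forall i, smooth_curve (u i)) ->
  tvs_bounded ((fun h => (fun i => u i (a + h)) : epow E n) @` unit_itv).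
Proof.
move=> su; apply/epow_bounded => i p cp.
have [K hK] := smooth_bounded_itv a 1 (su i) cp.
by exists K => _ [h /= h1 <-]; exact: hK.
Qed.

End curve_sets.

Section completeness.
Context {R : realType} {E F : lcsType R} (U : set E).
Hypotheses (openU : open U) (cF : uniform_complete F).
Variable Phi : set_system (Cinfty U F).
Hypotheses (FPhi : ProperFilter Phi) (cPhi : cauchy Phi).

Lemma Cinfty_smooth (f : Cinfty U F) : smooth (\val f).
Proof. exact: (set_mem (valP f)). Qed.

Let D n (f : Cinfty U F) : E -> epow E n -> F := dext (\val f).

Lemma cauchy_uniform n (K : set E) (B : set (epow E n)) p e : compact K -> K `<=` U ->
  tvs_bounded B -> csemi p -> 0 < e ->
  exists2 A, Phi A & forall f g, A f -> A g -> forall x v, K x -> B v ->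
    p (D f x v - D g x v) < e.
Proof.
move=> cK KU bB cp e0.
have [[A A']/= [PA PA'] H] := cPhi (entourage_Cinfty cK KU bB (csemi_nbhs0 cp e0)).
exists (A `&` A'); first exact: filterI.
move=> f g [_ Af] [Ag _] x v Kx Bv.
have Ux := KU x Kx; pose x' : U := SigSub (mem_set Ux).
have /(_ x' v Kx Bv) := H (g, f) (conj Ag Af).
by rewrite /= -!dextE.
Qed.

Lemma pointwise_limit n : exists g : E -> epow E n -> F, forall x v p, csemi p ->
  forall e, 0 < e -> \forall f \near Phi, p (D f x v - g x v) < e.
Proof.
suff /choice[g hg] : forall xv : E * epow E n, exists l, forall p, csemi p ->
    forall e, 0 < e -> \forall f \near Phi, p (D f xv.1 xv.2 - l) < e.
  by exists (fun x v => g (x, v)) => x v; exact: (hg (x, v)).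
move=> [x v] /=; have [Ux|nUx] := pselect (U x); last first.
  exists 0 => p cp e e0; near=> f.
  by rewrite /D /dext valL0_out// subrr csemi0.
apply: csemi_complete => // p cp e e0.
have xU : [set x] `<=` U by move=> _ ->.
have [A PA hA] := cauchy_uniform (@compact_set1 _ x) xU (@tvs_bounded1_epow _ _ n v) cp e0.
by exists A => // f g Af Ag; exact: hA.
Unshelve. all: by end_near. Qed.

Let G n := projT1 (cid (pointwise_limit n)).

Let hG n x (v : epow E n) p : csemi p -> forall e, 0 < e ->
  \forall f \near Phi, p (D f x v - G x v) < e.
Proof. exact: (projT2 (cid (pointwise_limit n))). Qed.

Lemma uniform_limit n (K : set E) (B : set (epow E n)) p e : compact K -> K `<=` U ->
  tvs_bounded B -> csemi p -> 0 < e ->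
  \forall f \near Phi, forall x v, K x -> B v -> p (D f x v - G x v) < e.
Proof.
move=> cK KU bB cp e0; have e20 : 0 < e / 2 by rewrite divr_gt0.
have [A PA hA] := cauchy_uniform cK KU bB cp e20.
apply: (@filterS _ Phi _ A _ _ PA) => f Af x v Kx Bv.
have [g [Ag gG]] := @filter_ex _ _ _ _ (filterI PA (hG x v cp e20)).
rewrite (le_lt_trans (csemi_triangle cp (D g x v) _ _))//.
by rewrite [ltRHS]splitr ltrD// hA.
Qed.

(** The Leibniz rule passes to the limit, since all the terms converge uniformly
    on compact pieces of the curves. *)
Lemma der_limit_curve n (c : R -> E) (w : 'I_n -> R -> E) t : smooth_curve c ->
  (forall t, U (c t)) -> (forall i, smooth_curve (w i)) ->
  der (fun t => G (c t) (fun i => w i t)) t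
   (G (c t) (fcons (cder 1 c t) (fun i => w i t)) +
    \sum_(i < n) G (c t) (@dfwith _ (fun=> E) (fun i => w i t) i (cder 1 (w i) t))).
Proof.
move=> sc cU sw.
pose a t : epow E n.+1 := fcons (cder 1 c t) (fun i => w i t).
pose b i t : epow E n := @dfwith _ (fun=> E) (fun i => w i t) i (cder 1 (w i) t).
apply: (@der_limit R F (Cinfty U F) Phi _ (fun f => dcurve (\val f) c w)
  (fun f t => D f (c t) (a t) + \sum_(i < n) D f (c t) (b i t))
  (fun t => G (c t) (fun i => w i t))
  (fun t => G (c t) (a t) + \sum_(i < n) G (c t) (b i t))).
- move=> f s; exact: (der_dcurve openU cF (Cinfty_smooth f) s sc cU sw).
- by move=> s p cp e e0; exact: hG.
move=> p cp e e0; pose e' := e / n.+1%:R.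
have e'0 : 0 < e' by rewrite divr_gt0.
exists 1 => //.
pose K := [set c (t + h) | h in unit_itv].
have cK : compact K by exact: compact_curve.
have KU : K `<=` U by move=> _ [h _ <-].
have sa i : smooth_curve (fun t => a t i).
  rewrite /a /fcons; case: (unlift ord0 i) => [j|] /=; first exact: sw.
  exact: (smooth_cder 1 sc).
have sb i j : smooth_curve (fun t => b i t j).
  have [->|ij] := eqVneq j i.
    apply: smooth_ext (smooth_cder 1 (sw i)) => s.
    by rewrite /b dfwithin.
  apply: smooth_ext (sw j) => s.
  by rewrite /b dfwithout// eq_sym.
have Ha := uniform_limit cK KU (bounded_curves t sa) cp e'0.
have Hb : \forall f \near Phi, forall i : 'I_n, forall x v, K x ->
    ((fun h => (fun j => b i (t + h) j) : epow E n) @` unit_itv) v ->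
    p (D f x v - G x v) < e'.
  by apply: filter_forall => i; exact: uniform_limit cK KU (bounded_curves t (sb i)) cp e'0.
apply: filterS2 Ha Hb => f fa fb h /ltW h1.
have Kh : K (c (t + h)) by exists h.
have -> : e = e' + \sum_(i < n) e'.
  rewrite sumr_const card_ord -[e' in e' + _]mulr1n -mulrnDr add1n -mulr_natr.
  by rewrite /e' divfK ?pnatr_eq0.
rewrite [X in p X](_ : _ = (D f (c (t + h)) (a (t + h)) - G (c (t + h)) (a (t + h))) +
  \sum_(i < n) (D f (c (t + h)) (b i (t + h)) - G (c (t + h)) (b i (t + h)))); last first.
  by rewrite sumrB opprD addrACA.
rewrite (le_trans (csemiD cp _ _))// lerD//.
  by apply/ltW/fa => //; exists h.
rewrite (le_trans (csemi_sum cp _ _ _))//; apply: ler_sum => i _.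
by apply/ltW/(fb i) => //; exists h.
Qed.

(** The derivative of such a curve is a sum of curves of the same kind. *)
Lemma smooth_limit_curve n (c : R -> E) (w : 'I_n -> R -> E) : smooth_curve c ->
  (forall t, U (c t)) -> (forall i, smooth_curve (w i)) ->
  smooth_curve (fun t => G (c t) (fun i => w i t)).
Proof.
move=> sc cU sw; apply/smoothP => m; elim: m n w sw => // m IH n w sw.
exists (fun t => G (c t) (fcons (cder 1 c t) (fun i => w i t)) +
    \sum_(i < n) G (c t) (@dfwith _ (fun=> E) (fun i => w i t) i (cder 1 (w i) t))).
split; first by move=> t; exact: der_limit_curve.
apply: CkD; last (apply: Ck_sum => i).
  pose a (i : 'I_n.+1) t := oapp (fun i => w i t) (cder 1 c t) (unlift ord0 i).
  apply: (IH n.+1 a) => i; rewrite /a; case: (unlift ord0 i) => [j|] /=; first exact: sw.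
  exact: (smooth_cder 1 sc).
pose b (j : 'I_n) t := @dfwith _ (fun=> E) (fun i => w i t) i (cder 1 (w i) t) j.
apply: (IH n b) => j; have [->|ij] := eqVneq j i.
  apply: smooth_ext (smooth_cder 1 (sw i)) => s.
  by rewrite /b dfwithin.
apply: smooth_ext (sw j) => s.
by rewrite /b dfwithout// eq_sym.
Qed.

Let f0 (x : U) : F := G (\val x) ((fun _ => 0) : epow E 0).

Let smooth_f0 : smooth f0.
Proof.
move=> c sc; have := @smooth_limit_curve 0 (fun t => \val (c t)) (fun=> fun=> 0) sc.
apply=> [t|[]//]; exact: (set_mem (valP (c t))).
Qed.

(** The Leibniz rule along the line through [x] with constant arguments says that
    [G] of order [n.+1] is the directional derivative of [G] of order [n]. *)
Let dext_f0 n x (v : epow E n) : U x -> dext f0 x v = G x v.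
Proof.
elim: n x v => [|n IH] x v Ux.
  rewrite -[x in LHS]/(\val (SigSub (mem_set Ux) : U)) dextE /= /f0 /=.
  by congr G; apply/funext => -[].
rewrite dextS//; apply: ddirE.
have [d d0 hd] := tube openU (t := 0) (smooth_cst x) (smooth_cst (v ord0)) Ux.
have d20 : 0 < d / 2 by rewrite divr_gt0.
pose c h := x + cutoff d h *: v ord0.
have sc : smooth_curve c.
  apply: smoothD; first exact: smooth_cst.
  by apply: smoothM; [exact: smooth_cutoff|exact: smooth_cst].
have cU h : U (c h) by apply: (hd _ 0); [exact: cutoff_lt|rewrite normr0].
have := @der_limit_curve n c (fun i => fun=> ftail v i) 0 sc cU
  (fun i => smooth_cst (ftail v i)).
have c0 : c 0 = x by rewrite /c cutoff0// scale0r addr0.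
have c'0 : cder 1 c 0 = v ord0.
  apply: curve_deriveE.
  have := derD (der_cst x 0) (derM (der_id 0) (der_cst (v ord0) 0)).
  rewrite scaler0 !add0r scale1r; apply: der_near d20 _ => h /ltW hd2.
  by rewrite /c !add0r cutoff_id.
rewrite c0 c'0 fcons_ftail big1 ?addr0; last first.
  (* the arguments are constant, and limits of multilinear maps vanish when one
     argument is 0 *)
  move=> i _; apply: csemi_eq0 => p cp; apply/eqP; rewrite eq_le csemi_ge0// andbT.
  have -> : cder 1 (fun=> ftail v i) 0 = 0 by apply/curve_deriveE/der_cst.
  apply/ler_addgt0Pr => e e0; rewrite add0r.
  have [f /ltW] := @filter_ex _ _ _ _
    (hG x (@dfwith _ (fun=> E) (ftail v) i 0) cp e0).
  rewrite /D [dext _ _ _](_ : _ = 0) ?sub0r ?csemiN//.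
  have := @multilinear_dext R E F U openU cF _ (Cinfty_smooth f) n x i (ftail v) (-1) 0 0.
  by rewrite scaler0 addr0 scaleN1r addNr.
apply: der_near d20 _ => h /ltW hd2; rewrite !add0r.
have ch : c h = x + h *: v ord0 by rewrite /c cutoff_id.
by rewrite -ch IH.
Qed.

Lemma Cinfty_limit : exists f : Cinfty U F, Phi --> f.
Proof.
exists (SigSub (mem_set (smooth_f0 : [set f : U -> F | smooth f] f0))).
apply: cvg_Cinfty => n K B W cK KU bB /exists_csemi[p cp pW].
have := uniform_limit cK KU bB cp ltr01; apply: filterS => f fG x v Kx Bv.
apply: pW; rewrite /= -!dextE dext_f0; last exact: KU.
exact: fG.
Qed.

End completeness.

Lemma complete_Cinfty (R : realType) (E F : lcsType R) (U : set E) :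
  open U -> uniform_complete F -> uniform_complete (Cinfty U F).
Proof. by move=> oU cF Phi FPhi cPhi; exact: Cinfty_limit. Qed.

(** * The differential as a smooth map into multilinear maps *)

Section bmlin_curves.
Context {R : realType} {E F : lcsType R} (n : nat).

Lemma der_bmlin (A : R -> bmlin E F n) t (L : bmlin E F n) :
  (forall (B : set (epow E n)) p e, tvs_bounded B -> csemi p -> 0 < e ->
    exists2 d, 0 < d & forall h v, `|h| < d -> B v ->
      p (A (t + h) v - A t v - h *: L v) <= e * `|h|) ->
  der A t L.
Proof.
move=> H; apply/derP => P /bmlin_nbhsP[B [W [bB /exists_csemi[p cp pW] BWP]]].
have [|d d0 hd] := H B p 2^-1 bB cp; first lra.
exists d => // h /=; rewrite sub0r normrN => hh h0; apply: BWP => v Bv; apply: pW.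
rewrite [X in p X](_ : _ = h^-1 *: (A (t + h) v - A t v - h *: L v)); last first.
  by rewrite [RHS]scalerBr scalerA mulVf// scale1r.
rewrite csemiZ// normfV mulrC ltr_pdivrMr ?normr_gt0// mul1r.
rewrite (le_lt_trans (hd h v hh Bv))//.
have h1 : 0 < `|h| by rewrite normr_gt0.
lra.
Qed.

Lemma exists_bmlin (m : epow E n -> F) : multilinear_map m -> bounded_map m ->
  exists b : bmlin E F n, forall v, b v = m v.
Proof.
move=> lm bm; have mP : m \in @bmlin_pred R E F n by apply/asboolP.
by exists (Bmlin mP).
Qed.

End bmlin_curves.

Section concatenation.
Context {R : realType} {E : lcsType R}.

(** The recursion follows [differential], which takes the directions off the
    front one by one. *)
Fixpoint fcat m n : epow E m -> epow E n -> epow E (m + n) :=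
  match m with
  | 0 => fun _ v => v
  | m'.+1 => fun w v => fcons (w ord0) (fcat (ftail w) v)
  end.

Lemma fcat_dfwith m n (w : epow E m) (v : epow E n) i x :
  fcat w (@dfwith _ (fun=> E) v i x) = @dfwith _ (fun=> E) (fcat w v) (rshift m i) x.
Proof.
elim: m w => [|m IH] w /=.
  by have -> : rshift 0 i = i :> 'I_n by exact/val_inj.
have E1 : rshift m.+1 i = lift ord0 (rshift m i) by exact/val_inj.
rewrite IH; apply/funext => j; rewrite E1.
case: (unliftP ord0 j) => [k ->|->]; last first.
  by rewrite fcons0 dfwithout ?fcons0// eq_sym neq_lift.
rewrite -[LHS]/(ftail (fcons _ _) k) ftail_fcons.
have [->|ki] := eqVneq k (rshift m i); first by rewrite !dfwithin.
have ik : rshift m i != k by rewrite eq_sym.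
have lik : lift ord0 (rshift m i) != lift ord0 k.
  by apply: contra ik => /eqP/lift_inj ->.
by rewrite (dfwithout _ _ ik) (dfwithout _ _ lik) -[RHS]/(ftail (fcons _ _) k) ftail_fcons.
Qed.

Lemma fcat_bounded m n (B : set (epow E m)) (B' : set (epow E n)) :
  tvs_bounded B -> tvs_bounded B' ->
  tvs_bounded [set u | exists w v, [/\ B w, B' v & u = fcat w v]].
Proof.
move=> /epow_bounded bB /epow_bounded bB'; apply/epow_bounded.
suff H i p : csemi p -> exists M, forall w v, B w -> B' v -> p (fcat w v i) <= M.
  by move=> i p cp; have [M hM] := H i p cp; exists M => _ [w [v [Bw Bv ->]]]; exact: hM.
move=> cp; elim: m B bB i => [|m IH] B bB i /=.
  by have [M hM] := bB' i p cp; exists M => w v _; exact: hM.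
rewrite /fcons; case: (unliftP ord0 i) => [j _|_] /=; last first.
  by have [M hM] := bB ord0 p cp; exists M => w v Bw _; exact: hM.
have [|M hM] := IH (@ftail R E m @` B) _ j.
  move=> k q cq; have [M hM] := bB (lift ord0 k) q cq.
  by exists M => _ [w Bw <-]; exact: hM.
by exists M => w v Bw Bv; apply: hM => //; exists w.
Qed.

End concatenation.

Section differential_map.
Context {R : realType} {E F : lcsType R} (U : set E) (p : nat).
Hypotheses (openU : open U) (cF : uniform_complete F).

Lemma dext_bmlin (f : U -> F) : smooth f ->
  exists Df : U -> bmlin E F p, forall x v, Df x v = dext f (\val x) v.
Proof.
move=> sf; suff /choice[Df DfE] : forall x : U, exists b : bmlin E F p,
    forall v, b v = dext f (\val x) v by exists Df.
move=> x; apply: exists_bmlin; first exact: (multilinear_dext openU cF sf).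
by apply: (bounded_dext openU cF sf); exact: (set_mem (valP x)).
Qed.

Section smoothness.
Variables (f : U -> F) (Df : U -> bmlin E F p).
Hypotheses (sf : smooth f) (DfE : forall x v, Df x v = dext f (\val x) v).

(** Along a smooth curve all [t]-derivatives of the differential are bounded
    multilinear maps and are derivatives uniformly on bounded sets. *)
Lemma smooth_Df : smooth Df.
Proof.
move=> c sc; have cU t : U (\val (c t)) by exact: (set_mem (valP (c t))).
have sG := @csmooth_dext R E F U openU cF f sf p.
have lG x (_ : U x) := @multilinear_dext R E F U openU cF f sf p x.
pose g v t := dext f (\val (c t)) (v : epow E p).
have sg v : smooth_curve (g v) := smooth_along sG sc cU v.
have /choice[d hd] : forall jt : nat * R, exists b : bmlin E F p,
    forall v, b v = cder jt.1 (g v) jt.2.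
  move=> [j t] /=; apply: exists_bmlin.
    move=> i v a x y; pose dv x := @dfwith _ (fun=> E) v i x.
    have -> : g (dv (a *: x + y)) = (fun t => a *: g (dv x) t + g (dv y) t).
      by apply/funext => s; exact: lG (cU s) _ _ _ _ _.
    rewrite cderD//; last exact: smoothZ.
    by rewrite cderZ.
  move=> B bB; apply/tvs_bounded_csemi => q cq.
  have [e e0 [M hM]] := locally_bounded_on sG lG sc cU bB j t cq.
  exists M => _ [v Bv <-]; have := hM 0 v; rewrite normr0 addr0; exact.
have dd j t : der (fun t => d (j, t)) t (d (j.+1, t)).
  apply: der_bmlin => B q e bB cq e0.
  have [r r0 hr] := uniform_der sG lG sc cU bB j t cq e0.
  by exists r => // h v hh Bv; rewrite !hd; exact: hr.
have := smooth_tower dd; apply: smooth_ext => t; apply/val_inj/funext => v.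
by rewrite [LHS]hd [RHS]DfE.
Qed.

(** The directional derivatives of [g] are limits uniformly on bounded sets, by
    [uniform_der], so they exist as multilinear maps and are determined by
    evaluation at [v]. *)
Lemma differential_Df m (x : U) (w : epow E m) (v : epow E p) :
  differential Df x w v = dext f (\val x) (fcat w v).
Proof.
elim: m x w v => [|m IH] x w v; first exact: DfE.
have Ux : U (\val x) by exact: (set_mem (valP x)).
pose u := w ord0; pose w' := ftail w.
pose g y := differential Df y w'.
have sG := @csmooth_dext R E F U openU cF f sf (m + p).
have lG y (_ : U y) := @multilinear_dext R E F U openU cF f sf (m + p) y.
have [L hL] : exists L : bmlin E F p, forall v, L v = dext f (\val x) (fcat w v).
  apply: exists_bmlin => [i v' a y z|B bB].
    by rewrite !fcat_dfwith; exact: multilinear_dext.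
  have bB' := fcat_bounded (@tvs_bounded1_epow _ _ _ w) bB.
  apply: tvs_boundedS (bounded_dext openU cF sf Ux bB') => _ [v' Bv' <-].
  by exists (fcat w v') => //; exists w, v'.
suff : der (fun h => 'valL_0 g (\val x + h *: u)) 0 L.
  move=> /ddirE dL; rewrite -hL -dL; congr (bmlin_fun _ v).
  by rewrite /= /dir_derive /ddir valL0E.
apply: der_bmlin => B q e bB cq e0.
have [d d0 hd] := tube openU (t := 0) (smooth_cst (\val x)) (smooth_cst u) Ux.
have d20 : 0 < d / 2 by rewrite divr_gt0.
pose c h := \val x + cutoff d h *: u.
have sc : smooth_curve c.
  apply: smoothD; first exact: smooth_cst.
  by apply: smoothM; [exact: smooth_cutoff|exact: smooth_cst].
have cU h : U (c h) by apply: (hd _ 0); [exact: cutoff_lt|rewrite normr0].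
have bB' := fcat_bounded (@tvs_bounded1_epow _ _ _ w') bB.
have [r r0 hr] := uniform_der sG lG sc cU bB' 0 0 cq e0.
exists (Num.min r (d / 2)); first by rewrite lt_min r0.
move=> h v'; rewrite lt_min => /andP[/hr H /ltW hd2] Bv'.
have {}H := H (fcat w' v') (ex_intro _ w' (ex_intro _ v' (And3 erefl Bv' erefl))).
have gE k : `|k| <= d / 2 -> 'valL_0 g (\val x + k *: u) v' = dext f (c k) (fcat w' v').
  move=> kd; have ck : c k = \val x + k *: u by rewrite /c cutoff_id.
  by rewrite -ck -[c k]/(\val (SigSub (mem_set (cU k)) : U)) valL0E /g IH.
rewrite add0r !gE ?normr0 ?(ltW d20)// hL.
have <- : cder 1 (fun t => dext f (c t) (fcat w' v')) 0 = dext f (\val x) (fcat w v').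
  rewrite -[fcat w v']/(fcons u (fcat w' v')) [RHS]dextS// ftail_fcons fcons0.
  apply: curve_deriveE.
  have sl : usmooth U (fun y => dext f y (fcat w' v')) by exact: csmooth_usmooth.
  apply: der_near d20 _ (der_line openU u sl Ux) => k /ltW kd.
  by rewrite !add0r /c cutoff_id.
by move: H; rewrite add0r.
Qed.

End smoothness.

End differential_map.

Theorem theorem14p1 (R : realType) (E F : lcsType R) (U : set E)
    (completeF : uniform_complete F) (openU : open U) :
  uniform_complete (Cinfty U F) /\
  forall p : nat,
    exists2 D : Cinfty U F -> Cinfty U (bmlin E F p),
      (forall (f : Cinfty U F) (x : U) (v : epow E p),
         \val (D f) x v = differential (\val f) x v) &
      continuous D.
Proof.
split; first exact: complete_Cinfty.
move=> p.
have /choice[D hD] : forall f : Cinfty U F, exists g : Cinfty U (bmlin E F p),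
    forall x v, \val g x v = dext (\val f) (\val x) v.
  move=> f; have [Df DfE] := @dext_bmlin R E F U p openU completeF _ (Cinfty_smooth f).
  have sDf := smooth_Df openU completeF (Cinfty_smooth f) DfE.
  by exists (SigSub (mem_set (sDf : [set f : U -> bmlin E F p | smooth f] Df))).
exists D; first by move=> f x v; rewrite hD dextE.
move=> f; have FD : Filter (D @ nbhs f) := fmap_filter _ (nbhs_filter f).
apply: (cvg_Cinfty FD) => m K B W cK KU bB /bmlin_nbhsP[B' [W' [bB' W'0 W'W]]].
have := nbhs_Cinfty f cK KU (fcat_bounded bB bB') W'0.
rewrite near_simpl; apply: filterS => g fg x w Kx Bw; apply: W'W => v Bv.
rewrite subr0 [X in W' X](_ : _ = differential (\val (D g)) x w v -
  differential (\val (D f)) x w v)//.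
rewrite (differential_Df openU completeF (Cinfty_smooth g) (hD g)).
rewrite (differential_Df openU completeF (Cinfty_smooth f) (hD f)).
by rewrite !dextE; apply: fg => //; exists w, v.
Qed.
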